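(* Let $M\in\mathbb{R}^{d\times d}$ and $\theta\in\mathbb{R}^d$. At each time $t\ge1$ a learner pulls an arm $x_t$ from a bounded set $D\subset\mathbb{R}^d$ containing the unit sphere and observes $r_t(x_t):=(M^t\theta)^\top x_t+\eta_t$, where the noise is conditionally $R$-sub-Gaussian ($R\ge0$): there is an increasing filtration $(\mathcal{F}_\tau)$ with $x_1,\dots,x_{\tau+1},\eta_1,\dots,\eta_\tau$ $\mathcal{F}_\tau$-measurable, $\mathbb{E}[\eta_t\mid\mathcal{F}_{t-1}]=0$, $\mathrm{Var}[\eta_t\mid\mathcal{F}_{t-1}]\le R^2$, $\mathbb{E}[e^{\lambda\eta_t}\mid\mathcal{F}_{t-1}]\le e^{\lambda^2R^2/2}$ for all $\lambda$. Assume $\{M^t\theta\}_{t\ge1}$ lies in the ball of radius $B>0$ and $(M^t\theta)_{t=t_0}^\infty$ is $\mu$-nearly periodic of length $L$ for some $t_0>0$, $\mu\ge0$, $L\in\mathbb{Z}_{>0}$. Given $\delta\in(0,1]$, let $N$ be an integer with $N\ge2d^2$ and \[N\ge\max\left\{16L^2,\ \frac{-(d-1)\log\Delta}{\Delta}+\frac{\log(B\kappa^2)+d+6}{\Delta}+d\right\},\qquad \gamma(N):=\frac{\sqrt{4d^2R^2\log(4d^2/\delta)}+1}{\sqrt N}.\] Run Algorithm 2: draw $\tilde x_1,\dots,\tilde x_d$ independently and uniformly from the unit sphere of $\mathbb{R}^d$; during times $1,\dots,N$ the observations are not used; for $t=N+1,\dots,N+2Nd^2$ let $m_0:=((t-N-1)\bmod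 2d^2)+1$, $m:=\lceil m_0/(2d)\rceil$, pull $x_t=\tilde x_m$ and observe $r_t(\tilde x_m)$. For $s=0,1$ form $A_s(N)\in\mathbb{C}^{d\times d}$ with $(k,\ell)$ entry $\frac1N\sum_{j=0}^{N-1}r_{2(k-1)d+sd+2d^2j+N+\ell}(\tilde x_k)e^{i2\pi j^2/(4L)}$; let $\hat A_0(N)$ be the low rank approximation of $A_0(N)$ via the singular value threshold $\gamma(N)$, and output $A_1(N)\hat A_0(N)^\dagger$. Then there exists a matrix $A$ whose eigenvalues are zero except for $(\theta,1,d)$-distinct eigenvalues of $M$ such that, with probability at least $1-\delta$, \[\left\|A-A_1(N)\hat A_0(N)^\dagger\right\|\le C\,\frac{R^2(\log(1/\delta)+1)+1}{\sqrt N},\] where $C>0$ is a constant depending on $\theta$, $M$, $d$, $(\tilde x_m)_{m=1}^d$, and $L$ (through the constants in the bounds on the Weyl sums $\sum_{j=0}^{N}e^{i2\pi(2bj+j^2)/(4L)}$).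
   Context: $\|\cdot\|$ is the spectral norm and $\dagger$ the Moore–Penrose pseudoinverse. A sequence $(y_t)$ in $\mathbb{R}^d$ is $\mu$-nearly periodic of length $L$ if $\|y_{s+Lt}-y_s\|<\mu$ for all $s,t\in\mathbb{Z}_{>0}$. $\kappa:=\inf\{\|P\|\|P^{-1}\|: P^{-1}MP=J_M\}\ge1$ where $J_M$ is a Jordan normal form of $M$; $\Delta\in(0,1]$ is such that every eigenvalue $\alpha$ of $M$ with $|\alpha|<1$ satisfies $|\alpha|\le1-\Delta$. Low rank approximation via singular value threshold $\gamma$: if $A=U\,\mathrm{diag}(\sigma_1,\dots,\sigma_r,0,\dots)V^*$ is an SVD, $A_\gamma:=U\,\mathrm{diag}(\mathbf{1}_{[\gamma,\infty)}(\sigma_1)\sigma_1,\dots,\mathbf{1}_{[\gamma,\infty)}(\sigma_r)\sigma_r,0,\dots)V^*$. Let $W:=\mathrm{span}_{\mathbb{C}}\{M\theta,M^2\theta,\dots\}$; for $k\in\mathbb{Z}_{>0}$, a $(\theta,1,k)$-distinct eigenvalue of $M$ is an eigenvalue $\beta$ of $M^k|_W$ with $|\beta|=1$ and $\theta_\beta\ne0$, where $\theta_\beta$ is the component of $\theta$ in the generalized eigenspace of $M^k$ for $\beta$. *)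

(* Defs.v *)
From mathcomp Require Import all_boot all_order all_algebra.
From mathcomp Require Import complex.
From mathcomp Require Import all_classical all_reals all_analysis.

Set Implicit Arguments.
Unset Strict Implicit.
Unset Printing Implicit Defensive.

Import Order.TTheory GRing.Theory Num.Theory.
Import numFieldNormedType.Exports.

Local Open Scope classical_set_scope.
Local Open Scope ring_scope.
Local Open Scope sesquilinear_scope.

Section Norms.
Variable R : realType.

Definition l2norm n (v : 'cV[R]_n) : R := Num.sqrt (\sum_i v i ord0 ^+ 2).

Definition cmod (z : R[i]) : R := ComplexField.Normc.normc z.

Definition cl2norm n (v : 'cV[R[i]]_n) : R :=
  Num.sqrt (\sum_i cmod (v i ord0) ^+ 2).

Definition spectral_norm n (A : 'M[R[i]]_n) : R :=
  sup [set cl2norm (A *m v) | v in [set v : 'cV[R[i]]_n | cl2norm v <= 1]].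

Definition cexpi (y : R) : R[i] := Complex (cos y) (sin y).

Definition cmx m n (A : 'M[R]_(m, n)) : 'M[R[i]]_(m, n) :=
  map_mx (real_complex R) A.

End Norms.

Section MatrixDecompositions.
Variable R : realType.
Variable n : nat.
Implicit Types A B J P X U V : 'M[R[i]]_n.

Definition is_moore_penrose A X : Prop :=
  [/\ A *m X *m A = A, X *m A *m X = X,
      (A *m X)^t* = A *m X & (X *m A)^t* = X *m A].

(* There is always exactly one such X, so the default value 0 is never used. *)
Definition moore_penrose A : 'M[R[i]]_n := xget 0 [set X | is_moore_penrose A X].

Definition real_diag (s : 'I_n -> R) : 'M[R[i]]_n :=
  diag_mx (\row_i real_complex R (s i)).

(* The vanishing singular values are part of s; no ordering of s is imposed,
   as reordering s (with the columns of U and V) does not change truncations. *)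
Definition is_svd A U (s : 'I_n -> R) V : Prop :=
  [/\ U \is unitarymx, V \is unitarymx, (forall i, 0 <= s i)
    & A = U *m real_diag s *m V^t*].

(* The truncated matrix does not depend on the SVD, which always exists, so
   that the default value 0 is never used. *)
Definition low_rank_approx (gamma : R) A : 'M[R[i]]_n :=
  xget 0 [set B | exists U s V, is_svd A U s V /\
    B = U *m real_diag (fun i => if gamma <= s i then s i else 0) *m V^t*].

Definition is_jordan J : Prop :=
  [/\ (forall i j : 'I_n, j != i :> nat -> j != i.+1 :> nat -> J i j = 0)
    & (forall i j : 'I_n, j = i.+1 :> nat ->
         J i j = 0 \/ (J i j = 1 /\ J i i = J j j))].

Definition is_jordan_form_of A J : Prop :=
  is_jordan J /\ exists2 P, P \in unitmx & invmx P *m A *m P = J.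

Definition jordan_condition A J : R :=
  inf [set r : R | exists P, [/\ P \in unitmx, invmx P *m A *m P = J
                               & r = spectral_norm P * spectral_norm (invmx P)]].

End MatrixDecompositions.

Section DistinctEigenvalues.
Variable R : realType.
Variable n : nat.
Implicit Types (M : 'M[R[i]]_n) (theta v w u : 'cV[R[i]]_n).

(* u is the b-component of v in the decomposition of the whole space into the
   generalized eigenspaces of M; transposes because geigenspace consists of
   row vectors. *)
Definition is_geigen_component M (b : R[i]) v u : Prop :=
  exists (s : seq R[i]) (f : R[i] -> 'cV[R[i]]_n),
    [/\ uniq s, b \in s,
        (forall a, a \in s -> ((f a)^T <= geigenspace M^T a)%MS),
        v = \sum_(a <- s) f a
      & u = f b].

Definition orbit_span M theta : set 'cV[R[i]]_n :=
  [set w | exists (m : nat) (c : 'I_m -> R[i]),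
     w = \sum_(i < m) c i *: (M ^+ i.+1 *m theta)].

(* (theta, 1, k)-distinct eigenvalues of M *)
Definition distinct_eigenvalue M theta (k : nat) (b : R[i]) : Prop :=
  [/\ (exists w, [/\ orbit_span M theta w, w != 0 & M ^+ k *m w = b *: w]),
      cmod b = 1
    & (exists2 u, is_geigen_component (M ^+ k) b theta u & u != 0)].

End DistinctEigenvalues.

(* A sequence y_1, y_2, ... is encoded by a function on nat whose value at 0 is
   irrelevant. *)
Definition nearly_periodic (R : realType) n (mu : R) (L : nat)
    (y : nat -> 'cV[R]_n) : Prop :=
  forall s t : nat, (0 < s)%N -> (0 < t)%N ->
    l2norm (y (s + L * t)%N - y s) < mu.

Section Probability.
Context {R : realType} {disp : measure_display} {Omega : measurableType disp}.
Variable P : probability Omega R.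
Implicit Types (G : set (set Omega)) (X Y V : Omega -> R).

Definition measurable_wrt T (B : set (set T)) G (f : Omega -> T) : Prop :=
  forall S, B S -> G (f @^-1` S).

Definition Borel : set (set R) := [set S | measurable S].

(* Borel sets of R^n, as the product sigma-algebra *)
Definition vBorel (n : nat) : set (set 'cV[R]_n) :=
  g_sigma_preimage (fun (i : 'I_n) (v : 'cV[R]_n) => v i ord0).

(* Y is a version of E[X | G] *)
Definition is_condexp G X Y : Prop :=
  [/\ P.-integrable setT (EFin \o X), measurable_wrt Borel G Y,
      P.-integrable setT (EFin \o Y)
    & forall A, G A ->
        (\int[P]_(w in A) (Y w)%:E = \int[P]_(w in A) (X w)%:E)%E].

(* V is a version of Var[X | G] *)
Definition is_condvar G X V : Prop :=
  exists2 Y, is_condexp G X Y & is_condexp G (fun w => (X w - Y w) ^+ 2) V.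

Definition filtration (F : nat -> set (set Omega)) : Prop :=
  [/\ (forall t, sigma_algebra setT (F t)), (forall t, F t `<=` measurable)
    & (forall s t, (s <= t)%N -> F s `<=` F t)].

(* rho is the sub-Gaussian parameter. Index 0 of x and eta is unused, whereas
   F 0 is the information available before the first observation. *)
Definition cond_sub_gaussian_noise n (rho : R) (F : nat -> set (set Omega))
    (x : nat -> Omega -> 'cV[R]_n) (eta : nat -> Omega -> R) : Prop :=
  [/\ filtration F,
      (forall tau t, (0 < t <= tau.+1)%N ->
         measurable_wrt (@vBorel n) (F tau) (x t)),
      (forall tau t, (0 < t <= tau)%N -> measurable_wrt Borel (F tau) (eta t))
    & forall t, (0 < t)%N ->
        [/\ is_condexp (F t.-1) (eta t) (cst 0),
            (exists2 V, is_condvar (F t.-1) (eta t) V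
                      & {ae P, forall w, V w <= rho ^+ 2})
          & forall lambda : R,
              exists2 Y,
                is_condexp (F t.-1) (fun w => expR (lambda * eta t w)) Y
              & {ae P, forall w, Y w <= expR (lambda ^+ 2 * rho ^+ 2 / 2)}]].

Definition mutually_independent n k (X : 'I_k -> Omega -> 'cV[R]_n) : Prop :=
  forall (I : {set 'I_k}) (B : 'I_k -> set 'cV[R]_n),
    (forall i, vBorel (B i)) ->
    P (\bigcap_(i in [set` I]) (X i @^-1` B i)) =
    (\prod_(i in I) P (X i @^-1` B i))%E.

(* The uniform distribution on the unit sphere is the unique Borel probability
   measure on the sphere that is invariant under the orthogonal group. *)
Definition uniform_on_sphere n (X : Omega -> 'cV[R]_n) : Prop :=
  [/\ measurable_wrt (@vBorel n) measurable X,
      (forall w, l2norm (X w) = 1)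
    & forall Q : 'M[R]_n, Q^T *m Q = 1%:M ->
        forall B, vBorel B ->
          P ((fun w => Q *m X w) @^-1` B) = P (X @^-1` B)].

End Probability.

Section Algorithm.
Variable R : realType.
Variable d : nat.

(* The 1-based index m of the arm pulled at time t; since m = ceil(m0 / (2d))
   with m0 >= 1, the ceiling is computed by shifting the numerator. *)
Definition arm_slot (N t : nat) : nat :=
  let m0 := ((t - N - 1) %% (2 * d ^ 2)).+1%N in
  ((m0 + (2 * d - 1)) %/ (2 * d))%N.

Definition reward (M : 'M[R]_d) (theta : 'cV[R]_d) (noise : nat -> R)
    (t : nat) (v : 'cV[R]_d) : R :=
  ((M ^+ t *m theta)^T *m v) ord0 ord0 + noise t.

(* k and l are 0-based, whence k instead of k - 1 and l.+1 instead of l. *)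
Definition weyl_matrix (M : 'M[R]_d) (theta : 'cV[R]_d) (noise : nat -> R)
    (X : 'I_d -> 'cV[R]_d) (L N s : nat) : 'M[R[i]]_d :=
  \matrix_(k < d, l < d)
    ((N%:R)^-1 * \sum_(j < N)
       real_complex R
         (reward M theta noise
            (2 * k * d + s * d + 2 * d ^ 2 * j + N + l.+1)%N (X k))
       * cexpi (2 * pi * (j%:R) ^+ 2 / (4 * L%:R))).

Definition sv_threshold (rho delta : R) (N : nat) : R :=
  (Num.sqrt (4 * d%:R ^+ 2 * rho ^+ 2 * ln (4 * d%:R ^+ 2 / delta)) + 1)
  / Num.sqrt N%:R.

Definition algorithm_output (M : 'M[R]_d) (theta : 'cV[R]_d)
    (noise : nat -> R) (X : 'I_d -> 'cV[R]_d) (L N : nat) (rho delta : R) :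
    'M[R[i]]_d :=
  weyl_matrix M theta noise X L N 1 *m
  moore_penrose (low_rank_approx (sv_threshold rho delta N)
                   (weyl_matrix M theta noise X L N 0)).

End Algorithm.

(* Main.v *)
(* Decompose theta into its generalized eigencomponents f_a. Since the orbit is
   bounded, f_a = 0 when |a| > 1 and f_a is an eigenvector when |a| = 1, while
   M^t f_a is summable when |a| < 1. The chirp e^(2 pi i j^2 / (4 L)) has period
   2 L in j, so the Weyl sum of z^j over j < n, with |z| = 1, is n c(z) + O(1).
   Hence
   A_s(N) = P Lambda^s Q + noise + O(1/N), where the columns of P are indexed by
   the eigenvalues a with c != 0 and depend only on the arms, Lambda is diagonal
   with entries a^d, and Q has a right inverse bounded independently of N. P has
   independent columns almost surely, because each arm avoids the hyperplane
   determined by the previous ones, and then A = P Lambda (P^* P)^-1 P^*.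
   Outside an event of probability delta the noise is below gamma(N) - N^(-1/2)
   in Frobenius norm, so the truncation has rank at most that of P, its
   pseudoinverse is bounded, and A_1 pinv(hat A_0) differs from A by
   O(gamma(N)). *)

(* The constant is a function of the arms that is fixed before [N], [rho], [delta] and the noise, so
   every estimate has to be uniform in these. In the signal part, [N] enters only through unimodular
   factors [a ^+ N], which do not change the size of a right inverse of Q. Rates may lose factors
   depending on d and are computed in a submultiplicative entrywise norm. The rank argument can
   afford no such loss: noise plus bias is compared strictly with gamma(N), vector by vector, in the
   Euclidean norm. The summand N^(-1/2) of gamma(N) is the room left for the bias O(1/N); it
   suffices once gamma(N) lies below a constant depending on the arms, and larger values of gamma(N)
   are treated by a cruder bound. The noise part of A_s does not involve the arms, so its
   exceptional event and the null event of degenerate arms are built separately and only united at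
   the end. *)
Require Import Defs.
From HB Require Import structures.
From mathcomp Require Import all_boot all_order all_algebra.
From mathcomp Require Import complex zify ring lra.
From mathcomp Require Import all_classical all_reals all_analysis measurable_realfun.

Set Implicit Arguments.
Unset Strict Implicit.
Unset Printing Implicit Defensive.

Import Order.TTheory GRing.Theory Num.Theory.
Import numFieldNormedType.Exports.

Local Open Scope classical_set_scope.
Local Open Scope ring_scope.
Local Open Scope sesquilinear_scope.

(** * Norms of complex matrices *)

Section ComplexNorms.
Variable R : realType.
Local Notation C := R[i].
Implicit Types z w : C.

Lemma cmod_ge0 z : 0 <= cmod z.
Proof. by case: z => a b; exact: sqrtr_ge0. Qed.

Lemma cmod0 : cmod (0 : C) = 0.
Proof. exact: ComplexField.Normc.normc0. Qed.

Lemma cmod1 : cmod (1 : C) = 1.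
Proof. exact: ComplexField.Normc.normc1. Qed.

Lemma cmodM z w : cmod (z * w) = cmod z * cmod w.
Proof. exact: ComplexField.Normc.normcM. Qed.

Lemma cmodN z : cmod (- z) = cmod z.
Proof. by case: z => a b; rewrite /cmod /= !sqrrN. Qed.

Lemma cmodV z : cmod z^-1 = (cmod z)^-1.
Proof. exact: ComplexField.Normc.normcV. Qed.

Lemma normC_cmod z : `|z| = (cmod z)%:C%C.
Proof. by case: z. Qed.

Lemma cmodD z w : cmod (z + w) <= cmod z + cmod w.
Proof. by have := ler_normD z w; rewrite !normC_cmod -rmorphD lecR. Qed.

Lemma cmodX z n : cmod (z ^+ n) = cmod z ^+ n.
Proof. by elim: n => [|n IHn]; rewrite ?expr0 ?cmod1 // !exprS cmodM IHn. Qed.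

Lemma cmod_eq0 z : (cmod z == 0) = (z == 0).
Proof.
apply/eqP/eqP => [|->]; last exact: cmod0.
exact: ComplexField.Normc.eq0_normc.
Qed.

Lemma cmod_gt0 z : (0 < cmod z) = (z != 0).
Proof. by rewrite lt_neqAle cmod_ge0 eq_sym cmod_eq0 andbT. Qed.

Lemma cmodE z : cmod z ^+ 2 = complex.Re z ^+ 2 + complex.Im z ^+ 2.
Proof. by case: z => a b /=; rewrite sqr_sqrtr // addr_ge0 ?sqr_ge0. Qed.

Lemma cmodJ z : cmod (conjc z) = cmod z.
Proof. by case: z => a b; rewrite /cmod /= sqrrN. Qed.

Lemma cmod_real (x : R) : cmod x%:C%C = `|x|.
Proof. by rewrite /cmod /= expr0n addr0 sqrtr_sqr. Qed.

Lemma cmod_sum (I : Type) (s : seq I) (p : pred I) (f : I -> C) :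
  cmod (\sum_(i <- s | p i) f i) <= \sum_(i <- s | p i) cmod (f i).
Proof.
elim/big_rec2: _ => [|i y x _ le_xy]; first by rewrite cmod0.
by apply: le_trans (cmodD _ _) _; rewrite lerD2l.
Qed.

Lemma trC_mul m n p (A : 'M[C]_(m, n)) (B : 'M[C]_(n, p)) :
  (A *m B)^t* = B^t* *m A^t*.
Proof. by rewrite trmx_mul map_mxM. Qed.

Lemma trC_eq m n (A B : 'M[C]_(m, n)) : A^t* = B^t* -> A = B.
Proof. by move=> AB; rewrite -[A]trmxCK AB trmxCK. Qed.

Lemma trC0 m n : (0 : 'M[C]_(m, n))^t* = 0.
Proof. by rewrite trmx0 map_mx0. Qed.

(** This norm is submultiplicative for all rectangular shapes. Estimates that may lose a dimensional
    factor are made in it; the comparison of the noise with the threshold uses [cl2norm] instead. *)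
Definition mxnorm1 m n (A : 'M[C]_(m, n)) : R := \sum_i \sum_j cmod (A i j).

Lemma mxnorm1_ge0 m n (A : 'M[C]_(m, n)) : 0 <= mxnorm1 A.
Proof. by do 2![apply: sumr_ge0 => ? _]; exact: cmod_ge0. Qed.

Lemma mxnorm1D m n (A B : 'M[C]_(m, n)) :
  mxnorm1 (A + B) <= mxnorm1 A + mxnorm1 B.
Proof.
rewrite /mxnorm1 -big_split ler_sum// => i _; rewrite -big_split ler_sum// => j _.
by rewrite mxE cmodD.
Qed.

Lemma mxnorm1N m n (A : 'M[C]_(m, n)) : mxnorm1 (- A) = mxnorm1 A.
Proof. by do 2![apply: eq_bigr => ? _]; rewrite mxE cmodN. Qed.

Lemma mxnorm1B m n (A B : 'M[C]_(m, n)) :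
  mxnorm1 (A - B) <= mxnorm1 A + mxnorm1 B.
Proof. by rewrite -(mxnorm1N B) mxnorm1D. Qed.

Lemma le_mxnorm1_entry m n (A : 'M[C]_(m, n)) i j : cmod (A i j) <= mxnorm1 A.
Proof.
rewrite /mxnorm1 (bigD1 i)//= (bigD1 j)//= -addrA lerDl addr_ge0 ?sumr_ge0//.
  by move=> *; exact: cmod_ge0.
by move=> *; apply: sumr_ge0 => *; exact: cmod_ge0.
Qed.

Lemma mxnorm1_le m n (A : 'M[C]_(m, n)) c :
  (forall i j, cmod (A i j) <= c) -> mxnorm1 A <= m%:R * n%:R * c.
Proof.
move=> Ac; rewrite -natrM mulr_natl.
rewrite (le_trans (ler_sum _ (fun i _ => ler_sum _ (fun j _ => Ac i j))))//.
by rewrite !(sumr_const, card_ord) -mulrnA mulnC.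
Qed.

Lemma mxnorm1M m n p (A : 'M[C]_(m, n)) (B : 'M[C]_(n, p)) :
  mxnorm1 (A *m B) <= mxnorm1 A * mxnorm1 B.
Proof.
rewrite /mxnorm1 mulr_suml ler_sum// => i _.
apply: (@le_trans _ _ (\sum_k \sum_j cmod (A i j) * cmod (B j k))).
  apply: ler_sum => k _; rewrite mxE (le_trans (cmod_sum _ _ _))//.
  by apply: ler_sum => j _; rewrite cmodM.
rewrite exchange_big mulr_suml ler_sum//= => j _.
rewrite -mulr_sumr ler_wpM2l ?cmod_ge0// [leRHS](bigD1 j)//= lerDl sumr_ge0//.
by move=> *; apply: sumr_ge0 => *; exact: cmod_ge0.
Qed.

Lemma mxnorm1_trC m n (A : 'M[C]_(m, n)) : mxnorm1 (A^t*) = mxnorm1 A.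
Proof.
rewrite /mxnorm1 exchange_big; do 2![apply: eq_bigr => ? _].
by rewrite !mxE; exact: cmodJ.
Qed.

Lemma mxnorm1_eq0 m n (A : 'M[C]_(m, n)) : mxnorm1 A = 0 -> A = 0.
Proof.
move=> A0; apply/matrixP => i j; rewrite mxE; apply/eqP; rewrite -cmod_eq0.
by rewrite eq_le cmod_ge0 andbT -A0 le_mxnorm1_entry.
Qed.

Lemma mulmx_trC_self n (v : 'cV[C]_n) :
  (v^t* *m v) ord0 ord0 = (cl2norm v ^+ 2)%:C%C.
Proof.
rewrite mxE sqr_sqrtr ?sumr_ge0// => [|i _]; last exact: sqr_ge0.
rewrite rmorph_sum; apply: eq_bigr => i _; rewrite !mxE.
by rewrite (rmorphXn (real_complex R)) mulrC -normCK; congr (_ ^+ 2).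
Qed.

Lemma cl2norm_ge0 n (v : 'cV[C]_n) : 0 <= cl2norm v.
Proof. exact: sqrtr_ge0. Qed.

Lemma cl2norm_eq0 n (v : 'cV[C]_n) : cl2norm v = 0 -> v = 0.
Proof.
move=> v0; apply/colP => i; rewrite mxE; apply/eqP; rewrite -cmod_eq0.
move/eqP: v0; rewrite sqrtr_eq0 le_eqVlt ltNge sumr_ge0 ?orbF; last first.
  by move=> *; exact: sqr_ge0.
rewrite psumr_eq0 => [/allP/(_ i (mem_index_enum _))|*]; last exact: sqr_ge0.
by rewrite sqrf_eq0.
Qed.

Lemma cl2norm_unitary n (U : 'M[C]_n) (v : 'cV[C]_n) :
  U \is unitarymx -> cl2norm (U *m v) = cl2norm v.
Proof.
rewrite -trmxC_unitary => /unitarymxP; rewrite trmxCK => UU.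
apply/eqP; rewrite -(@eqrXn2 _ 2) ?cl2norm_ge0//; apply/eqP/complexI.
rewrite -!mulmx_trC_self trmx_mul map_mxM -mulmxA (mulmxA _ U).
by rewrite UU mul1mx.
Qed.

Lemma cl2norm_le_mxnorm1 n (v : 'cV[C]_n) : cl2norm v <= mxnorm1 v.
Proof.
rewrite /cl2norm -(ler_pXn2r (n:=2)) ?nnegrE ?sqrtr_ge0 ?mxnorm1_ge0//.
rewrite sqr_sqrtr ?sumr_ge0// => [|i _]; last exact: sqr_ge0.
rewrite expr2 {1}/mxnorm1 mulr_suml ler_sum// => i _.
by rewrite big_ord1 expr2 ler_wpM2l ?cmod_ge0 ?le_mxnorm1_entry.
Qed.

Lemma cmod_le_cl2norm n (v : 'cV[C]_n) i : cmod (v i ord0) <= cl2norm v.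
Proof.
rewrite /cl2norm -(ler_pXn2r (n:=2)) ?nnegrE ?sqrtr_ge0 ?cmod_ge0//.
rewrite sqr_sqrtr ?sumr_ge0// => [|j _]; last exact: sqr_ge0.
by rewrite (bigD1 i)//= lerDl sumr_ge0// => *; exact: sqr_ge0.
Qed.

Lemma spectral_norm_le n (A : 'M[C]_n) :
  spectral_norm A <= n%:R * mxnorm1 A.
Proof.
apply: ge_sup => [|_ [v v1 <-]].
  by exists (cl2norm (A *m 0)), 0 => //=; rewrite /cl2norm big1 ?sqrtr0// => i _;
    rewrite mxE cmod0 expr0n.
rewrite (le_trans (cl2norm_le_mxnorm1 _))// (le_trans (mxnorm1M _ _))//.
rewrite mulrC ler_wpM2r ?mxnorm1_ge0//.
have := @mxnorm1_le _ _ v 1; rewrite !mulr1; apply => i j.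
by rewrite ord1 (le_trans (cmod_le_cl2norm _ _)).
Qed.

(** Cauchy-Schwarz: the quadratic [\sum_i (x * a i - b i) ^+ 2] is nonnegative at its minimum
    [x = S / A]; if [A = 0], all [a i] vanish. *)
Lemma sum_mul_sqr_le n (a b : 'I_n -> R) :
  (\sum_i a i * b i) ^+ 2 <= (\sum_i a i ^+ 2) * (\sum_i b i ^+ 2).
Proof.
set A := \sum_i a i ^+ 2; set B := \sum_i b i ^+ 2; set S := \sum_i a i * b i.
have A0 : 0 <= A by apply: sumr_ge0 => i _; exact: sqr_ge0.
have q x : 0 <= x ^+ 2 * A - 2 * x * S + B.
  rewrite /A /B /S !mulr_sumr -sumrB -big_split sumr_ge0//= => i _.
  suff -> : x ^+ 2 * a i ^+ 2 - 2 * x * (a i * b i) + b i ^+ 2 = (x * a i - b i) ^+ 2.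
    exact: sqr_ge0.
  by ring.
have [A_eq0|A_neq0] := eqVneq A 0.
  rewrite A_eq0 mul0r.
  have a0 i : a i = 0.
    move/eqP: A_eq0; rewrite psumr_eq0 => [/allP/(_ i (mem_index_enum _))|*].
      by rewrite sqrf_eq0 => /eqP.
    exact: sqr_ge0.
  by rewrite /S big1 ?expr0n// => i _; rewrite a0 mul0r.
have {}A0 : 0 < A by rewrite lt_neqAle eq_sym A_neq0.
have := q (S / A); rewrite -(pmulr_rge0 _ A0).
have -> : A * ((S / A) ^+ 2 * A - 2 * (S / A) * S + B) = A * B - S ^+ 2 by field.
by rewrite subr_ge0.
Qed.

(** The operator norm is at most the Frobenius norm, by Cauchy-Schwarz in each row and with no
    dimensional factor. *)
Lemma cl2norm_mulmx m (A : 'M[C]_m) (v : 'cV[C]_m) :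
  cl2norm (A *m v) <= Num.sqrt (\sum_i \sum_j cmod (A i j) ^+ 2) * cl2norm v.
Proof.
rewrite /cl2norm -sqrtrM; last by do 2![apply: sumr_ge0 => ? _]; exact: sqr_ge0.
rewrite ler_wsqrtr// mulr_suml ler_sum// => i _.
apply: le_trans (sum_mul_sqr_le _ _); rewrite ler_pXn2r ?nnegrE ?cmod_ge0//.
  rewrite mxE (le_trans (cmod_sum _ _ _))// ler_sum// => j _.
  by rewrite cmodM.
by apply: sumr_ge0 => *; rewrite mulr_ge0 ?cmod_ge0.
Qed.

Lemma cl2normD n (v w : 'cV[C]_n) : cl2norm (v + w) <= cl2norm v + cl2norm w.
Proof.
have sq (u : 'cV[C]_n) : 0 <= \sum_i cmod (u i ord0) ^+ 2.
  by apply: sumr_ge0 => *; exact: sqr_ge0.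
rewrite -(ler_pXn2r (n:=2)) ?nnegrE ?addr_ge0 ?cl2norm_ge0//.
rewrite sqrrD /cl2norm !sqr_sqrtr//.
have := sum_mul_sqr_le (fun i => cmod (v i ord0)) (fun i => cmod (w i ord0)).
set S := \sum_i _ => S2.
have S0 : 0 <= S by apply: sumr_ge0 => *; rewrite mulr_ge0 ?cmod_ge0.
have {S2} : S <= Num.sqrt (\sum_i cmod (v i ord0) ^+ 2) * Num.sqrt (\sum_i cmod (w i ord0) ^+ 2).
  by rewrite -sqrtrM// -[leLHS]ger0_norm// -sqrtr_sqr ler_wsqrtr.
move=> le_S; apply: (@le_trans _ _ (\sum_i cmod (v i ord0) ^+ 2 + S *+ 2 + \sum_i cmod (w i ord0) ^+ 2)).
  rewrite /S -sumrMnl -!big_split ler_sum//= => i _.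
  rewrite -sqrrD ler_pXn2r ?nnegrE ?addr_ge0 ?cmod_ge0//.
  by rewrite mxE cmodD.
by rewrite lerD2r lerD2l lerMn2r.
Qed.

Lemma not_linearly_bounded (x K : R) : 0 < x -> exists t : nat, K < t%:R * x.
Proof.
move=> x0; exists (Num.truncn `|K / x|).+1.
rewrite -ltr_pdivrMr// (le_lt_trans (ler_norm _))//.
by have := truncnS_gt `|K / x|.
Qed.

End ComplexNorms.

(** * Singular values and truncated pseudoinverses *)

Section SVD.
Variable R : realType.
Local Notation C := R[i].

Lemma trC_real_diag n (s : 'I_n -> R) : (real_diag s)^t* = real_diag s.
Proof.
apply/matrixP => i j; rewrite !mxE eq_sym; case: eqP => [->|_].
  by rewrite !mulr1n; exact: conjc_real.
by rewrite !mulr0n rmorph0.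
Qed.

Lemma real_diagM n (s t : 'I_n -> R) :
  real_diag s *m real_diag t = real_diag (fun i => s i * t i).
Proof.
rewrite /real_diag mulmx_diag; congr diag_mx; apply/rowP => i.
by rewrite !mxE rmorphM.
Qed.

(** Nonzero orthogonal rows only need to be normalized. A zero row is replaced by a unit vector
    orthogonal to all rows, whence the induction on the number of zero rows. *)
Lemma orthogonal_rows_svd n (A : 'M[C]_n) :
  is_diag_mx (A *m A^t*) ->
  exists2 Y, Y \is unitarymx & exists2 s : 'I_n -> R,
    (forall i, 0 <= s i) & A = real_diag s *m Y.
Proof.
have [k] := ubnP #|[pred i | row i A == 0]|.
elim: k A => // k IHk A; rewrite ltnS => leAk /is_diag_mxP orthA.
have entryE (B : 'M[C]_n) i j : (B *m B^t*) i j = (row i B *m (row j B)^t*) 0 0.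
  by rewrite !mxE; apply: eq_bigr => l _; rewrite !mxE.
have [/existsP[i /eqP rowi0]|] := boolP [exists i, row i A == 0].
  (* A square matrix with a zero row is rank deficient, so some unit vector is orthogonal to all its
     rows. *)
  have [y yA y1] : exists2 y : 'rV[C]_n, A *m y^t* = 0 & y *m y^t* = 1%:M.
    have /rowV0Pn[z zA z0] : kermx (A^t*) != 0.
      rewrite -mxrank_eq0 mxrank_ker -lt0n subn_gt0.
      rewrite mxrank_map mxrank_tr ltn_neqAle rank_leq_row andbT.
      apply/negP => /row_freeP[B AB]; have /rowP/(_ i) : row i (A *m B) = row i 1%:M by rewrite AB.
      by rewrite row_mul rowi0 mul0mx !mxE eqxx => /eqP; rewrite eq_sym oner_eq0.
    have zz : (z *m z^t*) = (cl2norm z^T ^+ 2)%:C%C%:M.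
      rewrite [LHS]mx11_scalar; congr (_%:M); rewrite -mulmx_trC_self.
      rewrite !mxE; apply: eq_bigr => l _; rewrite !mxE mulrC; congr (_ * _).
    have c0 : cl2norm z^T != 0.
      by apply: contra z0 => /eqP/cl2norm_eq0/(congr1 trmx); rewrite trmxK trmx0 => ->.
    exists ((cl2norm z^T)^-1%:C%C *: z).
      apply: trC_eq; rewrite trC_mul trmxCK -scalemxAl.
      by move/sub_kermxP : zA => ->; rewrite scaler0 trC0.
    rewrite linearZ/= map_mxZ -scalemxAr -scalemxAl zz scalerA scale_scalar_mx.
    congr (_%:M); set c := (cl2norm _)^-1.
    transitivity (c%:C%C * c%:C%C * (cl2norm z^T ^+ 2)%:C%C).
      by congr (_ * _ * _); exact: conjc_real.
    by rewrite -!rmorphM -expr2 -exprMn mulVf// expr1n.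
  pose A' : 'M[C]_n := \matrix_(j, l) if j == i then y 0 l else A j l.
  have rowA' j : row j A' = if j == i then y else row j A.
    by apply/rowP => l; rewrite !mxE; case: eqP => //= _; rewrite ?mxE.
  have Ay j : row j A *m y^t* = 0 by rewrite -row_mul yA row0.
  have yAj j : y *m (row j A)^t* = 0.
    by apply: trC_eq; rewrite trC_mul trmxCK Ay trC0.
  have [||Y Yu [s s0 A'E]] := IHk A'.
  - apply: leq_trans leAk; apply: proper_card; apply/properP; split.
      apply/fintype.subsetP => j; rewrite !inE rowA'; case: (eqVneq j i) => // ->.
      by rewrite rowi0.
    exists i; rewrite !inE ?rowi0// rowA' eqxx; apply/negP => /eqP y0.
    by move/eqP: y1; rewrite y0 mul0mx eq_sym -mxrank_eq0 mxrank1.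
  - apply/is_diag_mxP => j l jl; rewrite entryE !rowA'.
    case: eqP => [ji|_]; case: eqP => [li|_]; rewrite ?yAj ?Ay ?mxE//.
      by rewrite ji li eqxx in jl.
    by have := orthA _ _ jl; rewrite entryE mxE.
  (* The inserted row is erased again by the singular value 0. *)
  exists Y => //; exists (fun j => if j == i then 0 else s j).
    by move=> j; case: ifP.
  apply/matrixP => j l; have /matrixP/(_ j l) := A'E.
  rewrite !mul_diag_mx !mxE; case: (eqVneq j i) => [->|//] _.
  by have /rowP/(_ l) := rowi0; rewrite !mxE mul0r.
rewrite negb_exists => /forallP rowN0.
pose s i : R := cl2norm (row i A)^T.
have s0 i : s i != 0.
  apply: contra (rowN0 i) => /eqP/cl2norm_eq0/(congr1 trmx).
  by rewrite trmxK trmx0 => ->.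
have AA : A *m A^t* = real_diag (fun i => s i ^+ 2).
  apply/matrixP => i j; rewrite mxE [RHS]mxE; case: (eqVneq i j) => [<-|ij]; last first.
    by have := orthA _ _ ij; rewrite mxE mulr0n => ->.
  rewrite mulr1n mxE -mulmx_trC_self mxE; apply: eq_bigr => l _.
  by rewrite !mxE mulrC.
exists (real_diag (fun i => (s i)^-1) *m A).
  apply/unitarymxP; rewrite trC_mul trC_real_diag !mulmxA -(mulmxA _ A) AA.
  rewrite !real_diagM; apply/matrixP => i j; rewrite !mxE; congr (_ *+ _).
  by rewrite expr2 mulKf// divff.
exists s; first by move=> i; exact: cl2norm_ge0.
rewrite mulmxA real_diagM (_ : real_diag _ = 1%:M) ?mul1mx//.
by apply/matrixP => i j; rewrite !mxE mulfV.
Qed.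

(** A unitary [S] that diagonalizes the normal matrix [A *m A^t*] makes the rows of [S *m A]
    orthogonal. *)
Lemma svd_exists n (A : 'M[C]_n) : exists U s V, is_svd A U s V.
Proof.
have nH : A *m A^t* \is normalmx.
  by apply/normalmxP; rewrite trC_mul trmxCK.
have /orthomx_spectralP HE := nH.
set S := spectralmx _ in HE; have Su : S \is unitarymx by exact: spectral_unitarymx.
rewrite invmx_unitary// in HE.
have SS : S *m S^t* = 1%:M by apply/unitarymxP.
have [|Y Yu [s s0 SA]] := @orthogonal_rows_svd n (S *m A).
  rewrite trC_mul !mulmxA -(mulmxA S A) HE !mulmxA SS mul1mx -mulmxA SS mulmx1.
  exact: diag_mx_is_diag.
exists (S^t*), s, (Y^t*); split; rewrite ?trmxC_unitary ?trmxCK//.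
by rewrite -mulmxA -SA mulmxA -[S in _ *m S *m _]trmxCK (unitarymxP _) ?mul1mx// trmxC_unitary.
Qed.

Lemma moore_penrose_unique n (B X Y : 'M[C]_n) :
  is_moore_penrose B X -> is_moore_penrose B Y -> X = Y.
Proof.
move=> [BXB XBX BXh XBh] [BYB YBY BYh YBh].
have BXY : B *m X = B *m Y.
  by rewrite -BXh -{1}BYB -!mulmxA (mulmxA B) trC_mul BXh BYh !mulmxA BXB.
have XBY : X *m B = Y *m B.
  by rewrite -XBh -{1}BYB !mulmxA -mulmxA trC_mul XBh YBh -mulmxA (mulmxA B) BXB.
by rewrite -XBX XBY -mulmxA BXY mulmxA.
Qed.

(** A single SVD, the one behind [low_rank_approx], gives everything: [X] inverts the kept singular
    values, [F] carries the discarded ones, and they annihilate each other because they live on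
    complementary singular vectors. The exponent 6 comes from three factors, each contributing
    [n ^ 2] entries. *)
Lemma truncated_pseudoinverse n (A : 'M[C]_n) (gamma : R) (gamma_gt0 : 0 < gamma) :
  let B := low_rank_approx gamma A in
  exists X F : 'M[C]_n,
    [/\ moore_penrose B = X, is_moore_penrose B X & A = B + F] /\
    [/\ F *m X = 0, X *m F = 0, mxnorm1 F <= n%:R ^+ 6 * gamma
     & forall v, cl2norm (X *m v) <= gamma^-1 * cl2norm v].
Proof.
move=> B.
have [U [s [V [[Uu Vu s_ge0 AE] BE]]]] : exists U s V, is_svd A U s V /\
    B = U *m real_diag (fun i => if gamma <= s i then s i else 0) *m V^t*.
  rewrite /B /low_rank_approx; case: xgetP => //= noB.
  have [U [s [V svdA]]] := svd_exists A.
  by case: (noB (U *m real_diag (fun i => if gamma <= s i then s i else 0) *m V^t*));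
    exists U, s, V.
pose X := V *m real_diag (fun i => if gamma <= s i then (s i)^-1 else 0) *m U^t*.
pose F := U *m real_diag (fun i => if gamma <= s i then 0 else s i) *m V^t*.
have UU : U^t* *m U = 1%:M by have := Uu; rewrite -trmxC_unitary => /unitarymxP; rewrite trmxCK.
have VV : V^t* *m V = 1%:M by have := Vu; rewrite -trmxC_unitary => /unitarymxP; rewrite trmxCK.
have mulU (a b : 'I_n -> R) (W1 W2 : 'M[C]_n) : W1 *m real_diag a *m U^t* *m (U *m real_diag b *m W2^t*) = W1 *m real_diag (fun i => a i * b i) *m W2^t*.
  by rewrite !mulmxA -(mulmxA _ (U^t*)) UU mulmx1 -(mulmxA W1) real_diagM.
have mulV (a b : 'I_n -> R) (W1 W2 : 'M[C]_n) : W1 *m real_diag a *m V^t* *m (V *m real_diag b *m W2^t*) = W1 *m real_diag (fun i => a i * b i) *m W2^t*.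
  by rewrite !mulmxA -(mulmxA _ (V^t*)) VV mulmx1 -(mulmxA W1) real_diagM.
have rdE (a b : 'I_n -> R) (W1 W2 : 'M[C]_n) : a =1 b -> W1 *m real_diag a *m W2^t* = W1 *m real_diag b *m W2^t*.
  by move=> ab; congr (_ *m _ *m _); apply/matrixP => i j; rewrite !mxE ab.
have s_neq0 i : gamma <= s i -> s i != 0.
  by move=> le_gs; rewrite gt_eqF// (lt_le_trans gamma_gt0).
have BX : is_moore_penrose B X.
  split; rewrite BE /X ?mulU ?mulV ?mulU ?mulV.
  - by apply: rdE => i; case: ifP => [/s_neq0 si|_]; rewrite ?mulr0// divff// mul1r.
  - by apply: rdE => i; case: ifP => [/s_neq0 si|_]; rewrite ?mulr0// mulVf// mul1r.
  - by rewrite !trC_mul trmxCK trC_real_diag mulmxA.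
  - by rewrite !trC_mul trmxCK trC_real_diag mulmxA.
exists X, F; split; split => //.
- rewrite /moore_penrose; case: xgetP => [Y _ BY|noX]; last by case: (noX X).
  exact: moore_penrose_unique BY BX.
- rewrite AE BE /F -mulmxDl -mulmxDr; congr (_ *m _ *m _).
  apply/matrixP => i j; rewrite !mxE -mulrnDl -rmorphD.
  by case: ifP; rewrite ?addr0 ?add0r.
- rewrite /F /X mulV (_ : real_diag _ = 0) ?mulmx0 ?mul0mx//.
  by apply/matrixP => i j; rewrite !mxE; case: ifP; rewrite ?mul0r ?mulr0 mul0rn.
- rewrite /F /X mulU (_ : real_diag _ = 0) ?mulmx0 ?mul0mx//.
  by apply/matrixP => i j; rewrite !mxE; case: ifP; rewrite ?mul0r ?mulr0 mul0rn.
- have unit_norm (W : 'M[C]_n) : W \is unitarymx -> mxnorm1 W <= n%:R ^+ 2.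
    move=> Wu; rewrite expr2 -[leRHS]mulr1; apply: mxnorm1_le => i j.
    have -> : W i j = (W *m delta_mx j (ord0 : 'I_1)) i ord0.
      rewrite mxE (bigD1 j)//= mxE !eqxx mulr1 big1 ?addr0// => k /negPf kj.
      by rewrite mxE kj mulr0.
    apply: le_trans (cmod_le_cl2norm _ _) _; rewrite cl2norm_unitary//.
    rewrite /cl2norm (bigD1 j)//= big1 => [|k /negPf kj]; rewrite !mxE ?eqxx ?kj/= ?cmod1 ?cmod0 ?expr0n//.
      by rewrite !(addr0, expr1n, expr0n, sqrtr1).
    by rewrite /= addr0 sqrtr0 expr0n.
  rewrite /F (le_trans (mxnorm1M _ _))// mxnorm1_trC.
  have le2 : mxnorm1 (real_diag (fun i => if gamma <= s i then 0 else s i)) <= n%:R ^+ 2 * gamma.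
    apply: mxnorm1_le => i j; rewrite !mxE; case: (i == j); last by rewrite mulr0n cmod0 ltW.
    rewrite mulr1n cmod_real; case: (leP gamma (s i)) => [_|/ltW]; first by rewrite normr0 ltW.
    by rewrite ger0_norm.
  rewrite (_ : _ ^+ 6 * gamma = n%:R ^+ 2 * (n%:R ^+ 2 * gamma) * n%:R ^+ 2); last by ring.
  apply: ler_pM; rewrite ?mxnorm1_ge0 ?unit_norm//.
  rewrite (le_trans (mxnorm1M _ _))//.
  by apply: ler_pM; rewrite ?mxnorm1_ge0 ?unit_norm.
- move=> v; rewrite /X -!mulmxA cl2norm_unitary// -(@cl2norm_unitary _ _ (U^t*) v) ?trmxC_unitary//.
  set w := U^t* *m v; have g0 : 0 <= gamma^-1 by rewrite invr_ge0 ltW.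
  rewrite -(ler_pXn2r (n:=2)) ?nnegrE ?mulr_ge0 ?cl2norm_ge0//.
  have sq (u : 'cV[C]_n) : 0 <= \sum_i cmod (u i ord0) ^+ 2.
    by apply: sumr_ge0 => *; exact: sqr_ge0.
  rewrite exprMn /cl2norm !sqr_sqrtr// mulr_sumr ler_sum// => i _.
  rewrite mul_diag_mx !mxE cmodM cmod_real exprMn ler_wpM2r ?sqr_ge0//.
  case: ifP => [le_gs|_]; last by rewrite normr0 expr0n sqr_ge0.
  rewrite ler_pXn2r ?nnegrE ?normr_ge0//.
  by rewrite ger0_norm ?invr_ge0// lef_pV2 ?posrE// (lt_le_trans gamma_gt0).
Qed.

End SVD.

Ltac nonneg :=
  repeat (first [ by [] | exact: mxnorm1_ge0 | exact: sqr_ge0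
                | exact: exprn_ge0 | apply: addr_ge0 | apply: mulr_ge0 ]).

(** * Perturbation of a truncated low rank factorization *)

Section Perturbation.
Variable R : realType.
Local Notation C := R[i].

(** Each diagonal entry equals the sum of the squared moduli in its row. Hence it is at most 1, and
    then so is the modulus of every entry. *)
Lemma orthogonal_projection_mxnorm1 n (E : 'M[C]_n) :
  E^t* = E -> E *m E = E -> mxnorm1 E <= n%:R * n%:R.
Proof.
move=> Eh EE; rewrite -[leRHS]mulr1; apply: mxnorm1_le => i j.
have Eii : E i i = (\sum_k cmod (E i k) ^+ 2)%:C%C.
  rewrite -{1}EE mxE rmorph_sum; apply: eq_bigr => k _.
  rewrite -{2}Eh !mxE -normCK normC_cmod; exact: esym (rmorphXn _ _ _).
have le2 k : cmod (E i k) ^+ 2 <= cmod (E i i).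
  rewrite Eii cmod_real ger0_norm; last by apply: sumr_ge0 => *; exact: sqr_ge0.
  by rewrite (bigD1 k)//= lerDl sumr_ge0// => *; exact: sqr_ge0.
have Eii1 : cmod (E i i) <= 1.
  have := le2 i; rewrite expr2; have [->//|nz] := eqVneq (cmod (E i i)) 0.
  by rewrite ger_pMl// lt_neqAle eq_sym nz cmod_ge0.
rewrite -(ler_pXn2r (n:=2)) ?nnegrE ?cmod_ge0// expr1n.
exact: le_trans (le2 j) Eii1.
Qed.

Lemma mxnorm1_scalar1 n : mxnorm1 (1%:M : 'M[C]_n) <= n%:R * n%:R.
Proof.
apply: orthogonal_projection_mxnorm1; last by rewrite mulmx1.
by rewrite trmx1 map_mx1.
Qed.

(** A kernel vector satisfies [v = v *m (1%:M - Z)], so its norm is at most half of itself. The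
    inverse is bounded through [W = 1%:M + (1%:M - Z) *m W], with no Neumann series. *)
Lemma near1_unitmx r (Z : 'M[C]_r) : mxnorm1 (1%:M - Z) <= 1 / 2 ->
  Z \in unitmx /\ mxnorm1 (invmx Z) <= 2 * (r%:R * r%:R).
Proof.
move=> Z1.
have Zu : Z \in unitmx.
  rewrite -row_free_unit -kermx_eq0; apply/eqP/row_matrixP => i; rewrite row0.
  set v := row i _; have vZ : v *m Z = 0 by rewrite -row_mul mulmx_ker row0.
  apply: mxnorm1_eq0; apply: le_anti; rewrite mxnorm1_ge0 andbT.
  have : mxnorm1 v <= mxnorm1 v * (1 / 2).
    rewrite -{1}[v]subr0 -vZ -[v in v - _]mulmx1 -mulmxBr.
    by rewrite (le_trans (mxnorm1M _ _))// ler_wpM2l ?mxnorm1_ge0.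
  lra.
split=> //; set W := invmx Z.
have : mxnorm1 W <= r%:R * r%:R + 1 / 2 * mxnorm1 W.
  have {1}-> : W = 1%:M + (1%:M - Z) *m W by rewrite mulmxBl mul1mx mulmxV// addrCA subrr addr0.
  rewrite (le_trans (mxnorm1D _ _))// lerD ?mxnorm1_scalar1//.
  by rewrite (le_trans (mxnorm1M _ _))// ler_wpM2r ?mxnorm1_ge0.
lra.
Qed.

Lemma rank_drop_witness m n p (A : 'M[C]_(m, n)) (T : 'M[C]_(n, p)) :
  (\rank (A *m T) < \rank T)%N -> exists2 w : 'cV[C]_p, A *m T *m w = 0 & T *m w != 0.
Proof.
move=> ltr.
have /row_subPn[i Hi] : ~~ (kermx (A *m T)^T <= kermx T^T)%MS.
  apply: contraL ltr => /mxrankS; rewrite !mxrank_ker !mxrank_tr -leqNgt => le2.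
  have := rank_leq_col (A *m T); have := rank_leq_col T; lia.
have Kw := congr1 (row i) (mulmx_ker (A *m T)^T); rewrite row_mul row0 in Kw.
exists (row i (kermx (A *m T)^T))^T.
  by apply: trmx_inj; rewrite trmx_mul trmxK Kw trmx0.
apply: contra Hi => /eqP Tw; apply/sub_kermxP.
by apply: trmx_inj; rewrite trmx_mul trmxK Tw trmx0.
Qed.

(* [F] is the part of [A0] below the threshold. A perturbation smaller than
   [gamma] cannot lift the truncation above the rank of [P *m Q]. *)
Lemma pseudoinverse_rank n r (A0 E0 B X F : 'M[C]_n) (P : 'M[C]_(n, r))
    (Q : 'M[C]_(r, n)) (gamma : R) :
  0 < gamma -> A0 = P *m Q + E0 -> is_moore_penrose B X -> A0 = B + F ->
  F *m X = 0 -> (forall v, cl2norm (X *m v) <= gamma^-1 * cl2norm v) ->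
  (forall v, v != 0 -> cl2norm (E0 *m v) < gamma * cl2norm v) ->
  (\rank (B *m X) <= r)%N.
Proof.
move=> g0 A0E [BXB XBX _ _] A0F FX Xle E0lt.
apply: (@leq_trans (\rank (X *m B))).
  rewrite (leq_trans (mxrankM_maxl _ _))// -{1}BXB -mulmxA.
  exact: mxrankM_maxr.
rewrite leqNgt; apply/negP => lt_r.
(* [X *m B] projects onto the range of [X]. If its rank exceeded [r], that range would contain some
   [v != 0] killed by [Q]; there [B *m v = E0 *m v], and [v = X *m B *m v] would be shorter than
   itself. *)
have [|w Qw Tw] := @rank_drop_witness _ _ _ Q (X *m B).
  by rewrite (leq_ltn_trans _ lt_r)// (leq_trans (mxrankM_maxl _ _))// rank_leq_row.
set v := X *m B *m w in Tw.
have Bv : B *m v = E0 *m v.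
  have : A0 *m v = A0 *m v by [].
  rewrite {1}A0F A0E !mulmxDl -!mulmxA [Q *m v](_ : _ = 0) ?mulmx0 ?add0r; last first.
    by rewrite /v mulmxA.
  by rewrite [F *m v](_ : _ = 0) ?addr0// /v !mulmxA FX !mul0mx.
have vE : v = X *m (B *m v) by rewrite /v !mulmxA XBX.
have := Xle (B *m v); rewrite -vE Bv leNgt => /negP; apply.
by rewrite mulrC ltr_pdivrMr// mulrC E0lt.
Qed.

(** [X] is bounded in terms of itself. With the orthogonal projection [Pi = B *m X], the rank
    hypothesis recovers [Pi] from [Pi *m P], so it is enough to bound
    [X *m P = X *m (P *m Q) *m QR]. There [X *m (P *m Q)] is [X *m B], again a projection, minus
    [X *m E0], whose contribution is at most half the norm of [X] and is absorbed on the left. *)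
Lemma pseudoinverse_bound n r (A0 E0 B X F : 'M[C]_n) (P : 'M[C]_(n, r))
    (Pp : 'M[C]_(r, n)) (Q : 'M[C]_(r, n)) (QR : 'M[C]_(n, r)) (K a : R) :
  A0 = P *m Q + E0 -> Q *m QR = 1%:M -> Pp *m P = 1%:M ->
  is_moore_penrose B X -> A0 = B + F -> X *m F = 0 ->
  (\rank (B *m X) <= r)%N ->
  mxnorm1 (Pp *m (1%:M - B *m X) *m P) <= 1 / 2 ->
  mxnorm1 QR <= K -> mxnorm1 Pp <= a ->
  mxnorm1 E0 * (K * (2 * (r%:R * r%:R)) * a * (n%:R * n%:R)) <= 1 / 2 ->
  mxnorm1 X <= 2 * (n%:R * n%:R * (K * (2 * (r%:R * r%:R)) * a * (n%:R * n%:R))).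
Proof.
move=> A0E QQR PpP [BXB XBX BXh XBh] A0F XF rk Z1 QRle Pple E0le.
set Pi := B *m X in rk Z1.
have PiPi : Pi *m Pi = Pi by rewrite /Pi mulmxA BXB.
pose Z := Pp *m Pi *m P.
have [|Zu Zinv] := @near1_unitmx _ Z.
  by move: Z1; rewrite mulmxBr mulmxBl mulmx1 PpP.
have XPi : X *m Pi = X by rewrite mulmxA.
have [S PiS] : exists S, Pi = Pi *m P *m S.
  have sub : ((Pi *m P)^T <= Pi^T)%MS by rewrite trmx_mul submxMl.
  (* [Pp *m (Pi *m P)] is invertible of size [r], so [Pi *m P] has rank at least [r], hence the same
     column span as [Pi]. Transposes turn column spans into row spaces. *)
  have rkP : (\rank (Pi^T) <= \rank (Pi *m P)^T)%N.
    rewrite !mxrank_tr (leq_trans rk)// -[leqLHS](mxrank_unit Zu) /Z -mulmxA.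
    exact: mxrankM_maxr.
  have : (Pi^T <= (Pi *m P)^T)%MS by rewrite -(geq_leqif (mxrank_leqif_sup sub)).
  case/submxP => T TE; exists T^T; apply: trmx_inj.
  by rewrite [RHS]trmx_mul trmxK.
have PiE : Pi = Pi *m P *m invmx Z *m Pp *m Pi.
  have PpPi : Pp *m Pi = Z *m S by rewrite {1}PiS /Z !mulmxA.
  by rewrite -(mulmxA _ Pp) PpPi mulmxA mulmxKV.
have XE : X = (X *m B - X *m E0) *m QR *m invmx Z *m (Pp *m Pi).
  have {1}-> : X = X *m P *m invmx Z *m (Pp *m Pi).
    by rewrite -{1}XPi {1}PiE !mulmxA XBX.
  congr (_ *m _ *m _).
  have -> : X *m B - X *m E0 = X *m (P *m Q).
    by rewrite -[P *m Q](addrK E0) -A0E A0F mulmxBr mulmxDr XF addr0.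
  by rewrite -mulmxA -mulmxA QQR mulmx1.
have XBn : mxnorm1 (X *m B) <= n%:R * n%:R.
  by apply: orthogonal_projection_mxnorm1 => //; rewrite mulmxA XBX.
have Pin : mxnorm1 Pi <= n%:R * n%:R by exact: orthogonal_projection_mxnorm1.
have n0 T m p (W : 'M[C]_(m, p)) : 0 <= mxnorm1 W by exact: mxnorm1_ge0.
set k := K * _ * _ * _ in E0le *.
have le1 : mxnorm1 X <= (n%:R * n%:R + mxnorm1 X * mxnorm1 E0) * k.
  rewrite {1}XE (le_trans (mxnorm1M _ _))// /k.
  set s := n%:R * n%:R + mxnorm1 X * mxnorm1 E0; rewrite (_ : s * _ = s * K * (2 * (r%:R * r%:R)) * (a * (n%:R * n%:R))); last by ring.
  rewrite {}/s.
  apply: ler_pM; rewrite ?mxnorm1_ge0//; last first.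
    by rewrite (le_trans (mxnorm1M _ _))// ler_pM ?mxnorm1_ge0.
  rewrite (le_trans (mxnorm1M _ _))//.
  apply: ler_pM; rewrite ?mxnorm1_ge0//.
  rewrite (le_trans (mxnorm1M _ _))//.
  apply: ler_pM; rewrite ?mxnorm1_ge0//.
  rewrite (le_trans (mxnorm1B _ _))// lerD// mxnorm1M//.
have := ler_wpM2l (mxnorm1_ge0 X) E0le.
rewrite mulrDl in le1; lra.
Qed.

(* For [gamma >= eps] the trivial bound [gamma^-1] on the pseudoinverse is
   enough; below [eps] the rank of the truncation is at most [r], which makes
   the pseudoinverse bounded uniformly in [gamma]. *)
Lemma perturbation n r (P : 'M[C]_(n, r)) (Lam H : 'M[C]_r) (K c e : R) :
  0 <= K -> 0 <= c -> 0 <= e -> H *m P^t* *m P = 1%:M ->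
  exists2 eps : R, 0 < eps <= (1 + e)^-1 & exists2 D : R, 0 < D &
  forall (Q : 'M[C]_(r, n)) (QR : 'M[C]_(n, r)) (A0 A1 E0 E1 B X F : 'M[C]_n)
    (gamma : R),
  Q *m QR = 1%:M -> mxnorm1 QR <= K -> 0 < gamma ->
  A0 = P *m Q + E0 -> A1 = P *m Lam *m Q + E1 ->
  mxnorm1 E0 <= c * gamma -> mxnorm1 E1 <= c * gamma ->
  is_moore_penrose B X -> A0 = B + F -> F *m X = 0 -> X *m F = 0 ->
  mxnorm1 F <= c * gamma ->
  (forall v, cl2norm (X *m v) <= gamma^-1 * cl2norm v) ->
  (gamma < eps -> forall v, v != 0 -> cl2norm (E0 *m v) < gamma * cl2norm v) ->
  mxnorm1 (P *m Lam *m H *m P^t* - A1 *m X) <= D * gamma.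
Proof.
move=> K0 c0 e0 PpP.
set p := mxnorm1 P; set l := mxnorm1 Lam; set h := mxnorm1 H.
have [p0 l0 h0] : [/\ 0 <= p, 0 <= l & 0 <= h] by split; exact: mxnorm1_ge0.
pose n2 : R := n%:R * n%:R; have n20 : 0 <= n2 by rewrite mulr_ge0.
pose k1 := (c + n2 * c) * K; have k10 : 0 <= k1 by nonneg.
pose k2 := K * (2 * (r%:R * r%:R)) * (h * p) * n2.
have k20 : 0 <= k2 by rewrite !mulr_ge0.
pose g := p * l * h * p; have g0 : 0 <= g by rewrite !mulr_ge0.
(* One summand per requirement: [1 + e] gives the bound promised on [eps], [h * p * k1] puts the
   compression of [1%:M - Pi] to [P] below 1/2, and [c * k2] makes [E0] absorbable in
   [pseudoinverse_bound]. *)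
pose eps := (2 * (1 + e + h * p * k1 + c * k2))^-1.
have den0 : 0 < 1 + e + h * p * k1 + c * k2.
  by rewrite -!addrA ltr_pwDl//; nonneg.
have eps0 : 0 < eps by rewrite invr_gt0 mulr_gt0.
pose x0 := 2 * (n2 * k2); have x00 : 0 <= x0 by rewrite !mulr_ge0.
have x1 : 0 <= n2 / eps by rewrite mulr_ge0// invr_ge0 ltW.
(* The first term bounds [G *m Pi']. The second bounds [(E1 - G *m E0) *m X], with [x0] serving
   small [gamma] and [n2 / eps] serving large [gamma]. The final 1 gives positivity. *)
pose D := p * l * h * k1 + (c + g * c) * (x0 + n2 / eps) + 1.
have D0 : 0 < D by rewrite ltr_wpDl//; nonneg.
exists eps.
  rewrite eps0 lef_pV2 ?posrE ?mulr_gt0//; last by rewrite ltr_pwDl.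
  rewrite mulr_natl mulr2n ler_wpDr ?(ltW den0)//.
  by rewrite -[leRHS]addrA lerDl; nonneg.
exists D => // Q QR A0 A1 E0 E1 B X F gamma.
move=> QQR QRle gam0 A0E A1E E0le E1le MP A0F FX XF Fle Xle E0lt.
have [BXB XBX BXh XBh] := MP.
set G := _ *m _ *m H *m _; set Pi := B *m X.
have PiPi : Pi *m Pi = Pi by rewrite /Pi mulmxA BXB.
pose Pi' := 1%:M - Pi.
have Pi'h : Pi'^t* = Pi'.
  by rewrite /Pi' linearB/= map_mxB trmx1 map_mx1 BXh.
have Pi'n : mxnorm1 Pi' <= n2.
  apply: orthogonal_projection_mxnorm1 => //.
  by rewrite /Pi' mulmxBl mul1mx mulmxBr mulmx1 PiPi subrr subr0.
have Pi'A : Pi' *m A0 = F.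
  rewrite A0F mulmxDr mulmxBl mul1mx BXB subrr add0r mulmxBl mul1mx -mulmxA XF.
  by rewrite mulmx0 subr0.
have A0X : A0 *m X = Pi by rewrite A0F mulmxDl FX addr0.
(* The complementary projection sends [A0] to the small part [F]; cancelling [Q] by its right
   inverse shows that it almost kills [P]. *)
have Pi'P : mxnorm1 (Pi' *m P) <= k1 * gamma.
  have -> : Pi' *m P = (F - Pi' *m E0) *m QR.
    by rewrite -Pi'A -mulmxBr A0E addrK -!mulmxA QQR mulmx1.
  rewrite (le_trans (mxnorm1M _ _))// /k1 mulrAC.
  apply: ler_pM; rewrite ?mxnorm1_ge0// mulrDl (le_trans (mxnorm1B _ _))// lerD//.
  by rewrite (le_trans (mxnorm1M _ _))// -mulrA ler_pM ?mxnorm1_ge0.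
have Gle : mxnorm1 G <= g.
  do 2!(rewrite (le_trans (mxnorm1M _ _))// ?mxnorm1_trC; apply: ler_pM; rewrite ?mxnorm1_ge0//).
  by rewrite (le_trans (mxnorm1M _ _)).
have GPi' : mxnorm1 (G *m Pi') <= p * l * h * k1 * gamma.
  rewrite /G -mulmxA (le_trans (mxnorm1M _ _))// -mulrA.
  apply: ler_pM; rewrite ?mxnorm1_ge0//.
    rewrite (le_trans (mxnorm1M _ _))//; apply: ler_pM; rewrite ?mxnorm1_ge0//.
    by rewrite (le_trans (mxnorm1M _ _)).
  by rewrite -Pi'h -trC_mul mxnorm1_trC.
have GP : G *m P = P *m Lam by rewrite /G -!mulmxA (mulmxA H) PpP mulmx1.
(* Since [G *m P = P *m Lam], multiplication by [G] carries the signal of [A0] to that of [A1]; only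
   errors remain. *)
have A1G : A1 = G *m A0 + (E1 - G *m E0).
  by rewrite A1E A0E mulmxDr mulmxA GP addrCA addrK addrC.
have EX : mxnorm1 (E1 - G *m E0) <= (c + g * c) * gamma.
  rewrite mulrDl (le_trans (mxnorm1B _ _))// lerD// (le_trans (mxnorm1M _ _))//.
  by rewrite -mulrA ler_pM ?mxnorm1_ge0.
have Xn : gamma * mxnorm1 X <= gamma * (x0 + n2 / eps).
  have [eps_le|lt_eps] := leP eps gamma.
    apply: (@le_trans _ _ n2); last first.
      rewrite mulrDr mulrA [gamma * n2]mulrC -mulrA ler_wpDl//.
        by rewrite mulr_ge0// ltW.
      by rewrite ler_peMr// ler_pdivlMr ?mul1r.
    rewrite mulrC -ler_pdivlMr//; apply: mxnorm1_le => i j.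
    have -> : X i j = (X *m delta_mx j (ord0 : 'I_1)) i ord0.
      rewrite mxE (bigD1 j)//= mxE !eqxx mulr1 big1 ?addr0// => k /negPf kj.
      by rewrite mxE kj mulr0.
    rewrite (le_trans (cmod_le_cl2norm _ _))// (le_trans (Xle _))//.
    rewrite ger_pMr ?invr_gt0// /cl2norm (bigD1 j)//= big1 => [|k /negPf kj]; rewrite !mxE ?eqxx ?kj/= ?cmod1 ?cmod0 ?expr0n//.
      by rewrite !(addr0, expr1n, expr0n, sqrtr1).
    by rewrite /= addr0 sqrtr0 expr0n.
  rewrite ler_wpM2l ?(ltW gam0)// ler_wpDr//.
  have gam_le (x : R) : 0 <= x -> x <= 1 + e + h * p * k1 + c * k2 -> x * gamma <= 1 / 2.
    move=> x_ge0 xle; rewrite (le_trans (ler_wpM2l x_ge0 (ltW lt_eps)))//.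
    by rewrite /eps ler_pdivrMr ?mulr_gt0//; lra.
  apply: (@pseudoinverse_bound _ _ A0 E0 B X F P (H *m P^t*) Q QR) => //.
  - by apply: (pseudoinverse_rank gam0 A0E MP A0F FX Xle); exact: E0lt.
  - rewrite -mulmxA (le_trans (mxnorm1M _ _))//.
    apply: (@le_trans _ _ (h * p * (k1 * gamma))).
      apply: ler_pM; rewrite ?mxnorm1_ge0//.
      by rewrite (le_trans (mxnorm1M _ _))// mxnorm1_trC.
    rewrite (_ : h * p * _ = h * p * k1 * gamma); last by rewrite !mulrA.
    by apply: gam_le; [nonneg | rewrite -addrA addrCA ler_wpDr//; nonneg].
  - by rewrite (le_trans (mxnorm1M _ _))// mxnorm1_trC.
  - rewrite (le_trans (ler_wpM2r _ E0le))// mulrAC; apply: gam_le.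
      by nonneg.
    by rewrite ler_wpDl//; nonneg.
have -> : G - A1 *m X = G *m Pi' - (E1 - G *m E0) *m X.
  by rewrite [A1 in LHS]A1G mulmxDl -mulmxA A0X mulmxBr mulmx1 opprD addrA.
rewrite (le_trans (mxnorm1B _ _))// /D mulrDl ler_wpDr ?mul1r ?(ltW gam0)//.
rewrite mulrDl lerD// (le_trans (mxnorm1M _ _))//.
rewrite (le_trans (ler_wpM2r (mxnorm1_ge0 _) EX))// -[leLHS]mulrA -[leRHS]mulrA.
apply: ler_wpM2l; first by nonneg.
by rewrite [leRHS]mulrC.
Qed.

End Perturbation.

(** * Weyl sums along eigencomponents *)

Section WeylSums.
Variable R : realType.
Local Notation C := R[i].
Variable L : nat.
Hypothesis L_gt0 : (0 < L)%N.

Lemma cexpiD (x y : R) : cexpi (x + y) = cexpi x * cexpi y.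
Proof. by rewrite /cexpi sinD cosD; apply/eqP; rewrite eq_complex /= eqxx addrC eqxx. Qed.

Lemma cmod_cexpi (x : R) : cmod (cexpi x) = 1.
Proof. by rewrite /cmod /= cos2Dsin2 sqrtr1. Qed.

Lemma cexpi_2piM (m : nat) : cexpi (2 * pi * m%:R : R) = 1.
Proof.
elim: m => [|m IHm]; first by rewrite mulr0 /cexpi cos0 sin0.
rewrite -[m.+1]addn1 natrD mulrDr mulr1 cexpiD IHm mul1r /cexpi.
by rewrite mulr_natl cos2pi sin2pi.
Qed.

Definition chirp (j : nat) : C := cexpi (2 * pi * j%:R ^+ 2 / (4 * L%:R)).

Lemma cmod_chirp j : cmod (chirp j) = 1.
Proof. exact: cmod_cexpi. Qed.

Let L_neq0 : L%:R != 0 :> R. Proof. by rewrite pnatr_eq0 -lt0n. Qed.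

(** [(j + 2 * L) ^ 2 / (4 * L)] exceeds [j ^ 2 / (4 * L)] by the integer [j + L]. *)
Lemma chirp_periodic j : chirp (j + 2 * L) = chirp j.
Proof.
rewrite /chirp (_ : 2 * pi * _ / _ = 2 * pi * j%:R ^+ 2 / (4 * L%:R) + 2 * pi * (j + L)%:R).
  by rewrite cexpiD cexpi_2piM mulr1.
by rewrite natrD natrM natrD; field.
Qed.

Definition weyl_sum (z : C) (n : nat) : C := \sum_(j < n) z ^+ j * chirp j.

Lemma weyl_sum_shift z n :
  weyl_sum z (n + 2 * L) = weyl_sum z (2 * L) + z ^+ (2 * L) * weyl_sum z n.
Proof.
rewrite /weyl_sum addnC big_split_ord /= mulr_sumr; congr (_ + _).
by apply: eq_bigr => j _; rewrite exprD mulrA addnC chirp_periodic.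
Qed.

Lemma weyl_sum_bound z n : cmod z = 1 -> cmod (weyl_sum z n) <= n%:R.
Proof.
move=> z1; rewrite (le_trans (cmod_sum _ _ _))//.
rewrite (eq_bigr (fun=> 1)) ?sumr_const ?card_ord// => j _.
by rewrite cmodM cmodX z1 cmod_chirp expr1n mulr1.
Qed.

(** By the shift identity, [(z ^+ (2 * L) - 1) * weyl_sum z n] is a difference of two sums over
    windows of [2 * L] unimodular terms; hence the numerator [4 * L]. *)
Lemma weyl_sum_bounded z : cmod z = 1 -> z ^+ (2 * L) != 1 ->
  exists K : R, forall n, cmod (weyl_sum z n) <= K.
Proof.
move=> z1 zL; exists (4 * L%:R / cmod (z ^+ (2 * L) - 1)) => n.
have d0 : 0 < cmod (z ^+ (2 * L) - 1) by rewrite cmod_gt0 subr_eq0.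
rewrite ler_pdivlMr// -cmodM mulrBr mulr1.
have -> : weyl_sum z n * z ^+ (2 * L) - weyl_sum z n =
    (weyl_sum z (n + 2 * L) - weyl_sum z n) - weyl_sum z (2 * L).
  by rewrite weyl_sum_shift; ring.
rewrite (le_trans (cmodD _ _))// cmodN.
have -> : 4 * L%:R = (2 * L)%:R + (2 * L)%:R :> R by rewrite natrM; ring.
rewrite lerD ?weyl_sum_bound//.
rewrite /weyl_sum big_split_ord /= addrAC subrr add0r (le_trans (cmod_sum _ _ _))//.
rewrite (eq_bigr (fun=> 1)) ?sumr_const ?card_ord// => j _.
by rewrite cmodM cmodX z1 cmod_chirp expr1n mulr1.
Qed.

(** Once the linear growth is removed, what remains has period [2 * L] in [n], so it is bounded by
    the sum of its moduli over one period. *)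
Lemma weyl_sum_periodic z : cmod z = 1 -> z ^+ (2 * L) = 1 ->
  exists K : R, forall n,
    cmod (weyl_sum z n - n%:R * (weyl_sum z (2 * L) / (2 * L)%:R)) <= K.
Proof.
move=> z1 zL; set c := weyl_sum z (2 * L) / _.
have per q n : weyl_sum z (n + q * (2 * L)) - (n + q * (2 * L))%:R * c =
               weyl_sum z n - n%:R * c.
  elim: q => [|q IHq]; first by rewrite mul0n addn0.
  rewrite -IHq mulSnr addnA weyl_sum_shift zL mul1r [in LHS]natrD mulrDl.
  have -> : (2 * L)%:R * c = weyl_sum z (2 * L).
    by rewrite /c mulrC divfK// pnatr_eq0 muln_eq0/= -lt0n.
  by ring.
exists (\sum_(j < 2 * L) cmod (weyl_sum z j - j%:R * c)) => n.
have n_lt : (n %% (2 * L) < 2 * L)%N by rewrite ltn_pmod// muln_gt0.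
rewrite (divn_eq n (2 * L)) addnC per (bigD1 (Ordinal n_lt))//= lerDl.
by apply: sumr_ge0 => *; exact: cmod_ge0.
Qed.

Lemma weyl_sum_asymptotic z : cmod z = 1 -> exists (c : C) (K : R),
  forall n, cmod (weyl_sum z n - n%:R * c) <= K.
Proof.
move=> z1; have [zL|zL] := eqVneq (z ^+ (2 * L)) 1.
  by have [K HK] := weyl_sum_periodic z1 zL; exists (weyl_sum z (2 * L) / (2 * L)%:R), K.
have [K HK] := weyl_sum_bounded z1 zL.
by exists 0, K => n; rewrite mulr0 subr0.
Qed.

End WeylSums.

(** * Generalized eigencomponents of a vector with bounded orbit *)

Section SpectralComponents.
Variable R : realType.
Local Notation C := R[i].
Variable n' : nat.
Local Notation n := n'.+1.
Implicit Types (M : 'M[C]_n) (u v : 'cV[C]_n).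

Lemma horner_mxM_vec M (p q : {poly C}) v :
  horner_mx M (p * q) *m v = horner_mx M p *m (horner_mx M q *m v).
Proof. by rewrite rmorphM -mulmxE mulmxA. Qed.

(** The components are polynomials in [M] applied to [v]: they commute with [M], so they inherit a
    bounded orbit, and they stay within the Krylov space of [v]. The last clause makes [q a] select
    the component of [a], which yields linear independence. *)
Definition components M v (s : seq C) (q : C -> {poly C}) : Prop :=
  let f a := horner_mx M (q a) *m v in
  [/\ uniq s, v = \sum_(a <- s) f a,
      (forall a, a \in s -> horner_mx M (('X - a%:P) ^+ n) *m f a = 0)
    & (forall a b, a \in s -> b \in s ->
         horner_mx M (q a) *m f b = if b == a then f a else 0)].

(** The characteristic polynomial is a product of coprime powers [p a]. In a Bezout identity for
    [p a] and the product [p' a] of the other powers, the term divisible by [p' a] is the projection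
    polynomial [q a]. *)
Lemma components_exist M v : exists s q, components M v s q.
Proof.
have [r rE] := closed_field_poly_normal (char_poly M).
rewrite (monicP (char_poly_monic M)) scale1r in rE.
have size_r : size r = n.
  by have := size_char_poly M; rewrite rE size_prod_XsubC => -[].
pose s := undup r; pose p a : {poly C} := ('X - a%:P) ^+ count_mem a r.
pose p' a := \prod_(b <- s | b != a) p b.
have sU : uniq s by exact: undup_uniq.
have charE : char_poly M = \prod_(a <- s) p a by rewrite rE -prodr_undup_exp_count.
have pp' a : a \in s -> char_poly M = p a * p' a by move=> sa; rewrite charE (bigD1_seq a).
have /choice[w wE] a : exists w, w.1 * p a + w.2 * p' a = 1.
  apply/Bezout_eq1_coprimepP; apply: coprimep_expl.
  rewrite coprimep_sym coprimep_XsubC rootE horner_prod prodf_seq_neq0.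
  apply/allP => b _; apply/implyP => ba; rewrite horner_exp hornerXsubC.
  by rewrite expf_neq0// subr_eq0 eq_sym.
pose q a := (w a).2 * p' a; pose f a := horner_mx M (q a) *m v.
have killp a u : a \in s -> horner_mx M (p a * p' a) *m u = 0.
  by move=> sa; rewrite -pp'// Cayley_Hamilton mul0mx.
have pf a : a \in s -> horner_mx M (p a) *m f a = 0.
  by move=> sa; rewrite -horner_mxM_vec mulrCA horner_mxM_vec killp// mulmx0.
have qf a b : a \in s -> b \in s -> horner_mx M (q a) *m f b = if b == a then f a else 0.
  move=> sa sb; case: eqVneq => [->|ba].
    have -> : q a = 1 - (w a).1 * p a by rewrite -(wE a) addrAC subrr add0r.
    rewrite rmorphB rmorph1 mulmxBl mul1mx horner_mxM_vec pf//.
    by rewrite mulmx0 subr0.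
  have [h hE] : exists h, p' a = h * p b.
    exists (\prod_(c <- [seq c <- s | c != a] | c != b) p c).
    rewrite /p' -big_filter (bigD1_seq b) ?mem_filter ?ba ?filter_uniq//.
    exact: mulrC.
  by rewrite /q hE mulrA horner_mxM_vec pf// mulmx0.
exists s, q; split => //.
(* The remainder [u] is killed by every [q a], hence fixed by every [(w a).1 * p a] and by their
   product, which is a multiple of the characteristic polynomial. *)
- apply/eqP; rewrite -subr_eq0; apply/eqP; set u := v - _.
  have u_fix a : a \in s -> u = horner_mx M ((w a).1 * p a) *m u.
    move=> sa; have -> : (w a).1 * p a = 1 - q a by rewrite -(wE a) addrK.
    rewrite rmorphB rmorph1 mulmxBl mul1mx [X in _ - X](_ : _ = 0) ?subr0//.
    rewrite mulmxBr mulmx_sumr (bigD1_seq a)//= qf// eqxx big_seq_cond.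
    rewrite big1 ?addr0 ?subrr// => b /andP[sb /negPf ba].
    by rewrite qf// ba.
  have : u = horner_mx M (\prod_(a <- s) ((w a).1 * p a)) *m u.
    have sub : {subset s <= s} by [].
    elim: {-2}s sub => [|a t IHt] sub; first by rewrite big_nil rmorph1 mul1mx.
    rewrite big_cons horner_mxM_vec -IHt ?u_fix// -?u_fix//.
    - by apply: sub; rewrite inE eqxx.
    - by move=> b tb; apply: sub; rewrite inE tb orbT.
  rewrite big_split /= -charE horner_mxM_vec Cayley_Hamilton mul0mx mulmx0.
  by [].
- move=> a sa; have le_n : (count_mem a r <= n)%N by rewrite -size_r count_size.
  have -> : ('X - a%:P) ^+ n = ('X - a%:P) ^+ (n - count_mem a r) * p a.
    by rewrite -exprD subnK.
  by rewrite horner_mxM_vec pf// mulmx0.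
Qed.

Definition bounded_orbit M v : Prop := exists B, forall t, mxnorm1 (M ^+ t *m v) <= B.

Lemma horner_mx_comm M p t : M ^+ t *m horner_mx M p = horner_mx M p *m M ^+ t.
Proof. exact/commr_sym/commrX/comm_horner_mx. Qed.

Lemma bounded_orbit_horner M v p : bounded_orbit M v -> bounded_orbit M (horner_mx M p *m v).
Proof.
move=> [B HB]; exists (mxnorm1 (horner_mx M p) * B) => t.
rewrite mulmxA horner_mx_comm -mulmxA (le_trans (mxnorm1M _ _))//.
by rewrite ler_wpM2l ?mxnorm1_ge0.
Qed.

Lemma mxnorm1Z m p (c : C) (A : 'M[C]_(m, p)) : mxnorm1 (c *: A) = cmod c * mxnorm1 A.
Proof.
rewrite /mxnorm1 mulr_sumr; apply: eq_bigr => i _.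
by rewrite mulr_sumr; apply: eq_bigr => j _; rewrite mxE cmodM.
Qed.

Lemma mxnorm1_sum m p (I : Type) (r : seq I) (P : pred I) (F : I -> 'M[C]_(m, p)) :
  mxnorm1 (\sum_(i <- r | P i) F i) <= \sum_(i <- r | P i) mxnorm1 (F i).
Proof.
elim/big_rec2: _ => [|i y x _ le_xy].
  by rewrite /mxnorm1 !big1// => *; rewrite ?big1// => *; rewrite mxE cmod0.
by apply: le_trans (mxnorm1D _ _) _; rewrite lerD2l.
Qed.

Lemma eigenvector_pow M a u t : M *m u = a *: u -> M ^+ t *m u = a ^+ t *: u.
Proof.
move=> Mu; elim: t => [|t IHt]; first by rewrite !expr0 mul1mx scale1r.
by rewrite exprSr -mulmxE -mulmxA Mu -scalemxAr IHt scalerA exprS.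
Qed.

(** A Jordan chain of length at least two over [a] would give [M^t y = a^t y + t a^(t-1) w] with an
    eigenvector [w != 0], which grows at least linearly when [1 <= cmod a]. *)
Lemma bounded_generalized_eigenvector M a u k :
  horner_mx M (('X - a%:P) ^+ k) *m u = 0 -> 1 <= cmod a -> bounded_orbit M u ->
  M *m u = a *: u.
Proof.
set N := 'X - a%:P; move=> Nk a1 bu.
have NE v : horner_mx M N *m v = M *m v - a *: v.
  by rewrite /N rmorphB /= horner_mx_X horner_mx_C mulmxBl mul_scalar_mx.
have exk : exists k, horner_mx M (N ^+ k) *m u == 0 by exists k; exact/eqP.
case: (ex_minnP exk) => -[|[|m]] /eqP.
- by rewrite rmorph1 mul1mx => -> _; rewrite mulmx0 scaler0.
- by rewrite expr1 NE => /eqP; rewrite subr_eq0 => /eqP.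
move=> Nm minm.
pose y := horner_mx M (N ^+ m) *m u; pose w := horner_mx M N *m y.
have wE : w = horner_mx M (N ^+ m.+1) *m u by rewrite exprS horner_mxM_vec.
have w0 : w != 0.
  by apply/negP; rewrite wE => /minm; rewrite ltnn.
have Mw : M *m w = a *: w.
  by apply/eqP; rewrite -subr_eq0 -NE wE -horner_mxM_vec -exprS; exact/eqP.
have My : M *m y = a *: y + w by rewrite /w NE addrC subrK.
(* Multiplied by [a], so that the exponent [t - 1] does not occur at [t = 0]. *)
have Mty t : a *: (M ^+ t *m y) = a ^+ t.+1 *: y + (t%:R * a ^+ t) *: w.
  elim: t => [|t IHt]; first by rewrite !expr0 mul1mx mul0r scale0r addr0 expr1.
  rewrite exprSr -mulmxE -mulmxA My mulmxDr -scalemxAr scalerDr IHt.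
  rewrite (eigenvector_pow _ Mw) scalerDr !scalerA -!exprS -addrA -scalerDl.
  congr (_ + _ *: _); rewrite mulrCA -exprS -natr1 mulrDl mul1r.
  by [].
have [B HB] : bounded_orbit M y by exact: bounded_orbit_horner.
have w_gt0 : 0 < mxnorm1 w.
  by rewrite lt_neqAle mxnorm1_ge0 andbT eq_sym; apply: contra w0 => /eqP/mxnorm1_eq0->.
have [t] := not_linearly_bounded (cmod a * B + cmod a * mxnorm1 y) w_gt0.
rewrite ltNge => /negP[].
have at1 : 1 <= cmod a ^+ t by exact: exprn_ege1.
have at0 : 0 < cmod a ^+ t by exact: lt_le_trans at1.
have B0 : 0 <= B by rewrite (le_trans _ (HB 0%N))// mxnorm1_ge0.
rewrite -(ler_pM2l at0).
have -> : cmod a ^+ t * (t%:R * mxnorm1 w) = mxnorm1 ((t%:R * a ^+ t) *: w).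
  have -> : (t%:R : C) = (t%:R : R)%:C%C by rewrite rmorph_nat.
  by rewrite mxnorm1Z cmodM cmodX cmod_real ger0_norm//; ring.
have -> : (t%:R * a ^+ t) *: w = a *: (M ^+ t *m y) - a ^+ t.+1 *: y.
  by rewrite Mty addrAC subrr add0r.
rewrite (le_trans (mxnorm1B _ _))// !mxnorm1Z cmodX mulrDr lerD//.
  apply: (@le_trans _ _ (cmod a * B)); first by rewrite ler_wpM2l ?cmod_ge0.
  by rewrite ler_peMl// mulr_ge0 ?cmod_ge0.
by rewrite exprSr mulrA.
Qed.

Lemma bounded_eigenvector M a u : M *m u = a *: u -> u != 0 -> bounded_orbit M u ->
  cmod a <= 1.
Proof.
move=> Mu u0 [B HB]; rewrite leNgt; apply/negP => a1.
have u_gt0 : 0 < mxnorm1 u.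
  by rewrite lt_neqAle mxnorm1_ge0 andbT eq_sym; apply: contra u0 => /eqP/mxnorm1_eq0->.
have bernoulli t : 1 + t%:R * (cmod a - 1) <= cmod a ^+ t.
  elim: t => [|t IHt]; first by rewrite mul0r addr0.
  rewrite exprS -natr1.
  have a0 : 0 <= cmod a by exact: cmod_ge0.
  apply: le_trans (ler_wpM2l a0 IHt).
  have : 0 <= t%:R * (cmod a - 1) ^+ 2 by rewrite mulr_ge0 ?sqr_ge0.
  by rewrite expr2; nra.
have am1 : 0 < cmod a - 1 by rewrite subr_gt0.
have [t] := not_linearly_bounded B (mulr_gt0 am1 u_gt0).
rewrite ltNge => /negP[]; apply: le_trans (HB t).
rewrite (eigenvector_pow _ Mu) mxnorm1Z cmodX mulrA ler_wpM2r ?mxnorm1_ge0//.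
by rewrite (le_trans _ (bernoulli t))// lerDr.
Qed.

(** Induction along the Jordan chain. A rate strictly between [cmod a] and 1 absorbs the polynomial
    factors of the powers, so the rate is the same at all levels and only the constant grows. *)
Lemma contracting_component M a u k :
  horner_mx M (('X - a%:P) ^+ k) *m u = 0 -> cmod a < 1 ->
  exists2 K : R, 0 <= K & forall t, mxnorm1 (M ^+ t *m u) <= K * ((1 + cmod a) / 2) ^+ t.
Proof.
move=> Nk a1; set r := (1 + cmod a) / 2.
have a0 := cmod_ge0 a.
have r0 : 0 <= r by rewrite divr_ge0// addr_ge0.
have ra : 0 < r - cmod a by rewrite /r; lra.
elim: k u Nk => [|k IHk] u.
  rewrite expr0 rmorph1 mul1mx => ->; exists 0 => // t.
  by rewrite mulmx0 mul0r /mxnorm1 !big1// => *; rewrite ?big1// => *; rewrite mxE cmod0.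
rewrite exprSr horner_mxM_vec => /IHk[K K0 HK].
set w := horner_mx M _ *m u in HK.
have Mu : M *m u = a *: u + w.
  by rewrite /w rmorphB /= horner_mx_X horner_mx_C mulmxBl mul_scalar_mx addrC subrK.
(* Chosen so that [cmod a * K' + K <= r * K'], the induction step in [t], and [mxnorm1 u <= K'], its
   start. *)
pose K' := mxnorm1 u + K / (r - cmod a).
have K'0 : 0 <= K' by rewrite addr_ge0 ?mxnorm1_ge0// divr_ge0// ltW.
have KK' : K <= K' * (r - cmod a).
  by rewrite -ler_pdivrMr// /K' lerDr mxnorm1_ge0.
exists K' => //; elim=> [|t IHt].
  by rewrite !expr0 mul1mx mulr1 /K' lerDl divr_ge0// ltW.
rewrite exprSr -mulmxE -mulmxA Mu mulmxDr -scalemxAr (le_trans (mxnorm1D _ _))//.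
rewrite mxnorm1Z.
apply: (@le_trans _ _ (cmod a * (K' * r ^+ t) + K * r ^+ t)).
  by rewrite lerD// ler_wpM2l.
have rt : 0 <= r ^+ t by exact: exprn_ge0.
have := ler_wpM2r rt KK'; rewrite exprS; nra.
Qed.

(** [K] may not depend on [t0], which will contain the waiting time [N]. A contracting component has
    a summable orbit, so [c = 0]; otherwise the component is an eigenvector with [cmod a = 1] and
    the sum is a Weyl sum at [a ^+ D]. *)
Lemma component_asymptotic M a u k (L D : nat) : (0 < L)%N -> (0 < D)%N ->
  horner_mx M (('X - a%:P) ^+ k) *m u = 0 -> bounded_orbit M u ->
  exists (c : C) (K : R),
    (c != 0 -> [/\ cmod a = 1, u != 0 & M *m u = a *: u]) /\
    forall m t0 : nat,
      mxnorm1 (\sum_(j < m) chirp R L j *: (M ^+ (t0 + D * j) *m u)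
               - (m%:R * c * a ^+ t0) *: u) <= K.
Proof.
move=> L0 D0 Nk bu; have [->|u0] := eqVneq u 0.
  exists 0, 0; split=> [|m t0]; first by rewrite eqxx.
  rewrite big1 => [|j _]; rewrite ?mulmx0 ?scaler0// subr0.
  by rewrite /mxnorm1 !big1// => *; rewrite ?big1// => *; rewrite mxE cmod0.
have [a1|a1] := ltP (cmod a) 1.
  have [K K0 HK] := contracting_component Nk a1; set r := (1 + cmod a) / 2 in HK.
  have a0 := cmod_ge0 a.
  have r0 : 0 <= r by rewrite divr_ge0// addr_ge0.
  have r1 : r < 1 by rewrite /r; lra.
  exists 0, (K / (1 - r)); split=> [|m t0]; first by rewrite eqxx.
  rewrite mulr0 mul0r scale0r subr0 (le_trans (mxnorm1_sum _ _ _))//.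
  apply: (@le_trans _ _ (\sum_(j < m) K * r ^+ j)).
    apply: ler_sum => j _; rewrite mxnorm1Z cmod_chirp mul1r (le_trans (HK _))//.
    rewrite ler_wpM2l// ler_wiXn2l// ?(ltW r1)//.
    by rewrite (leq_trans _ (leq_addl _ _))// leq_pmull.
  rewrite -mulr_sumr ler_wpM2l// -[leRHS]mul1r ler_pdivlMr ?subr_gt0// mulrC.
  have -> : (1 - r) * \sum_(i < m) r ^+ i = 1 - r ^+ m.
    by rewrite -[LHS]opprK -mulNr opprB -subrX1 opprB.
  by rewrite lerBlDr lerDl exprn_ge0.
have Mu := bounded_generalized_eigenvector Nk a1 bu.
have a1E : cmod a = 1 by apply/eqP; rewrite eq_le a1 (bounded_eigenvector Mu).
have [c [K HK]] := @weyl_sum_asymptotic R L L0 (a ^+ D) (etrans (cmodX _ _) (etrans (congr1 (fun x => x ^+ D) a1E) (expr1n _ _))).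
exists c, (K * mxnorm1 u); split=> // m t0.
have -> : \sum_(j < m) chirp R L j *: (M ^+ (t0 + D * j) *m u) = (a ^+ t0 * weyl_sum L (a ^+ D) m) *: u.
  rewrite /weyl_sum mulr_sumr scaler_suml; apply: eq_bigr => j _.
  by rewrite (eigenvector_pow _ Mu) scalerA exprD exprM; congr (_ *: _); ring.
rewrite -scalerBl mxnorm1Z ler_wpM2r ?mxnorm1_ge0//.
rewrite [m%:R * c * _]mulrC -mulrBr cmodM cmodX a1E expr1n mul1r.
exact: HK.
Qed.

(** [orbit_span] starts at [M *m v], not at [v]. Writing the eigenvector as [a^-1] times its image
    under [M] raises all exponents by one. *)
Lemma horner_orbit_span M v (p : {poly C}) a : a != 0 ->
  M *m (horner_mx M p *m v) = a *: (horner_mx M p *m v) ->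
  orbit_span M v (horner_mx M p *m v).
Proof.
move=> a0 Mf; exists (size p), (fun i => a^-1 * p`_i).
have -> : horner_mx M p *m v = a^-1 *: (M *m (horner_mx M p *m v)).
  by rewrite Mf scalerA mulVf// scale1r.
rewrite -{1}[p]coefK poly_def rmorph_sum /= mulmx_suml mulmx_sumr scaler_sumr.
apply: eq_bigr => i _; rewrite -mul_polyC rmorphM /= rmorphXn /= horner_mx_C horner_mx_X.
rewrite -mulmxE mul_scalar_mx -scalemxAl.
by rewrite -scalemxAr scalerA mulmxA mulmxE -exprS.
Qed.

Lemma trmx_exp m (A : 'M[C]_m.+1) k : (A ^+ k)^T = A^T ^+ k.
Proof.
elim: k => [|k IHk]; first by rewrite !expr0 trmx1.
by rewrite exprS exprSr -!mulmxE trmx_mul IHk.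
Qed.

(** Distinct eigenvalues of [M] may have the same [k]-th power, so the component of [v] for [M ^+ k]
    collects all components of [M] with that power. It is nonzero because [q a] maps it back to the
    component of [a]. *)
Lemma component_distinct_eigenvalue M v s q a k : components M v s q -> a \in s ->
  cmod a = 1 -> horner_mx M (q a) *m v != 0 ->
  M *m (horner_mx M (q a) *m v) = a *: (horner_mx M (q a) *m v) ->
  distinct_eigenvalue M v k (a ^+ k).
Proof.
move=> comp sa a1 f0 Mf; have [sU vE Nf qf] := comp.
have a0 : a != 0 by rewrite -cmod_eq0 a1 oner_eq0.
pose f b := horner_mx M (q b) *m v; rewrite -/(f a) in Mf f0.
split.
- exists (f a); split => //; first exact: (horner_orbit_span a0 Mf).
  exact: eigenvector_pow.
- by rewrite cmodX a1 expr1n.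
pose g b := \sum_(c <- s | c ^+ k == b) f c.
exists (g (a ^+ k)); last first.
  apply: contra f0 => /eqP g0; have : horner_mx M (q a) *m g (a ^+ k) = 0 by rewrite g0 mulmx0.
  rewrite mulmx_sumr -big_filter (bigD1_seq a) ?filter_uniq ?mem_filter ?eqxx//=.
  rewrite qf// eqxx big_seq_cond big1 ?addr0 => [<-//|b].
  by rewrite mem_filter => /andP[/andP[_ sb] /negPf ba]; rewrite qf// ba.
exists (undup [seq c ^+ k | c <- s]), g; split => //.
- exact: undup_uniq.
- by rewrite mem_undup; apply: (map_f (fun c => c ^+ k)).
- move=> b _; rewrite geigenspaceE; apply/sub_kermxP; apply: trmx_inj.
  rewrite trmx0 trmx_mul trmxK trmx_exp linearB /= trmxK tr_scalar_mx mulmx_sumr.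
  rewrite big_seq_cond big1// => c /andP[sc /eqP <-].
  (* ['X - c] divides ['X^k - c ^+ k], so what a power of [M - c] kills is killed by the same power
     of [M ^+ k - c ^+ k]. *)
  have /factor_theorem[h hE] : root ('X^k - (c ^+ k)%:P) c.
    by rewrite rootE !hornerE subrr.
  have -> : M ^+ k - (c ^+ k)%:M = horner_mx M (h * ('X - c%:P)).
    rewrite -hE rmorphB /= horner_mx_C; congr (_ - _).
    by rewrite (rmorphXn (horner_mx M)) /= horner_mx_X.
  by rewrite -rmorphXn exprMn horner_mxM_vec Nf// mulmx0.
rewrite {1}vE /g; under [RHS]eq_bigr do rewrite big_mkcond; rewrite exchange_big /=.
apply: eq_big_seq => c sc; rewrite (bigD1_seq (c ^+ k)) ?undup_uniq ?mem_undup//=; last first.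
  exact: (map_f (fun c => c ^+ k)).
by rewrite eqxx big1 ?addr0// => b /negPf; rewrite eq_sym => ->.
Qed.

End SpectralComponents.

(** * Sub-Gaussian tails *)

Section SubGaussian.
Context {R : realType} {disp : measure_display} {Omega : measurableType disp}.
Variable P : probability Omega R.
Implicit Types (G : set (set Omega)) (S f X Y : Omega -> R).

(** Turns an almost sure bound on a conditional expectation into a bound on the integral over each
    event of [G], the form required by [integral_expRM_le]. The exceptional null set is removed
    before comparing pointwise. *)
Lemma condexp_set_le G X Y c (A : set Omega) : G `<=` measurable ->
  is_condexp P G X Y -> {ae P, forall w, Y w <= c} -> 0 <= c -> G A ->
  (\int[P]_(w in A) (X w)%:E <= c%:E * P A)%E.
Proof.
move=> Gm [_ _ intY XY] [N [mN PN NY]] c0 GA; rewrite -XY//.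
have mA := Gm _ GA.
have intYA : P.-integrable A (EFin \o Y) by exact: (integrableS measurableT mA).
rewrite (negligible_integral mN mA intYA PN).
have mAN : measurable (A `\` N) by exact: measurableD.
apply: (@le_trans _ _ (\int[P]_(w in A `\` N) c%:E)%E); last first.
  rewrite (integral_cst P mAN); apply: lee_wpmul2l; rewrite ?lee_fin//.
  by rewrite le_measure ?inE//; exact: subDsetl.
apply: le_integral => //.
- exact: (integrableS mA).
- exact: finite_measure_integrable_cst.
- move=> w; rewrite inE => -[_ Nw] /=; rewrite lee_fin; apply/negPn/negP => cY.
  by apply: Nw; apply: NY => /=; exact/negP.
Qed.

Lemma measurable_wrt_fun G S : G `<=` measurable -> measurable_wrt (@Borel R) G S ->
  measurable_fun setT S.
Proof. by move=> Gm mS _ B mB; rewrite setTI; apply: Gm; exact: mS. Qed.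

Lemma measurable_ge S s : measurable_fun setT S -> measurable [set w | s <= S w].
Proof.
move=> mS; rewrite (_ : [set _ | _] = setT `&` S @^-1` `[s, +oo[%classic); first exact: mS.
by rewrite setTI; apply/seteqP; split => w /=; rewrite in_itv/= andbT.
Qed.

Lemma measurable_gt S s : measurable_fun setT S -> measurable [set w | s < S w].
Proof.
move=> mS; rewrite (_ : [set _ | _] = setT `&` S @^-1` `]s, +oo[%classic); first exact: mS.
by rewrite setTI; apply/seteqP; split => w /=; rewrite in_itv/= andbT.
Qed.

(** The cells of a grid of mesh [h], numbered by natural numbers through [pickle] so that they form
    a countable partition. *)
Let level (h : R) (n : nat) : set R := [set x | pickle (Num.floor (x / h)) = n].

Let measurable_level h n : 0 < h -> measurable (level h n).
Proof.
move=> h0; have [[k kn]|nok] := pselect (exists k : int, pickle k = n); last first.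
  by rewrite (_ : level h n = set0)// -subset0 => x xn; apply: nok; exists (Num.floor (x / h)).
rewrite (_ : level h n = `[k%:~R * h, (k + 1)%:~R * h[%classic); first exact: measurable_itv.
apply/seteqP; split => x /=; rewrite in_itv /=.
  rewrite -kn => /(pcan_inj pickleK) <-.
  by rewrite -ler_pdivlMr// -ltr_pdivrMr// floor_itv.
by rewrite -ler_pdivlMr// -ltr_pdivrMr// -floor_eq -kn => /eqP xk; congr pickle.
Qed.

Let level_expR h n x y : 0 < h -> level h n x -> level h n y -> expR x <= expR h * expR y.
Proof.
move=> h0 xn yn; rewrite -expRD ler_expR.
have xy : Num.floor (x / h) = Num.floor (y / h) by apply: (pcan_inj pickleK); rewrite xn yn.
have /andP[_] := floor_itv (x / h); have /andP[+ _] := floor_itv (y / h).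
rewrite xy ler_pdivlMr// ltr_pdivrMr// intrD mulrDl mul1r => le1 /ltW le2.
by rewrite (le_trans le2)// addrC lerD2l.
Qed.

(* [S] is discretized on a grid of mesh [h], at the cost of a factor
   [expR (h + h)]; no conditional expectation of a product is needed. *)
Lemma integral_expRM_le G S f (b c : R) :
  G `<=` measurable -> measurable_wrt (@Borel R) G S ->
  measurable_fun setT f -> (forall w, 0 <= f w) -> 0 <= c ->
  (forall A, G A -> \int[P]_(w in A) (f w)%:E <= c%:E * P A)%E ->
  (\int[P]_w (expR (S w))%:E <= b%:E)%E ->
  (\int[P]_w (expR (S w) * f w)%:E <= (c * b)%:E)%E.
Proof.
move=> Gm mS mf f0 c0 fle Sle.
have mSf := measurable_wrt_fun Gm mS.
have meS : measurable_fun setT (fun w => expR (S w)) by exact: measurableT_comp.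
have eS0 w : (0 <= (expR (S w))%:E)%E by rewrite lee_fin expR_ge0.
have eSf0 w : (0 <= (expR (S w) * f w)%:E)%E by rewrite lee_fin mulr_ge0 ?expR_ge0.
have b0 : 0 <= b by rewrite -lee_fin (le_trans _ Sle)// integral_ge0.
have grid h : 0 < h -> (\int[P]_w (expR (S w) * f w)%:E <= (expR (h + h) * (c * b))%:E)%E.
  move=> h0; pose F n := S @^-1` level h n.
  have GF n : G (F n) by apply: mS; exact: measurable_level.
  have mF n : measurable (F n) by exact: Gm.
  have FT : \bigcup_n F n = setT.
    by apply/seteqP; split => // w _; exists (pickle (Num.floor (S w / h))).
  have tF : trivIset setT F by move=> i j _ _ [w [<- <-]].
  have k0 : 0 <= expR (h + h) * c by rewrite mulr_ge0 ?expR_ge0.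
  apply: (@le_trans _ _ ((expR (h + h) * c)%:E * \int[P]_w (expR (S w))%:E)%E); last first.
    by rewrite mulrA (EFinM _ b); apply: lee_wpmul2l; rewrite ?lee_fin.
  rewrite -FT !ge0_integral_bigcup//; last 2 first.
  - by rewrite FT; apply/measurable_EFinP.
  - by rewrite FT; apply/measurable_EFinP; exact: measurable_funM.
  rewrite -nneseriesZl; last by move=> n _; exact: integral_ge0.
  apply: lee_nneseries => [n _ _|n _]; first exact: integral_ge0.
  have [->|/set0P[w0 Fw0]] := eqVneq (F n) set0; first by rewrite !integral_set0 mule0.
  have mfF : measurable_fun (F n) f by exact: measurable_funTS.
  have meSF : measurable_fun (F n) (fun w => expR (S w)) by exact: measurable_funTS.
  (* On a cell, [expR (S w)] is replaced by its value at one sample point and later restored; each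
     replacement costs a factor [expR h]. *)
  pose m := expR (S w0); have m0 : 0 <= m by exact: expR_ge0.
  apply: (@le_trans _ _ (\int[P]_(w in F n) ((expR h * m)%:E * (f w)%:E))%E).
    apply: ge0_le_integral => //.
    - by apply/measurable_EFinP; exact: measurable_funM.
    - by apply: measurable_funeM; exact/measurable_EFinP.
    - by move=> w Fw; rewrite -EFinM lee_fin ler_wpM2r// (level_expR (n := n)).
  rewrite ge0_integralZl//; last 3 first.
  - exact/measurable_EFinP.
  - by move=> w _; rewrite lee_fin.
  - by rewrite lee_fin mulr_ge0 ?expR_ge0.
  apply: (@le_trans _ _ ((expR h * m)%:E * (c%:E * P (F n)))%E).
    by apply: lee_wpmul2l; rewrite ?fle// lee_fin mulr_ge0 ?expR_ge0.
  have -> : ((expR h * m)%:E * (c%:E * P (F n)) = (expR h * c)%:E * \int[P]_(w in F n) m%:E)%E.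
    by rewrite integral_cst// !muleA -!EFinM mulrAC.
  have -> : (expR (h + h) * c)%:E = ((expR h * c)%:E * (expR h)%:E)%E.
    by rewrite -EFinM expRD mulrAC.
  rewrite -muleA; apply: lee_wpmul2l.
    by rewrite lee_fin mulr_ge0 ?expR_ge0.
  rewrite -ge0_integralZl//; last first.
    by first [exact/measurable_EFinP | rewrite lee_fin expR_ge0].
  apply: ge0_le_integral => //.
  - by apply: measurable_funeM; exact/measurable_EFinP.
  - by move=> w Fw; rewrite -EFinM lee_fin (level_expR (n := n)).
have cb0 : 0 <= c * b by rewrite mulr_ge0.
apply/lee_addgt0Pr => e e0.
have d0 : 0 < e / (c * b + 1) by rewrite divr_gt0// ltr_wpDl.
(* This mesh makes the loss [expR (h + h)] equal to [1 + e / (c * b + 1)], so the excess is at most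
   [e]; the 1 in the denominator covers [c * b = 0]. *)
have h0 : 0 < ln (1 + e / (c * b + 1)) / 2 by rewrite divr_gt0// ln_gt0// ltrDl.
apply: (le_trans (grid _ h0)); rewrite -splitr lnK ?posrE ?addr_gt0//.
rewrite -EFinD lee_fin mulrDl mul1r lerD2l mulrAC ler_pdivrMr ?ltr_wpDl//.
by rewrite ler_pM2l// lerDl.
Qed.

(** Exponential Markov inequality. *)
Lemma probability_ge_expR_le S (lambda s b : R) :
  measurable_fun setT S -> 0 <= lambda ->
  (\int[P]_w (expR (lambda * S w))%:E <= b%:E)%E ->
  (P [set w | (s <= S w)%R] <= (expR (- (lambda * s)) * b)%:E)%E.
Proof.
move=> mS l0 Sle.
have mA : measurable [set w | (s <= S w)%R].
  exact: measurable_ge.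
have me : measurable_fun setT (EFin \o (fun w => expR (lambda * S w))).
  by apply/measurable_EFinP/measurableT_comp => //; exact: measurable_funM.
have key : ((expR (lambda * s))%:E * P [set w | (s <= S w)%R] <= b%:E)%E.
  rewrite -(integral_cst P mA) (le_trans _ Sle)//.
  apply: (@le_trans _ _ (\int[P]_(w in [set w | (s <= S w)%R]) (expR (lambda * S w))%:E)%E).
    apply: ge0_le_integral => //.
    - by move=> w _; rewrite lee_fin expR_ge0.
    - exact: measurable_funTS.
    - by move=> w /= sS; rewrite lee_fin ler_expR ler_wpM2l.
  by apply: ge0_subset_integral => // w _; rewrite lee_fin expR_ge0.
rewrite EFinM -[X in (X <= _)%E]mul1e -(expR0 R) -(addNr (lambda * s)) expRD EFinM -muleA.
by apply: lee_wpmul2l => //; rewrite lee_fin expR_ge0.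
Qed.

(** For [v > 0] this is the Chernoff bound at the optimal parameter [s / v]. For [v = 0] the
    parameter can be taken arbitrarily large: [lambda = l * n.+1] handles [n.+1%:R^-1 <= S], and
    these events increase to [0 < S]. The strict inequality in the event is what makes this case
    true. *)
Lemma sub_gaussian_tail S (v l : R) : measurable_fun setT S -> 0 <= v -> 0 <= l ->
  (forall lambda : R, \int[P]_w (expR (lambda * S w))%:E <= (expR (lambda ^+ 2 * v / 2))%:E)%E ->
  (P [set w | (Num.sqrt (2 * v * l) < S w)%R] <= (expR (- l))%:E)%E.
Proof.
move=> mS v0 l0 Sle; have [v_eq0|v_neq0] := eqVneq v 0.
  pose F n := [set w | n.+1%:R^-1 <= S w].
  have mF n : measurable (F n).
    exact: measurable_ge.
  have FE : [set w | (Num.sqrt (2 * v * l) < S w)%R] = \bigcup_n F n.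
    rewrite v_eq0 mulr0 mul0r sqrtr0; apply/seteqP; split => w /=.
      move=> S0; exists (Num.truncn (S w)^-1) => //=.
      rewrite /F /= invf_ple ?posrE ?ltr0Sn//; exact: ltW (truncnS_gt _).
    by move=> [n _ /=]; apply: lt_le_trans; rewrite invr_gt0.
  rewrite FE; have mU : measurable (\bigcup_n F n) by exact: bigcup_measurable.
  have ndF : nondecreasing_seq F.
    move=> m n mn; apply/subsetPset => w /=; apply: le_trans.
    by rewrite lef_pV2 ?posrE// ler_nat.
  have cvgF := nondecreasing_cvg_mu (mu := P) mF mU ndF.
  rewrite -(cvg_lim _ cvgF)//; apply: lime_le; first by apply/cvg_ex; eexists; exact: cvgF.
  apply: nearW => n /=; have := @probability_ge_expR_le S (l * n.+1%:R) n.+1%:R^-1 _ mS _ (Sle _).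
  by rewrite v_eq0 mulr0 mul0r expR0 mulr1 mulfK// => -> //; rewrite mulr_ge0.
have vp : 0 < v by rewrite lt_neqAle eq_sym v_neq0.
set s := Num.sqrt _; have s0 : 0 <= s by exact: sqrtr_ge0.
have s2 : s ^+ 2 = 2 * v * l by rewrite sqr_sqrtr// !mulr_ge0.
have mlt : measurable [set w | s < S w].
  exact: measurable_gt.
have mle : measurable [set w | (s <= S w)%R].
  exact: measurable_ge.
apply: (@le_trans _ _ (P [set w | (s <= S w)%R])).
  by apply: le_measure; rewrite ?inE// => w /= /ltW.
have sv : 0 <= s / v by rewrite divr_ge0.
apply: (le_trans (probability_ge_expR_le s mS sv (Sle (s / v)))).
rewrite -expRD lee_fin ler_expR.
have -> : - (s / v * s) + (s / v) ^+ 2 * v / 2 = - (s ^+ 2 / (2 * v)) by field.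
by rewrite s2 (_ : 2 * v * l / (2 * v) = l)//; field.
Qed.

End SubGaussian.

(** * Weighted sums of the noise along increasing times *)

Section NoiseSums.
Context {R : realType} {disp : measure_display} {Omega : measurableType disp}.
Variable P : probability Omega R.
Variables (n : nat) (rho : R) (F : nat -> set (set Omega)).
Variables (x : nat -> Omega -> 'cV[R]_n) (eta : nat -> Omega -> R).
Hypothesis noise : cond_sub_gaussian_noise P rho F x eta.

Lemma measurable_wrt_sum (G : set (set Omega)) (I : Type) (s : seq I)
    (a : I -> R) (S : I -> Omega -> R) : sigma_algebra setT G ->
  (forall i, measurable_wrt (@Borel R) G (S i)) ->
  measurable_wrt (@Borel R) G (fun w => \sum_(i <- s) a i * S i w).
Proof.
move=> sG mS; have GE := measurable_g_measurableTypeE sG.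
have mSG i : measurable_fun setT (S i : g_sigma_algebraType G -> R).
  by move=> _ B mB; rewrite setTI GE; exact: mS.
have mSum : measurable_fun setT
    ((fun w => \sum_(i <- s) a i * S i w) : g_sigma_algebraType G -> R).
  by apply: measurable_sum => i; exact: measurable_funM.
by move=> B mB; have := mSum measurableT B mB; rewrite setTI GE.
Qed.

Lemma measurable_noise t : (0 < t)%N -> measurable_fun setT (eta t).
Proof.
move=> t0; have [[_ Fm _] _ meta _] := noise.
by apply: (measurable_wrt_fun (Fm t)); apply: meta; rewrite t0 leqnn.
Qed.

(** The last term is split off: all earlier noise is measurable at time [(tau m).-1] because [tau]
    is strictly increasing, and the last factor is sub-Gaussian conditionally on that time. *)
Lemma noise_sum_mgf (m : nat) (tau : nat -> nat) (a : nat -> R) (lambda : R) :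
  (0 < tau 0)%N -> (forall j, (tau j < tau j.+1)%N) ->
  (\int[P]_w (expR (lambda * \sum_(j < m) a j * eta (tau j) w))%:E
    <= (expR (lambda ^+ 2 * (rho ^+ 2 * \sum_(j < m) a j ^+ 2) / 2))%:E)%E.
Proof.
move=> tau0 tauS; have [[sF Fm Fmono] _ meta sub] := noise.
have tau_mono : {homo tau : i j / (i < j)%N} by apply: homo_ltn => // ? ? ?; exact: ltn_trans.
have tau_gt0 j : (0 < tau j)%N.
  by case: j => // j; rewrite (leq_trans tau0)// ltnW// tau_mono.
elim: m => [|m IHm].
  under eq_integral do rewrite big_ord0 mulr0 expR0.
  rewrite big_ord0 !mulr0 mul0r expR0.
  have := integral_cst P measurableT 1%E => /= ->.
  by rewrite mul1e probability_setT.
have [_ _ /(_ (lambda * a m))[Y Yexp Yle]] := sub (tau m) (tau_gt0 m).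
set c := expR _ in Yle.
have -> : expR (lambda ^+ 2 * (rho ^+ 2 * (\sum_(j < m.+1) a j ^+ 2)) / 2) =
    c * expR (lambda ^+ 2 * (rho ^+ 2 * (\sum_(j < m) a j ^+ 2)) / 2).
  by rewrite -expRD big_ord_recr /=; congr expR; field.
have -> : (fun w => (expR (lambda * \sum_(j < m.+1) a j * eta (tau j) w))%:E) =
    (fun w => (expR (lambda * \sum_(j < m) a j * eta (tau j) w)
      * expR (lambda * a m * eta (tau m) w))%:E).
  by apply/funext => w; rewrite -expRD big_ord_recr /= mulrDr mulrA.
apply: (@integral_expRM_le _ _ _ P (F (tau m).-1)) => //.
- move=> B mB.
  have := @measurable_wrt_sum (F (tau m).-1) _ (enum 'I_m) (fun j => lambda * a j)
    (fun j => eta (tau j)) (sF _).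
  have -> : (fun w => \sum_(j <- enum 'I_m) lambda * a j * eta (tau j) w) =
     (fun w => lambda * \sum_(j < m) a j * eta (tau j) w).
    apply/funext => w; rewrite mulr_sumr big_enum; apply: eq_bigr => j _.
    by rewrite mulrA.
  apply => // j C mC; apply: meta => //.
  by rewrite tau_gt0 -ltnS prednK ?tau_gt0// tau_mono.
- apply: measurableT_comp => //; apply: measurable_funM => //.
  exact: measurable_noise.
- exact: expR_ge0.
- by move=> A FA; apply: (condexp_set_le (Fm _) Yexp Yle) => //; exact: expR_ge0.
Qed.

Lemma noise_sum_tail (m : nat) (tau : nat -> nat) (a : nat -> R) (l : R) :
  (0 < tau 0)%N -> (forall j, (tau j < tau j.+1)%N) -> 0 <= l ->
  (P [set w | (Num.sqrt (2 * (rho ^+ 2 * \sum_(j < m) a j ^+ 2) * l)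
       < \sum_(j < m) a j * eta (tau j) w)%R] <= (expR (- l))%:E)%E.
Proof.
move=> tau0 tauS l0; apply: sub_gaussian_tail => //.
- apply: measurable_sum => j; apply: measurable_funM => //.
  apply: measurable_noise; elim: (nat_of_ord j) => // i taui.
  exact: ltn_trans (tauS i).
- by rewrite mulr_ge0 ?sqr_ge0// sumr_ge0// => *; exact: sqr_ge0.
- by move=> lambda; exact: noise_sum_mgf.
Qed.

End NoiseSums.

Lemma union_bound (R : realType) (disp : measure_display) (Omega : measurableType disp)
    (P : probability Omega R) (I : eqType) (s : seq I) (A : I -> set Omega) (e : R) :
  (forall i, measurable (A i)) -> (forall i, P (A i) <= e%:E)%E ->
  exists N, [/\ measurable N, (P N <= ((size s)%:R * e)%:E)%E
    & forall i, i \in s -> A i `<=` N].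
Proof.
move=> mA Ae; elim: s => [|i s [N [mN PN sN]]].
  by exists set0; split => //; rewrite measure0 mul0r.
exists (A i `|` N); split.
- exact: measurableU.
- apply: (le_trans (measureU2 P (mA i) mN)).
  by rewrite /= -natr1 mulrDl mul1r addrC EFinD leeD.
- move=> j; rewrite inE => /predU1P[->|js] w Aw; first by left.
  by right; exact: (sN j).
Qed.

(** * Arms in general position *)

Section Householder.
Variable R : realType.

Lemma trmx_mul_self n (a : 'cV[R]_n) : (a^T *m a) 0 0 = \sum_i a i 0 ^+ 2.
Proof. by rewrite mxE; apply: eq_bigr => i _; rewrite mxE expr2. Qed.

Lemma trmx_mul_self_eq0 n (a : 'cV[R]_n) : (a^T *m a) 0 0 = 0 -> a = 0.
Proof.
rewrite trmx_mul_self => /eqP; rewrite psumr_eq0 => [/allP a0|*]; last exact: sqr_ge0.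
apply/colP => i; rewrite mxE; apply/eqP; rewrite -sqrf_eq0.
exact: a0 (mem_index_enum i).
Qed.

(** Householder reflection along [w = a - b]: equal lengths give [w^T *m a = (s / 2)%:M], so the
    reflection subtracts exactly [w] from [a]. *)
Lemma reflection_exists n (a b : 'cV[R]_n) :
  (a^T *m a) 0 0 = (b^T *m b) 0 0 -> exists2 Q : 'M[R]_n, Q^T *m Q = 1%:M & Q *m a = b.
Proof.
move=> ab; have [->|neq] := eqVneq a b; first by exists 1%:M; rewrite ?trmx1 mul1mx.
pose w := a - b; pose s := (w^T *m w) 0 0.
have s0 : s != 0.
  by apply: contra neq => /eqP/trmx_mul_self_eq0/eqP; rewrite subr_eq0.
have wwE : w^T *m w = s%:M by rewrite [LHS]mx11_scalar.
pose Q : 'M[R]_n := 1%:M - (2 / s) *: (w *m w^T).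
have Qt : Q^T = Q by rewrite /Q linearB/= trmx1 linearZ/= trmx_mul trmxK.
exists Q.
  rewrite Qt /Q mulmxBl mul1mx mulmxBr mulmx1 -scalemxAl -scalemxAr -mulmxA (mulmxA w^T).
  rewrite wwE mul_scalar_mx -scalemxAr !scalerA -[X in _ - X - _]scale1r.
  by apply/matrixP => i j; rewrite !mxE; field.
have wa : w^T *m a = (s / 2)%:M.
  have sub (A B : 'M[R]_1) : (A - B) 0 0 = A 0 0 - B 0 0 by rewrite !mxE.
  have ba : (b^T *m a) 0 0 = (a^T *m b) 0 0.
    by rewrite !mxE; apply: eq_bigr => i _; rewrite !mxE mulrC.
  rewrite [LHS]mx11_scalar; congr (_%:M); rewrite /s /w linearB /= !mulmxBl !mulmxBr !sub.
  by rewrite -ab ba; field.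
rewrite /Q mulmxBl mul1mx -scalemxAl -mulmxA wa mul_mx_scalar scalerA.
have -> : 2 / s * (s / 2) = 1 by field.
by rewrite scale1r /w opprB addrCA subrr addr0.
Qed.

End Householder.

Section UniformSphere.
Context {R : realType} {disp : measure_display} {Omega : measurableType disp}.
Variable P : probability Omega R.

Lemma vBorel_sigma_algebra n : sigma_algebra setT (@vBorel R n).
Proof. exact: smallest_sigma_algebra. Qed.

Lemma vBorel_coord n (i : 'I_n) (B : set R) : measurable B ->
  vBorel [set v : 'cV[R]_n | B (v i ord0)].
Proof.
move=> mB; apply: sub_sigma_algebra; rewrite (bigD1 i)//=; left.
by exists B => //; rewrite setTI.
Qed.

Lemma vBorel_hyperplane n (a : 'cV[R]_n) : vBorel [set v : 'cV[R]_n | (a^T *m v) 0 0 = 0].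
Proof.
have GE := measurable_g_measurableTypeE (@vBorel_sigma_algebra n).
pose T : measurableType _ := g_sigma_algebraType (@vBorel R n).
have mc i : measurable_fun setT ((fun v : 'cV[R]_n => v i ord0) : T -> R).
  by move=> _ B mB; rewrite setTI GE; exact: vBorel_coord.
have mf : measurable_fun setT ((fun v : 'cV[R]_n => \sum_i a i 0 * v i ord0) : T -> R).
  by apply: measurable_sum => i; exact: measurable_funM.
have := mf measurableT [set 0] (measurable_set1 _); rewrite setTI GE.
have aE (v : 'cV[R]_n) : (a^T *m v) 0 0 = \sum_i a i 0 * v i ord0.
  by rewrite mxE; apply: eq_bigr => i _; rewrite mxE.
by congr vBorel; apply/seteqP; split => v /=; rewrite aE.
Qed.

(** Orthogonality to the moment vector at [t] says that [t] is a root of the nonzero polynomial of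
    degree less than [n] whose coefficients are the entries of [v]. *)
Lemma moment_hyperplanes n (v : 'cV[R]_n) T : v != 0 ->
  (\sum_(t < T) (((\col_(i < n) (t%:R : R) ^+ i)^T *m v) 0 0 == 0)%R <= n)%N.
Proof.
move=> v0; pose p : {poly R} := \poly_(i < n) (if insub i is Some j then v j 0 else 0).
have pE x : p.[x] = ((\col_(i < n) x ^+ i)^T *m v) 0 0.
  rewrite horner_poly mxE; apply: eq_bigr => i _; rewrite !mxE.
  by rewrite valK mulrC.
have p0 : p != 0.
  apply: contra v0 => /eqP p0; apply/eqP/colP => i; rewrite mxE.
  by have := congr1 (fun q : {poly R} => q`_i) p0; rewrite coef_poly ltn_ord valK coef0.
pose s := [seq (t%:R : R) | t <- [seq t <- iota 0 T | p.[t%:R] == 0]].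
have : (size s < size p)%N.
  apply: max_poly_roots => //.
    by apply/allP => x /mapP[t + ->]; rewrite mem_filter => /andP[].
  rewrite map_inj_uniq ?filter_uniq ?iota_uniq// => i j /eqP.
  by rewrite eqr_nat => /eqP.
move=> /leq_trans /(_ (size_poly _ _)) /ltnW; apply: leq_trans.
rewrite size_map size_filter -sum1_count.
have -> : iota 0 T = index_iota 0 T by rewrite /index_iota subn0.
by rewrite big_mkord [X in (_ <= X)%N]big_mkcond; apply: leq_sum => t _; rewrite -pE; case: eqP.
Qed.

(* By invariance all hyperplanes are equally likely, and a nonzero vector is
   orthogonal to at most [n] points of the moment curve. *)
Lemma sphere_hyperplane_null n (X : Omega -> 'cV[R]_n) (a : 'cV[R]_n) :
  uniform_on_sphere P X -> a != 0 -> P [set w | (a^T *m X w) 0 0 = 0] = 0%E.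
Proof.
move=> [mX X1 Xrot] a0.
pose H (b : 'cV[R]_n) := [set w | (b^T *m X w) 0 0 = 0].
have mH b : measurable (H b) by exact: mX (vBorel_hyperplane b).
have n0 : (0 < n)%N.
  rewrite lt0n; apply: contra a0 => /eqP n0; apply/eqP/colP => i.
  by have := ltn_ord i; rewrite {2}n0.
have rot Q b : Q^T *m Q = 1%:M -> P (H (Q *m b)) = P (H b).
  move=> QQ; have := Xrot Q QQ _ (vBorel_hyperplane (Q *m b)) => <-.
  congr (P _); apply/seteqP; split => w; rewrite /H /=;
    by rewrite trmx_mul -mulmxA (mulmxA _ Q) QQ mul1mx.
have scal c b : c != 0 -> H (c *: b) = H b.
  move=> c0; have E v : ((c *: b)^T *m v) 0 0 = c * (b^T *m v) 0 0 :> R.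
    by rewrite linearZ /= -scalemxAl mxE.
  apply/seteqP; split => w; rewrite /H /= E; last by move=> ->; rewrite mulr0.
  by move/eqP; rewrite mulf_eq0 (negPf c0) => /eqP.
have same b : b != 0 -> P (H b) = P (H a).
  move=> b0; pose q (v : 'cV[R]_n) := (v^T *m v) 0 0.
  have q0 v : v != 0 -> 0 < q v.
    move=> v0; rewrite lt_neqAle eq_sym; apply/andP; split.
      by apply: contra v0 => /eqP/trmx_mul_self_eq0 ->.
    by rewrite /q trmx_mul_self sumr_ge0// => *; exact: sqr_ge0.
  pose c := Num.sqrt (q a / q b).
  have c0 : c != 0 by rewrite sqrtr_eq0 -ltNge divr_gt0 ?q0.
  have [|Q QQ Qa] := @reflection_exists R n a (c *: b).
    have -> : ((c *: b)^T *m (c *: b)) 0 0 = c ^+ 2 * q b.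
      by rewrite [(c *: b)^T]linearZ -scalemxAl -scalemxAr scalerA mxE.
    by rewrite sqr_sqrtr ?divr_ge0 ?(ltW (q0 _ _))// divfK ?gt_eqF ?q0.
  by rewrite -(scal c)// -Qa rot.
pose m (t : nat) : 'cV[R]_n := \col_(i < n) t%:R ^+ i.
have m0 t : m t != 0.
  apply/negP => /eqP/colP/(_ (Ordinal n0)); rewrite !mxE /= expr0 => /eqP.
  by rewrite oner_eq0.
have X0 w : X w != 0.
  apply/negP => /eqP Xw; have := X1 w; rewrite Xw /l2norm big1 ?sqrtr0 => [/eqP|i _].
    by rewrite eq_sym oner_eq0.
  by rewrite mxE expr0n.
(* [T * P (H a)] is the expected number of moment vectors among the first [T] that are orthogonal to
   [X], which is at most [n] at every outcome. As [T] is arbitrary, the probability is zero. *)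
have bound T : (T%:R%:E * P (H a) <= n%:R%:E)%E.
  have -> : (T%:R%:E * P (H a) = \sum_(t < T) \int[P]_w (\1_(H (m t)) w)%:E)%E.
    rewrite (eq_bigr (fun=> P (H a))) => [|t _]; last by rewrite integral_indic// setIT; exact: same.
    have /fineK <- : P (H a) \is a fin_num by exact: fin_num_measure.
    by rewrite sumEFin sumr_const card_ord -EFinM mulr_natl.
  rewrite -ge0_integral_sum//; last first.
    by move=> t; apply/measurable_EFinP; exact: measurable_indic.
  apply: (@le_trans _ _ (\int[P]_w n%:R%:E)%E); last first.
    by have := integral_cst P measurableT n%:R%:E => /= ->; rewrite probability_setT mule1.
  apply: ge0_le_integral => //.
  - by move=> w _; rewrite sume_ge0.
  - by apply: emeasurable_sum => t; apply/measurable_EFinP; exact: measurable_indic.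
  - move=> w _; rewrite sumEFin lee_fin.
    have := moment_hyperplanes T (X0 w); rewrite -(ler_nat R) natr_sum.
    apply: le_trans; apply: ler_sum => t _; rewrite indicE ler_nat.
    by case: eqP => [_|ne]; [case: (_ \in _) | rewrite memNset].
have /fineK <- : P (H a) \is a fin_num by exact: fin_num_measure.
congr EFin; apply/eqP; rewrite eq_le fine_ge0 ?measure_ge0// andbT leNgt.
apply/negP => pos; have [T] := not_linearly_bounded n%:R pos.
rewrite ltNge => /negP; apply; rewrite -lee_fin EFinM fineK ?bound//.
exact: fin_num_measure.
Qed.

End UniformSphere.

(** * Hyperplanes that depend on the past *)

Section IndependentHyperplane.
Context {R : realType} {disp : measure_display} {Omega : measurableType disp}.
Variable P : probability Omega R.

(** The finite measures [P (A]&[B)] and [P A * P B], as functions of [A], agree on a pi-system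
    containing the whole space, hence on the sigma-algebra it generates. *)
Lemma independent_sigma_algebra (G : set (set Omega)) (A B : set Omega) :
  G `<=` measurable -> setI_closed G -> G setT -> measurable B ->
  (forall A, G A -> P (A `&` B) = P A * P B)%E ->
  <<s G >> A -> (P (A `&` B) = P A * P B)%E.
Proof.
move=> Gm GI GT mB indep sGA.
have PB0 : 0 <= fine (P B) by exact: fine_ge0.
pose m2 := mscale (NngNum PB0) P.
have m2E X : m2 X = (P X * P B)%E.
  by rewrite /m2 /mscale /= fineK ?fin_num_measure// muleC.
rewrite -m2E.
apply: (@g_sigma_algebra_measure_unique _ _ _ G Gm (fun=> setT) _ _ (mrestr P mB) m2) => //.
- by apply/seteqP; split => // w _; exists 0%N.
- by move=> X GX; exact: etrans (indep _ GX) (esym (m2E X)).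
- move=> _; rewrite (@le_lt_trans _ _ 1%E) ?ltry//.
  by apply: probability_le1; exact: measurableI.
Qed.

(** Fubini. [Omega] is equipped with the sigma-algebras of the past and of [X]; by independence the
    diagonal map [w |-> (w, w)] has a product law on the pair. For a fixed past with [u != 0], the
    section is a hyperplane event for [X], which is null. *)
Lemma independent_hyperplane_null n (G : set (set Omega)) (X u : Omega -> 'cV[R]_n) :
  G `<=` measurable -> setI_closed G -> G setT ->
  uniform_on_sphere P X ->
  (forall A B, G A -> vBorel B -> P (A `&` X @^-1` B) = P A * P (X @^-1` B))%E ->
  (forall i, measurable_wrt (@Borel R) <<s G >> (fun w => u w i ord0)) ->
  P.-negligible [set w | u w != 0 /\ ((u w)^T *m X w) 0 0 = 0].
Proof.
move=> Gm GI GT uX indep mu; have [mX X1 _] := uX.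
pose H := preimage_set_system setT X (@vBorel R n).
have sH : sigma_algebra setT H by apply: sigma_algebra_preimage; exact: vBorel_sigma_algebra.
have sGm : <<s G >> `<=` measurable by apply: smallest_sub => //; exact: sigma_algebra_measurable.
have Hm : H `<=` measurable by move=> _ [B vB <-]; rewrite setTI; exact: mX.
pose T1 : measurableType _ := g_sigma_algebraType G.
pose T2 : measurableType _ := g_sigma_algebraType H.
have HE : (measurable : set (set T2)) = H by exact: measurable_g_measurableTypeE.
have m1 : measurable_fun setT (id : Omega -> T1) by move=> _ B mB; rewrite setTI; exact: sGm.
have m2 : measurable_fun setT (id : Omega -> T2).
  by move=> _ B mB; rewrite setTI; apply: Hm; move: mB; rewrite HE.
have m12 : measurable_fun setT (fun w : Omega => (w : T1, w : T2)).
  exact: measurable_fun_pair.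
pose f1 : {mfun Omega >-> T1} := HB.pack (id : Omega -> T1) (isMeasurableFun.Build _ _ _ _ _ m1).
pose f2 : {mfun Omega >-> T2} := HB.pack (id : Omega -> T2) (isMeasurableFun.Build _ _ _ _ _ m2).
pose f12 : {mfun Omega >-> (T1 * T2)%type} := HB.pack
  (fun w : Omega => (w : T1, w : T2)) (isMeasurableFun.Build _ _ _ _ _ m12).
have prodE A B : measurable A -> measurable B ->
  distribution P f12 (A `*` B) = (distribution P f1 A * distribution P f2 B)%E.
  move=> mA mB; rewrite /distribution /pushforward.
  have -> : f12 @^-1` (A `*` B) = (A : set Omega) `&` (B : set Omega) by [].
  rewrite HE in mB; apply: independent_sigma_algebra mA => //; first exact: Hm.
  by move=> A' GA'; case: mB => C vC <-; rewrite setTI; exact: indep.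
pose D : set (T1 * T2) := [set z | u z.1 != 0 /\ ((u z.1)^T *m X z.2) 0 0 = 0].
have mu1 i : measurable_fun setT ((fun z => u z.1 i ord0) : T1 * T2 -> R).
  apply: (@measurableT_comp _ _ _ _ _ _ ((fun w => u w i ord0) : T1 -> R)) => //.
  by move=> _ B mB; rewrite setTI; exact: mu.
have mX2 i : measurable_fun setT ((fun z => X z.2 i ord0) : T1 * T2 -> R).
  apply: (@measurableT_comp _ _ _ _ _ _ ((fun w => X w i ord0) : T2 -> R)) => //.
  move=> _ B mB; rewrite setTI HE; exists [set v : 'cV[R]_n | B (v i ord0)].
    exact: vBorel_coord.
  by rewrite setTI.
have mD : measurable D.
  have -> : D = (fun z : T1 * T2 => \sum_i u z.1 i ord0 * u z.1 i ord0) @^-1` (~` [set 0])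
      `&` (fun z : T1 * T2 => \sum_i u z.1 i ord0 * X z.2 i ord0) @^-1` [set 0].
    have dotE (v v' : 'cV[R]_n) : (v^T *m v') 0 0 = \sum_i v i ord0 * v' i ord0.
      by rewrite mxE; apply: eq_bigr => i _; rewrite mxE.
    apply/seteqP; split => z; rewrite /D /= -!dotE => -[u0 uX0]; split => //.
      by move=> /trmx_mul_self_eq0 uz; rewrite uz eqxx in u0.
    by apply: contra_notN u0 => /eqP ->; rewrite mulmx0 mxE.
  have ms1 : measurable_fun setT (fun z : T1 * T2 => \sum_i u z.1 i ord0 * u z.1 i ord0).
    by apply: measurable_sum => i; exact: measurable_funM.
  have ms2 : measurable_fun setT (fun z : T1 * T2 => \sum_i u z.1 i ord0 * X z.2 i ord0).
    by apply: measurable_sum => i; exact: measurable_funM.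
  apply: measurableI; rewrite -[X in measurable X]setTI.
    by apply: ms1 => //; exact: measurableC.
  exact: ms2.
have := product_measure_unique (m1 := distribution P f1) (m2 := distribution P f2) prodE mD.
rewrite /product_measure1 integral0_eq => [D0|w _]; last first.
  rewrite /= /distribution /pushforward.
  have -> : f2 @^-1` xsection D w = [set w' | u w != 0 /\ ((u w)^T *m X w') 0 0 = 0].
    by apply/seteqP; split => w' /=; rewrite /xsection /= inE.
  have [uw|uw] := eqVneq (u w) 0.
    by rewrite (_ : [set _ | _] = set0) ?measure0// -subset0 => w' /= [].
  have := sphere_hyperplane_null uX uw; congr (P _ = _).
  by apply/seteqP; split => w' /= => [|[]].
exists (f12 @^-1` D); split => //.
by rewrite -[X in measurable X]setTI; exact (m12 measurableT _ mD).
Qed.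

End IndependentHyperplane.

(** * Almost sure invertibility of sample matrices *)

Section GenericPosition.
Context {R : realType}.
Local Notation C := R[i].

Section ComplexMeasurable.
Context {disp : measure_display} {T : measurableType disp}.
Implicit Types f g : T -> C.

Definition cmeasurable f : Prop :=
  measurable_fun setT (fun w => complex.Re (f w)) /\
  measurable_fun setT (fun w => complex.Im (f w)).

Lemma cmeasurable_cst (c : C) : cmeasurable (fun=> c).
Proof. by split; exact: measurable_cst. Qed.

Lemma cmeasurableD f g : cmeasurable f -> cmeasurable g -> cmeasurable (fun w => f w + g w).
Proof.
move=> [f1 f2] [g1 g2]; split.
  rewrite (_ : (fun _ => _) = (fun w => complex.Re (f w)) \+ (fun w => complex.Re (g w))); first exact: measurable_funD.
  by apply/funext => w /=; case: (f w) => ? ?; case: (g w).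
rewrite (_ : (fun _ => _) = (fun w => complex.Im (f w)) \+ (fun w => complex.Im (g w))); first exact: measurable_funD.
by apply/funext => w /=; case: (f w) => ? ?; case: (g w).
Qed.

Lemma cmeasurableM f g : cmeasurable f -> cmeasurable g -> cmeasurable (fun w => f w * g w).
Proof.
move=> [f1 f2] [g1 g2]; split.
  rewrite (_ : (fun _ => _) = (fun w => complex.Re (f w) * complex.Re (g w) - complex.Im (f w) * complex.Im (g w))).
    by apply: measurable_funB; exact: measurable_funM.
  by apply/funext => w /=; case: (f w) => ? ?; case: (g w).
rewrite (_ : (fun _ => _) = (fun w => complex.Re (f w) * complex.Im (g w) + complex.Im (f w) * complex.Re (g w))).
  by apply: measurable_funD; exact: measurable_funM.
by apply/funext => w /=; case: (f w) => ? ?; case: (g w).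
Qed.

Lemma cmeasurable_sum (I : Type) (s : seq I) (f : I -> T -> C) :
  (forall i, cmeasurable (f i)) -> cmeasurable (fun w => \sum_(i <- s) f i w).
Proof.
move=> mf; elim: s => [|i s IHs].
  by rewrite (_ : (fun _ => _) = fun=> 0); [exact: cmeasurable_cst|apply/funext => w; rewrite big_nil].
rewrite (_ : (fun _ => _) = fun w => f i w + \sum_(i <- s) f i w); first exact: cmeasurableD.
by apply/funext => w; rewrite big_cons.
Qed.

Lemma cmeasurable_prod (I : Type) (s : seq I) (f : I -> T -> C) :
  (forall i, cmeasurable (f i)) -> cmeasurable (fun w => \prod_(i <- s) f i w).
Proof.
move=> mf; elim: s => [|i s IHs].
  by rewrite (_ : (fun _ => _) = fun=> 1); [exact: cmeasurable_cst|apply/funext => w; rewrite big_nil].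
rewrite (_ : (fun _ => _) = fun w => f i w * \prod_(i <- s) f i w); first exact: cmeasurableM.
by apply/funext => w; rewrite big_cons.
Qed.

Lemma cmeasurable_det n (A : T -> 'M[C]_n) :
  (forall i j, cmeasurable (fun w => A w i j)) -> cmeasurable (fun w => \det (A w)).
Proof.
move=> mA; apply: cmeasurable_sum => s; apply: cmeasurableM; first exact: cmeasurable_cst.
by apply: cmeasurable_prod => i; exact: mA.
Qed.

End ComplexMeasurable.

Context {disp : measure_display} {Omega : measurableType disp}.
Variable P : probability Omega R.
Variables (d r : nat) (Y : nat -> Omega -> 'cV[R]_d).
Variables (theta : nat -> 'cV[C]_d) (c : nat -> nat -> C).

(** Cylinder events rather than the sigma-algebra they generate: they form a pi-system on which
    independence can be read off directly from [mutually_independent]. *)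
Definition past (k : nat) : set (set Omega) :=
  [set A | exists2 B : nat -> set 'cV[R]_d, (forall i, vBorel (B i)) &
     A = \bigcap_(i in `I_k) Y i @^-1` B i].

Definition sample_matrix (k : nat) (w : Omega) : 'M[C]_k :=
  \matrix_(i < k, j < k) (c i j * ((theta j)^T *m cmx (Y i w)) 0 0).

Hypothesis unifY : forall i, (i < r)%N -> uniform_on_sphere P (Y i).
Hypothesis indepY : forall k, (k < r)%N -> forall A B, past k A -> vBorel B ->
  (P (A `&` Y k @^-1` B) = P A * P (Y k @^-1` B))%E.
Hypothesis theta_free : forall a : nat -> C,
  \sum_(j < r) a j *: theta j = 0 -> forall j, (j < r)%N -> a j = 0.
Hypothesis c_neq0 : forall i j, c i j != 0.

Let pastI k : setI_closed (past k).
Proof.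
move=> _ _ [A vA ->] [B vB ->]; exists (fun i => A i `&` B i).
  move=> i; have sB := @vBorel_sigma_algebra R d.
  rewrite -(measurable_g_measurableTypeE sB).
  by apply: measurableI; rewrite (measurable_g_measurableTypeE sB).
by rewrite -bigcapI; apply: eq_bigcapr => i _; rewrite preimage_setI.
Qed.

Let pastT k : past k setT.
Proof.
exists (fun=> setT) => [i|]; last by rewrite bigcapT.
have sB := @vBorel_sigma_algebra R d.
by rewrite -(measurable_g_measurableTypeE sB); exact: measurableT.
Qed.

Let past_measurable k : (k <= r)%N -> past k `<=` measurable.
Proof.
move=> kr _ [B vB ->]; rewrite bigcap_mkord.
apply: bigsetI_measurable => i _; have ik := ltn_ord i.
by have [mY _ _] := unifY (leq_trans ik kr); exact: mY.
Qed.

Let cmeasurable_sample k i j : (i < k)%N ->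
  cmeasurable ((fun w => c i j * ((theta j)^T *m cmx (Y i w)) 0 0)
    : g_sigma_algebraType (past k) -> C).
Proof.
move=> ik; apply: cmeasurableM; first exact: cmeasurable_cst.
rewrite (_ : (fun _ => _) = fun w => \sum_l theta j l 0 * (Y i w l ord0)%:C%C); last first.
  by apply/funext => w; rewrite mxE; apply: eq_bigr => l _; rewrite !mxE.
apply: cmeasurable_sum => l; apply: cmeasurableM; first exact: cmeasurable_cst.
split; last exact: measurable_cst.
move=> _ B mB; rewrite setTI; apply: sub_sigma_algebra.
exists (fun i' => if i' == i then [set v : 'cV[R]_d | B (v l ord0)] else setT).
  move=> i'; case: eqP => _; first exact: vBorel_coord.
  have sB := @vBorel_sigma_algebra R d.
  by rewrite -(measurable_g_measurableTypeE sB); exact: measurableT.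
apply/seteqP; split => w /=.
  by move=> Bw i' _; case: eqP => [->|].
by move=> /(_ i ik); rewrite eqxx.
Qed.

(** Expanding along the last row writes the determinant as [y^T] applied to the newest sample, where
    [y] depends only on the earlier ones. The coefficient of [theta k] in [y] is a nonzero weight
    times the previous determinant, so freeness of [theta] gives [y != 0] almost surely. *)
Lemma sample_matrix_generic k : (k <= r)%N ->
  P.-negligible [set w | \det (sample_matrix k w) = 0].
Proof.
elim: k => [_|k IHk kr].
  rewrite (_ : [set _ | _] = set0); first exact: negligible_set0.
  by rewrite -subset0 => w /=; rewrite det_mx00 => /eqP; rewrite oner_eq0.
pose cof w j := cofactor (sample_matrix k.+1 w) ord_max j.
pose y w : 'cV[C]_d := \sum_(j < k.+1) (c k j * cof w j) *: theta j.
have detE w : \det (sample_matrix k.+1 w) = ((y w)^T *m cmx (Y k w)) 0 0.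
  rewrite (expand_det_row _ ord_max) /y linear_sum /= mulmx_suml summxE.
  by apply: eq_bigr => j _; rewrite linearZ /= -scalemxAl !mxE -/(cof w j); ring.
have cof_last w : cof w ord_max = \det (sample_matrix k w).
  rewrite /cof /cofactor -signr_odd oddD addbb mul1r; congr (\det _).
  by apply/matrixP => i j; rewrite !mxE !lift_max.
have y_neq0 w : \det (sample_matrix k w) != 0 -> y w != 0.
  apply: contra => /eqP y0; rewrite -cof_last.
  (* Extended by 0 beyond [k], because [theta_free] concerns combinations of all [r] vectors. *)
  pose a j := if insub j is Some j' then c k j * cof w j' else 0.
  have : \sum_(j < r) a j *: theta j = 0.
    rewrite -(big_mkord xpredT (fun j => a j *: theta j)) (big_cat_nat _ kr)//=.
    rewrite [X in _ + X]big_nat_cond [X in _ + X]big1 ?addr0 => [|j].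
      rewrite big_mkord -[RHS]y0; apply: eq_bigr => j _.
      by rewrite /a valK.
    by move=> /andP[/andP[kj _] _]; rewrite /a insubF ?scale0r// ltnNge kj.
  have ak : a k = c k k * cof w ord_max.
    by rewrite /a -[X in insub X]/(val (ord_max : 'I_k.+1)) valK.
  move=> a0; have := @theta_free a a0 k kr; rewrite ak => /eqP.
  by rewrite mulf_eq0 (negPf (c_neq0 _ _)).
have cmeas_cof j : cmeasurable ((fun w => cof w j) : g_sigma_algebraType (past k) -> C).
  apply: cmeasurableM; first exact: cmeasurable_cst.
  apply: cmeasurable_det => i l.
  rewrite (_ : (fun _ => _) = fun w => c i (lift j l) * ((theta (lift j l))^T *m cmx (Y i w)) 0 0); last first.
    by apply/funext => w; rewrite !mxE lift_max.
  exact: cmeasurable_sample.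
have cmeas_y l : cmeasurable ((fun w => y w l 0) : g_sigma_algebraType (past k) -> C).
  rewrite (_ : (fun _ => _) = fun w => \sum_(j < k.+1) (c k j * cof w j) * theta j l 0); last first.
    by apply/funext => w; rewrite summxE; apply: eq_bigr => j _; rewrite mxE.
  apply: cmeasurable_sum => j; apply: cmeasurableM; last exact: cmeasurable_cst.
  by apply: cmeasurableM => //; exact: cmeasurable_cst.
(* The sample is real, so it is orthogonal to both the real and the imaginary part of [y], one of
   which is nonzero. *)
pose yr w : 'cV[R]_d := \col_l complex.Re (y w l 0).
pose yi w : 'cV[R]_d := \col_l complex.Im (y w l 0).
have nullr := @independent_hyperplane_null R disp Omega P d (past k) (Y k) yr
  (past_measurable (ltnW kr)) (@pastI k) (@pastT k) (unifY kr) (indepY kr).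
have nulli := @independent_hyperplane_null R disp Omega P d (past k) (Y k) yi
  (past_measurable (ltnW kr)) (@pastI k) (@pastT k) (unifY kr) (indepY kr).
have {}nullr := nullr _.
have {}nulli := nulli _.
apply: (@negligibleS _ _ _ _ ([set w | \det (sample_matrix k w) = 0] `|`
  ([set w | yr w != 0 /\ ((yr w)^T *m Y k w) 0 0 = 0] `|`
   [set w | yi w != 0 /\ ((yi w)^T *m Y k w) 0 0 = 0]))).
  move=> w /=; rewrite detE => yY.
  have [->|det0] := eqVneq (\det (sample_matrix k w)) 0; first by left.
  right; have y0 := y_neq0 _ det0.
  have yYr : ((yr w)^T *m Y k w) 0 0 = complex.Re (((y w)^T *m cmx (Y k w)) 0 0).
    rewrite !mxE (big_morph (@complex.Re R) (id1 := 0) (op1 := +%R)) => [|[? ?] [? ?]|]//.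
    by apply: eq_bigr => l _; rewrite !mxE; case: (y w l 0) => ? ? /=; rewrite mulr0 subr0.
  have yYi : ((yi w)^T *m Y k w) 0 0 = complex.Im (((y w)^T *m cmx (Y k w)) 0 0).
    rewrite !mxE (big_morph (@complex.Im R) (id1 := 0) (op1 := +%R)) => [|[? ?] [? ?]|]//.
    by apply: eq_bigr => l _; rewrite !mxE; case: (y w l 0) => ? ? /=; rewrite mulr0 add0r.
  have [yr0|yr0] := eqVneq (yr w) 0; last by left; rewrite yYr yY.
  right; rewrite yYi yY; split => //; apply: contra y0 => /eqP yi0.
  apply/eqP/colP => l; rewrite mxE; apply/eqP; rewrite eq_complex /=.
  move/colP/(_ l): yr0; move/colP/(_ l): yi0; rewrite !mxE => -> ->.
  by rewrite !eqxx.
apply: negligibleU; first exact: (IHk (ltnW kr)).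
apply: negligibleU.
- apply: nullr => l B mB; have [+ _] := cmeas_y l => /(_ measurableT B mB).
  by rewrite setTI /=; congr (<<s _ >> _); apply/funext => w; rewrite /preimage /= mxE.
- apply: nulli => l B mB; have [_ +] := cmeas_y l => /(_ measurableT B mB).
  by rewrite setTI /=; congr (<<s _ >> _); apply/funext => w; rewrite /preimage /= mxE.
Qed.

End GenericPosition.

(** * The estimate outside the exceptional events *)

Section FactorizationLemmas.
Variable R : realType.
Local Notation C := R[i].

(** Column [j] holds the coefficients of the Lagrange polynomial of the node [b j]. The extra
    division by [b j] compensates for exponents starting at 1. *)
Lemma vandermonde_right_inverse r n (b : 'I_r -> C) : injective b ->
  (forall j, b j != 0) -> (r <= n)%N ->
  exists UR : 'M[C]_(n, r), (\matrix_(j < r, l < n) b j ^+ l.+1) *m UR = 1%:M.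
Proof.
move=> bI b0 rn; pose p j : {poly C} := \prod_(i < r | i != j) ('X - (b i)%:P).
have p_neq0 j : b j * (p j).[b j] != 0.
  rewrite mulf_neq0// horner_prod prodf_seq_neq0; apply/allP => i _.
  by apply/implyP => ij; rewrite hornerXsubC subr_eq0 (inj_eq bI) eq_sym.
have p_size j : (size (p j) <= n)%N.
  have -> : p j = \prod_(i <- [seq i <- enum 'I_r | i != j]) ('X - (b i)%:P).
    by rewrite big_filter big_enum_cond.
  rewrite size_prod_XsubC size_filter (leq_trans _ rn)//.
  have := count_predC (pred1 j) (enum 'I_r).
  by rewrite count_uniq_mem ?enum_uniq// mem_enum size_enum_ord add1n => cnt; exact: eq_leq cnt.
exists (\matrix_(l < n, j < r) ((p j)`_l / (b j * (p j).[b j]))).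
apply/matrixP => i j; rewrite !mxE.
transitivity (b i * (p j).[b i] / (b j * (p j).[b j])).
  rewrite (horner_coef_wide _ (p_size j)) mulr_sumr mulr_suml.
  by apply: eq_bigr => l _; rewrite !mxE exprS; ring.
have [->|ij] := eqVneq i j; first by rewrite divff.
rewrite [(p j).[b i]](_ : _ = 0) ?mulr0 ?mul0r//.
by rewrite horner_prod (bigD1 i)//= hornerXsubC subrr mul0r.
Qed.

Lemma gram_unitmx n r (P : 'M[C]_(n, r)) : row_full P -> P^t* *m P \in unitmx.
Proof.
move=> Pfull; rewrite -row_free_unit; apply: inj_row_free => v vPP.
have vP : v *m P^t* = 0.
    set z := v *m _; have zz : z *m z^t* = 0.
      by rewrite /z trC_mul trmxCK -!mulmxA (mulmxA _ P) mulmxA vPP mul0mx.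
    apply: (trC_eq (B := 0)); rewrite trC0; apply: cl2norm_eq0; apply/eqP.
    rewrite -sqrf_eq0; apply/eqP/complexI; by rewrite -mulmx_trC_self trmxCK zz mxE rmorph0.
have /row_freeP[B PB] : row_free (P^t*) by rewrite /row_free mxrank_map mxrank_tr.
by rewrite -[v]mulmx1 -PB mulmxA vP mul0mx.
Qed.

(** A left eigenvector [v] is carried to [v *m P], a left eigenvector of [diag_mx lam] that can
    vanish only if [a = 0]. *)
Lemma eigenvalue_factorization n r (P : 'M[C]_(n, r)) (Pp : 'M[C]_(r, n))
    (lam : 'rV[C]_r) a : Pp *m P = 1%:M ->
  eigenvalue (P *m diag_mx lam *m Pp) a -> a = 0 \/ exists j, a = lam 0 j.
Proof.
move=> PpP /eigenvalueP[v vE v0]; have [->|a0] := eqVneq a 0; [by left|right].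
pose w := v *m P; have wE : w *m diag_mx lam = a *: w.
  by rewrite /w scalemxAl -vE -!mulmxA PpP mulmx1.
have w0 : w != 0.
  apply: contra v0 => /eqP w0; have /eqP : a *: v = 0.
    by rewrite -vE !mulmxA -/w w0 !mul0mx.
  by rewrite scaler_eq0 (negPf a0).
have /existsP[j wj] : [exists j, w 0 j != 0].
  rewrite -negb_forall; apply: contra w0 => /forallP all0.
  by apply/eqP/rowP => j; rewrite [RHS]mxE; apply/eqP; exact: all0.
exists j; have /rowP/(_ j) := wE; rewrite mul_mx_diag [LHS]mxE [RHS]mxE => /eqP.
by rewrite mulrC -subr_eq0 -mulrBl mulf_eq0 (negPf wj) orbF subr_eq0 => /eqP.
Qed.

Lemma free_family_le d r (th : 'I_r -> 'cV[C]_d) :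
  (forall a : 'I_r -> C, \sum_j a j *: th j = 0 -> forall j, a j = 0) -> (r <= d)%N.
Proof.
move=> free; pose T : 'M[C]_(r, d) := \matrix_(j, i) th j i 0.
have : row_free T.
  apply: inj_row_free => v vT; apply/rowP => j; rewrite mxE.
  apply: (free (fun j => v 0 j)); apply/colP => i; rewrite summxE mxE.
  have /rowP/(_ i) := vT; rewrite !mxE => vTi; rewrite -[RHS]vTi; apply: eq_bigr => j' _.
  by rewrite !mxE.
by rewrite /row_free => /eqP <-; exact: rank_leq_col.
Qed.

(** Applying the polynomial of one eigenvalue to the relation isolates the corresponding term. *)
Lemma components_free n' (M : 'M[C]_n'.+1) v s q (t : seq C) (a : nat -> C) :
  components M v s q -> uniq t -> {subset t <= s} ->
  (forall j, (j < size t)%N -> horner_mx M (q (nth 1 t j)) *m v != 0) ->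
  \sum_(j < size t) a j *: (horner_mx M (q (nth 1 t j)) *m v) = 0 ->
  forall j, (j < size t)%N -> a j = 0.
Proof.
move=> [_ _ _ qf] tU ts f0 sum0 j jt.
have mem i : (i < size t)%N -> nth 1 t i \in s by move=> it; apply: ts; exact: mem_nth.
have := congr1 (mulmx (horner_mx M (q (nth 1 t j)))) sum0; rewrite mulmx0 mulmx_sumr.
rewrite (bigD1 (Ordinal jt))//= -scalemxAr qf ?mem// eqxx big1 ?addr0 => [/eqP|i ij].
  by rewrite scaler_eq0 (negPf (f0 _ jt)) orbF => /eqP.
rewrite -scalemxAr qf ?mem// nth_uniq// (_ : (_ == _) = false) ?scaler0//.
by apply/negbTE.
Qed.

End FactorizationLemmas.

(** * Factorization of the averaged signal and bound on the output *)

Section Deterministic.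
Variable R : realType.
Local Notation C := R[i].
Variables (d' L : nat).
Local Notation d := d'.+1.
Hypothesis L_gt0 : (0 < L)%N.

Definition noise_matrix (noise : nat -> R) (N s : nat) : 'M[C]_d :=
  \matrix_(k < d, l < d) ((N%:R)^-1 * \sum_(j < N)
     (noise (2 * k * d + s * d + 2 * d ^ 2 * j + N + l.+1)%N)%:C%C * chirp R L j).

Lemma cmxM m n p (A : 'M[R]_(m, n)) (B : 'M[R]_(n, p)) : cmx (A *m B) = cmx A *m cmx B.
Proof. exact: map_mxM. Qed.

Lemma trmx_cmx m n (A : 'M[R]_(m, n)) : (cmx A)^T = cmx A^T.
Proof. by apply/matrixP => i j; rewrite !mxE. Qed.

Lemma cmxX (A : 'M[R]_d) t : cmx (A ^+ t) = cmx A ^+ t.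
Proof.
elim: t => [|t IHt]; first by rewrite !expr0 /cmx map_mx1.
by rewrite !exprS -!mulmxE cmxM IHt.
Qed.

Variables (M : 'M[R]_d) (theta : 'cV[R]_d).
Let Mc := cmx M.
Let tc := cmx theta.
Let D := (2 * d ^ 2)%N.

Lemma bounded_orbit_cmx :
  (exists B, forall t, (0 < t)%N -> l2norm (M ^+ t *m theta) <= B) -> bounded_orbit Mc tc.
Proof.
(* The hypothesis starts at time 1; the summand [mxnorm1 tc] covers time 0. *)
move=> [B HB]; exists (mxnorm1 tc + d%:R * 1%:R * `|B|) => -[|t].
  by rewrite expr0 mul1mx lerDl mulr_ge0.
rewrite -cmxX -cmxM ler_wpDl ?mxnorm1_ge0//; apply: mxnorm1_le => i j.
rewrite mxE cmod_real (le_trans _ (ler_norm _))// (le_trans _ (HB t.+1 _))//.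
rewrite -sqrtr_sqr ler_wsqrtr// (bigD1 i)//= ord1 lerDl sumr_ge0// => *.
exact: sqr_ge0.
Qed.

Variables (s : seq C) (q : C -> {poly C}).
Hypothesis comp : components Mc tc s q.
Let f a := horner_mx Mc (q a) *m tc.
(* [c a] is the mean value of the Weyl sum attached to the eigenvalue [a]. *)
Variables (c : C -> C) (K : C -> R).
Hypothesis c_spec : forall a, a \in s -> c a != 0 -> [/\ cmod a = 1, f a != 0 & Mc *m f a = a *: f a].
Hypothesis c_asym : forall a, a \in s -> forall m t0 : nat,
  mxnorm1 (\sum_(j < m) chirp R L j *: (Mc ^+ (t0 + D * j) *m f a)
           - (m%:R * c a * a ^+ t0) *: f a) <= K a.

(** The mean [c a] may vanish even for a unimodular eigenvalue. Such eigenvalues leave no trace in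
    the limit, and keeping them would destroy the right inverse of [right_factor]. *)
Definition resonant := [seq a <- s | c a != 0].
Let r := size resonant.
(** The default 1 keeps [b j] nonzero for every [j], as the weights of [sample_matrix_generic] must
    be. *)
Let b (j : nat) := nth 1 resonant j.

Lemma resonantP j : (j < r)%N ->
  [/\ b j \in s, c (b j) != 0, cmod (b j) = 1, f (b j) != 0 & Mc *m f (b j) = b j *: f (b j)].
Proof.
move=> jr; have : b j \in resonant by exact: mem_nth.
by rewrite mem_filter => /andP[c0 sb]; have [] := c_spec sb c0.
Qed.

Lemma resonant_neq0 j : b j != 0.
Proof.
have [jr|jr] := ltnP j r; last by rewrite /b nth_default ?oner_eq0.
by have [_ _ b1 _ _] := resonantP jr; rewrite -cmod_eq0 b1 oner_eq0.
Qed.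

Let comp_uniq : uniq s. Proof. by case: comp. Qed.

Lemma resonant_free (a : nat -> C) :
  \sum_(j < r) a j *: f (b j) = 0 -> forall j, (j < r)%N -> a j = 0.
Proof.
apply: (components_free comp); first by rewrite filter_uniq.
  by move=> a'; rewrite mem_filter => /andP[].
by move=> j jr; have [] := resonantP jr.
Qed.

Lemma resonant_size : (r <= d)%N.
Proof.
apply: (@free_family_le R d r (fun j => f (b j))) => a a0 j.
have := @resonant_free (fun j => if insub j is Some j' then a j' else 0) _ j (ltn_ord j).
rewrite valK; apply; rewrite -[RHS]a0; apply: eq_bigr => i _.
by rewrite valK.
Qed.

(** Row [i] starts [2 * i * d] time steps into each block, which multiplies the eigencomponent by
    this power. *)
Let wgt (i j : nat) := b j ^+ (2 * i * d).

Definition left_factor (X : 'I_d -> 'cV[R]_d) : 'M[C]_(d, r) :=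
  \matrix_(k < d, j < r) (wgt k j * ((f (b j))^T *m cmx (X k)) 0 0).

Definition shift : 'M[C]_r := diag_mx (\row_j b j ^+ d).

Definition right_factor (N : nat) : 'M[C]_(r, d) :=
  \matrix_(j < r, l < d) (c (b j) * b j ^+ N * b j ^+ l.+1).

(** [right_factor N] is a fixed Vandermonde matrix with rows scaled by [c (b j) * b j ^+ N]. Since
    [b j] is unimodular, undoing the scaling costs [1 / cmod (c (b j))], whatever [N] is. *)
Lemma right_factor_inverse : exists KQ : R, 0 <= KQ /\ forall N, exists QR : 'M[C]_(d, r),
  right_factor N *m QR = 1%:M /\ mxnorm1 QR <= KQ.
Proof.
have bI : injective (fun j : 'I_r => b j).
  by move=> i j /eqP; rewrite nth_uniq ?filter_uniq// => /eqP /val_inj.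
have [UR URE] := vandermonde_right_inverse bI (fun j => resonant_neq0 j) resonant_size.
exists (mxnorm1 UR * \sum_(j < r) (cmod (c (b j)))^-1); split.
  by rewrite mulr_ge0 ?mxnorm1_ge0// sumr_ge0// => j _; rewrite invr_ge0 cmod_ge0.
move=> N; pose D1 := diag_mx (\row_(j < r) (c (b j) * b j ^+ N)).
pose D2 := diag_mx (\row_(j < r) (c (b j) * b j ^+ N)^-1).
have cb0 (j : 'I_r) : c (b j) * b j ^+ N != 0.
  by have [_ c0 _ _ _] := resonantP (ltn_ord j); rewrite mulf_neq0// expf_neq0// resonant_neq0.
have QE : right_factor N = D1 *m \matrix_(j < r, l < d) b j ^+ l.+1.
  by apply/matrixP => i j; rewrite mul_diag_mx !mxE.
exists (UR *m D2); split.
  rewrite QE -mulmxA (mulmxA _ UR) URE mul1mx mulmx_diag -diag_const_mx; congr diag_mx.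
  by apply/rowP => j; rewrite !mxE divff.
rewrite (le_trans (mxnorm1M _ _))// ler_wpM2l ?mxnorm1_ge0//.
rewrite /mxnorm1 ler_sum// => i _; rewrite (bigD1 i)//= big1 => [|j ji]; last first.
  by rewrite !mxE eq_sym (negPf ji) mulr0n cmod0.
rewrite !mxE eqxx mulr1n addr0 cmodV cmodM cmodX.
by have [_ _ -> _ _] := resonantP (ltn_ord i); rewrite expr1n mulr1.
Qed.

Definition bias_bound (X : 'I_d -> 'cV[R]_d) : R :=
  (d%:R * d%:R) * ((\sum_(a <- s) K a) * \sum_k mxnorm1 (cmx (X k))).

Lemma K_ge0 a : a \in s -> 0 <= K a.
Proof. by move=> sa; apply: le_trans (c_asym sa 0 0); exact: mxnorm1_ge0. Qed.

Lemma bias_bound_ge0 X : 0 <= bias_bound X.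
Proof.
have SK : 0 <= \sum_(a <- s) K a.
  by rewrite big_seq_cond sumr_ge0// => a /andP[sa _]; exact: K_ge0.
by rewrite !mulr_ge0// sumr_ge0// => k _; exact: mxnorm1_ge0.
Qed.

Definition shift_pow (e : nat) : 'M[C]_r := diag_mx (\row_j b j ^+ (e * d)).

(** Once [theta] is split into components, an entry differs from its limit by [N^-1] times
    deviations of Weyl sums from linear growth. Each is bounded by [K a] whatever the time offset,
    which contains [N]. *)
Lemma weyl_matrix_bias (noise : nat -> R) X N e : (0 < N)%N ->
  mxnorm1 (weyl_matrix M theta noise X L N e - left_factor X *m shift_pow e *m right_factor N
           - noise_matrix noise N e) <= bias_bound X / N%:R.
Proof.
move=> N0; rewrite /bias_bound -mulrA; apply: mxnorm1_le => k l.
pose t0 := (2 * k * d + e * d + N + l.+1)%N.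
have tE j : (2 * k * d + e * d + 2 * d ^ 2 * j + N + l.+1 = t0 + D * j)%N.
  by rewrite /t0 /D; lia.
pose Xk := cmx (X k).
pose err a := \sum_(j < N) chirp R L j *: (Mc ^+ (t0 + D * j) *m f a)
           - (N%:R * c a * a ^+ t0) *: f a.
have tcE : tc = \sum_(a <- s) f a by case: comp.
have N0c : (N%:R : C) != 0 by rewrite pnatr_eq0 -lt0n.
have PQ : (left_factor X *m shift_pow e *m right_factor N) k l =
    N%:R^-1 * \sum_(a <- s) ((N%:R * c a * a ^+ t0) * ((f a)^T *m Xk) 0 0).
  rewrite /left_factor mul_mx_diag mxE.
  transitivity (\sum_(a <- resonant) c a * a ^+ t0 * ((f a)^T *m Xk) 0 0).
    rewrite (big_nth 1) big_mkord; apply: eq_bigr => j _; rewrite !mxE.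
    rewrite /wgt /t0 -/(b j) !exprD; ring.
  rewrite big_filter mulr_sumr big_mkcond; apply: eq_bigr => a _.
  have [->|_] /= := eqVneq (c a) 0; first by rewrite !(mulr0, mul0r).
  by rewrite !mulrA mulVf// mul1r.
have WE : weyl_matrix M theta noise X L N e k l =
    N%:R^-1 * \sum_(a <- s) ((err a + (N%:R * c a * a ^+ t0) *: f a)^T *m Xk) 0 0
    + noise_matrix noise N e k l.
  rewrite !mxE -mulrDr; congr (_ * _).
  have -> : \sum_(a <- s) ((err a + (N%:R * c a * a ^+ t0) *: f a)^T *m Xk) 0 0 =
    \sum_(j < N) chirp R L j * ((Mc ^+ (t0 + D * j) *m tc)^T *m Xk) 0 0.
    under eq_bigr do rewrite /err subrK.
    transitivity (\sum_(a <- s) \sum_(j < N) chirp R L j * ((Mc ^+ (t0 + D * j) *m f a)^T *m Xk) 0 0).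
      apply: eq_bigr => a _; rewrite linear_sum mulmx_suml summxE; apply: eq_bigr => j _.
      by rewrite linearZ /= -scalemxAl mxE.
    rewrite exchange_big; apply: eq_bigr => j _; rewrite -mulr_sumr; congr (_ * _).
    by rewrite tcE mulmx_sumr linear_sum mulmx_suml summxE.
  rewrite -big_split; apply: eq_bigr => j _ /=; rewrite /reward tE rmorphD /= mulrDl.
  congr (_ + _); rewrite mulrC; congr (_ * _).
  rewrite /Mc /tc -cmxX -cmxM /Xk trmx_cmx -cmxM.
  by rewrite [RHS]mxE.
have -> : (weyl_matrix M theta noise X L N e - left_factor X *m shift_pow e *m right_factor N
           - noise_matrix noise N e) k l = N%:R^-1 * \sum_(a <- s) ((err a)^T *m Xk) 0 0.
  have sub3 (A B E : 'M[C]_d) : (A - B - E) k l = A k l - B k l - E k l by rewrite !mxE.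
  rewrite sub3 PQ WE addrAC addrK -mulrBr -sumrB; congr (_ * _).
  apply: eq_bigr => a _; rewrite linearD /= mulmxDl [LHS](_ : _ = ((err a)^T *m Xk) 0 0 + (((N%:R * c a * a ^+ t0) *: f a)^T *m Xk) 0 0 - N%:R * c a * a ^+ t0 * ((f a)^T *m Xk) 0 0).
    by rewrite linearZ /= -scalemxAl [X in _ + X - _]mxE addrK.
  by congr (_ - _); rewrite [LHS]mxE.
rewrite cmodM cmodV -(rmorph_nat (real_complex R)) cmod_real ger0_norm// mulrC.
rewrite ler_wpM2r ?invr_ge0// mulr_suml (le_trans (cmod_sum _ _ _))//.
rewrite big_seq [leRHS]big_seq; apply: ler_sum => a sa.
rewrite (le_trans (le_mxnorm1_entry _ _ _))// (le_trans (mxnorm1M _ _))//.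
apply: ler_pM; rewrite ?mxnorm1_ge0//.
  have -> : mxnorm1 (err a)^T = mxnorm1 (err a) by rewrite /mxnorm1 exchange_big; do 2![apply: eq_bigr => ? _]; rewrite mxE.
  exact: c_asym.
by rewrite (bigD1 k)//= lerDl sumr_ge0// => *; exact: mxnorm1_ge0.
Qed.

(** The rows of [left_factor] belonging to the first [r] arms; [inord] is harmless because [r <= d].
    Full rank then becomes the nonvanishing of one determinant, to which [sample_matrix_generic]
    applies. *)
Definition top_minor (X : 'I_d -> 'cV[R]_d) : 'M[C]_r :=
  \matrix_(i < r, j < r) (wgt i j * ((f (b j))^T *m cmx (X (inord i))) 0 0).

Definition generic (X : 'I_d -> 'cV[R]_d) : bool := \det (top_minor X) != 0.

Lemma left_factor_full X : generic X -> row_full (left_factor X).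
Proof.
move=> gX; have Tu : top_minor X \in unitmx by rewrite unitmxE unitfE.
pose S : 'M[C]_(r, d) := \matrix_(i, k) (k == inord i)%:R.
have TE : top_minor X = S *m left_factor X.
  apply/matrixP => i j; rewrite [RHS]mxE (bigD1 (inord i))//= [S _ _]mxE eqxx mul1r.
  rewrite big1 ?addr0 => [|k /negPf ki]; last by rewrite [S _ _]mxE ki mul0r.
  by rewrite [LHS]mxE [RHS]mxE inordK// (leq_trans (ltn_ord i) resonant_size).
apply/row_fullP; exists (invmx (top_minor X) *m S).
by rewrite -mulmxA -TE mulVmx.
Qed.

Definition limit_matrix (X : 'I_d -> 'cV[R]_d) : 'M[C]_d :=
  let P := left_factor X in P *m shift *m invmx (P^t* *m P) *m P^t*.

Lemma limit_matrix_eigenvalue X a : generic X -> eigenvalue (limit_matrix X) a ->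
  a = 0 \/ distinct_eigenvalue Mc tc d a.
Proof.
move=> /left_factor_full/gram_unitmx Gu; rewrite /limit_matrix /= -!mulmxA mulmxA.
move=> /eigenvalue_factorization[|->|[j ->]]; first by rewrite -mulmxA mulVmx.
  by left.
right; rewrite mxE; have [sb _ b1 f0 Mf] := resonantP (ltn_ord j).
exact: (component_distinct_eigenvalue d comp).
Qed.

Lemma frobenius_le_mxnorm1 m n (A : 'M[C]_(m, n)) :
  Num.sqrt (\sum_i \sum_j cmod (A i j) ^+ 2) <= mxnorm1 A.
Proof.
have S0 : 0 <= \sum_i \sum_j cmod (A i j) ^+ 2.
  by do 2![apply: sumr_ge0 => ? _]; exact: sqr_ge0.
rewrite -(ler_pXn2r (n:=2)) ?nnegrE ?sqrtr_ge0 ?mxnorm1_ge0// sqr_sqrtr//.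
rewrite expr2 {1}/mxnorm1 mulr_suml ler_sum// => i _; rewrite mulr_suml ler_sum// => j _.
by rewrite expr2 ler_wpM2l ?cmod_ge0 ?le_mxnorm1_entry.
Qed.

Lemma sv_threshold_le (rho delta : R) N : 0 < delta <= 1 ->
  sv_threshold d rho delta N <=
  (4 * d%:R ^+ 2 * (1 + ln (4 * d%:R ^+ 2)) + 2) *
    ((rho ^+ 2 * (ln (1 / delta) + 1) + 1) / Num.sqrt N%:R).
Proof.
move=> /andP[d0 d1]; rewrite /sv_threshold mulrA ler_wpM2r ?invr_ge0 ?sqrtr_ge0//.
have dR : 1 <= d%:R :> R by rewrite ler1n.
have d2 : 1 <= 4 * d%:R ^+ 2 :> R.
  by rewrite (@le_trans _ _ 4)// ?ler1n// ler_peMr// exprn_ege1.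
have lnE : ln (4 * d%:R ^+ 2 / delta) = ln (4 * d%:R ^+ 2) + ln (1 / delta).
  by rewrite div1r -lnM ?posrE ?invr_gt0// (lt_le_trans _ d2).
have a0 : 0 <= ln (4 * d%:R ^+ 2 : R) by rewrite ln_ge0.
have l0 : 0 <= ln (1 / delta) by rewrite ln_ge0// div1r invf_ge1.
rewrite lnE; set a := ln (4 * _) in a0 *; set l := ln (1 / delta) in l0 *.
set S := _ * _ * _ * (a + l); have r0 : 0 <= rho ^+ 2 by exact: sqr_ge0.
have S0 : 0 <= S by nonneg.
have SE : S <= 4 * d%:R ^+ 2 * (1 + a) * (rho ^+ 2 * (l + 1)).
  have -> : 4 * d%:R ^+ 2 * (1 + a) * (rho ^+ 2 * (l + 1)) =
      4 * d%:R ^+ 2 * rho ^+ 2 * ((1 + a) * (l + 1)) by ring.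
  by rewrite /S ler_wpM2l//; [nonneg|have := mulr_ge0 a0 l0; lra].
(* This replaces the square root in the threshold by the form of the announced rate, linear in
   [rho ^+ 2] and in the logarithm. *)
have sqS : Num.sqrt S <= S + 1.
  have := sqr_sqrtr S0; have := sqrtr_ge0 S; have := sqr_ge0 (Num.sqrt S - 1); nra.
have m0 : 0 <= 4 * d%:R ^+ 2 * (1 + a) by nonneg.
have m1 : 0 <= rho ^+ 2 * (l + 1) by nonneg.
set x := rho ^+ 2 * _ in SE m1 *; set y := 4 * _ * _ in SE m0 *; nra.
Qed.

Lemma algorithm_output_bound X : generic X -> exists2 Cx : R, 0 < Cx &
  forall (N : nat) (rho delta : R) (noise : nat -> R),
  (0 < N)%N -> 0 < delta <= 1 ->
  (forall e, (e < 2)%N -> \sum_k \sum_l cmod (noise_matrix noise N e k l) ^+ 2 <=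
     4 * d%:R ^+ 2 * rho ^+ 2 * ln (4 * d%:R ^+ 2 / delta) / N%:R) ->
  spectral_norm (limit_matrix X - algorithm_output M theta noise X L N rho delta) <=
  Cx * ((rho ^+ 2 * (ln (1 / delta) + 1) + 1) / Num.sqrt N%:R).
Proof.
move=> gX; set P := left_factor X; set KX := bias_bound X.
have KX0 : 0 <= KX := bias_bound_ge0 X.
have Gu := gram_unitmx (left_factor_full gX).
have HP : invmx (P^t* *m P) *m P^t* *m P = 1%:M by rewrite -mulmxA mulVmx.
have [KQ [KQ0 KQP]] := right_factor_inverse.
(* The three terms dominate the noise, the bias and the discarded singular part, each as a multiple
   of the threshold. *)
pose cst : R := d%:R * d%:R + KX + d%:R ^+ 6.
have cst0 : 0 <= cst by nonneg.
have [eps /andP[eps0 epsle] [Dx Dx0 HD]] := @perturbation R d r P shift _ KQ cst KX KQ0 cst0 KX0 HP.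
have dR : 1 <= d%:R :> R by rewrite ler1n.
pose cd : R := 4 * d%:R ^+ 2 * (1 + ln (4 * d%:R ^+ 2)) + 2.
have cd0 : 0 < cd.
  rewrite ltr_wpDl// !mulr_ge0// addr_ge0// ln_ge0//.
  by rewrite (@le_trans _ _ 4)// ?ler1n// ler_peMr// exprn_ege1.
exists (d%:R * Dx * cd); first by rewrite !mulr_gt0// ltr0n.
move=> N rho delta noise N0 d01 noise_le.
set g := sv_threshold d rho delta N; pose u : R := (Num.sqrt N%:R)^-1.
pose tau := Num.sqrt (4 * d%:R ^+ 2 * rho ^+ 2 * ln (4 * d%:R ^+ 2 / delta)).
have NR : 0 < N%:R :> R by rewrite ltr0n.
have u0 : 0 < u by rewrite invr_gt0 sqrtr_gt0.
have u2 : u ^+ 2 = N%:R^-1 by rewrite exprVn sqr_sqrtr// ltW.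
have u1 : u <= 1.
  rewrite invf_le1 ?sqrtr_gt0// -[leLHS]sqrtr1 ler_wsqrtr//.
  by rewrite ler1n.
have tau0 : 0 <= tau by exact: sqrtr_ge0.
have gE : g = (tau + 1) * u by [].
have g0 : 0 < g by rewrite gE mulr_gt0// ltr_wpDl.
have tau_g : tau * u <= g by rewrite gE mulrDl lerDl mul1r ltW.
have u_g : u <= g by rewrite gE mulrDl mul1r lerDr mulr_ge0// ltW.
have frob e : (e < 2)%N -> Num.sqrt (\sum_k \sum_l cmod (noise_matrix noise N e k l) ^+ 2) <= tau * u.
  move=> e2; have := ler_wsqrtr (noise_le e e2).
  rewrite -u2 [X in _ <= X -> _](_ : _ = tau * u)//.
  set T := 4 * _ * _ * _; have [T0|T0] := leP 0 T; first by rewrite sqrtrM// sqrtr_sqr gtr0_norm.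
  have Tt : tau = 0 by rewrite /tau ler0_sqrtr// ltW.
  by rewrite Tt mul0r ler0_sqrtr// mulr_le0_ge0 ?sqr_ge0// ltW.
have noise1 e : (e < 2)%N -> mxnorm1 (noise_matrix noise N e) <= d%:R * d%:R * g.
  move=> e2; apply: mxnorm1_le => k l; apply: le_trans (le_trans (frob e e2) tau_g).
  rewrite -[leLHS]ger0_norm ?cmod_ge0// -sqrtr_sqr ler_wsqrtr//.
  rewrite (bigD1 k)//= (bigD1 l)//= -addrA lerDl addr_ge0 ?sumr_ge0// => *.
    exact: sqr_ge0.
  by apply: sumr_ge0 => *; exact: sqr_ge0.
pose Q := right_factor N; have [QR [QQR QRle]] := KQP N.
pose A e := weyl_matrix M theta noise X L N e.
pose Bias e := A e - P *m shift_pow e *m Q - noise_matrix noise N e.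
pose E e := A e - P *m shift_pow e *m Q.
have EE e : E e = noise_matrix noise N e + Bias e by rewrite /Bias -/(E e) addrC subrK.
have Bias_le e : mxnorm1 (Bias e) <= KX * u ^+ 2.
  by rewrite u2; exact: weyl_matrix_bias.
have E_le e : (e < 2)%N -> mxnorm1 (E e) <= cst * g.
  move=> e2; rewrite EE (le_trans (mxnorm1D _ _))// /cst -addrA mulrDl lerD ?noise1//.
  rewrite mulrDl ler_wpDr ?mulr_ge0 ?exprn_ge0 ?(ltW g0)//.
  rewrite (le_trans (Bias_le e))// ler_wpM2l// (le_trans _ u_g)//.
  by rewrite expr2 ger_pMl.
have [Y [F [[YE MP AF] [FY YF Fle Yle]]]] := truncated_pseudoinverse (A 0) g0.
have A0E : A 0 = P *m Q + E 0.
  rewrite /E (_ : shift_pow 0 = 1%:M) ?mulmx1 1?addrC ?subrK//.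
  by rewrite -diag_const_mx; congr diag_mx; apply/rowP => j; rewrite !mxE mul0n expr0.
have A1E : A 1 = P *m shift *m Q + E 1.
  rewrite /E (_ : shift_pow 1 = shift) 1?addrC ?subrK//.
  by congr diag_mx; apply/rowP => j; rewrite !mxE mul1n.
have F_le : mxnorm1 F <= cst * g.
  by rewrite (le_trans Fle)// ler_wpM2r ?(ltW g0)// /cst lerDr; nonneg.
(* The noise uses up [tau * u] of [g = (tau + 1) * u], so the bias [KX * u ^+ 2] must stay below
   [u]. This holds because [u <= g < eps <= (1 + KX)^-1], the reason why [KX] is passed as [e] to
   [perturbation]. *)
have strict : g < eps -> forall v, v != 0 -> cl2norm (E 0 *m v) < g * cl2norm v.
  move=> g_eps v v0; have v_gt0 : 0 < cl2norm v.
    by rewrite lt_neqAle eq_sym cl2norm_ge0 andbT; apply: contra v0 => /eqP/cl2norm_eq0 ->.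
  rewrite EE mulmxDl (le_lt_trans (cl2normD _ _))//.
  apply: (@le_lt_trans _ _ (tau * u * cl2norm v + KX * u ^+ 2 * cl2norm v)).
    rewrite lerD// (le_trans (cl2norm_mulmx _ _))// ler_wpM2r ?cl2norm_ge0 ?frob//.
    exact: le_trans (frobenius_le_mxnorm1 _) (Bias_le 0%N).
  rewrite -mulrDl ltr_pM2r// gE mulrDl mul1r ltrD2l expr2 mulrA gtr_pMl//.
  have : u < (1 + KX)^-1 by rewrite (le_lt_trans u_g)// (lt_le_trans g_eps).
  rewrite -[ltRHS]mul1r ltr_pdivlMr ?ltr_wpDr//; lra.
have main := HD _ _ _ _ _ _ _ _ _ g QQR QRle g0 A0E A1E (E_le 0%N isT) (E_le 1%N isT) MP AF FY YF F_le Yle strict.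
rewrite (le_trans (spectral_norm_le _))// -[d%:R * Dx * cd]mulrA -mulrA ler_wpM2l//.
rewrite /algorithm_output YE (le_trans main)// -mulrA ler_wpM2l ?(ltW Dx0)//.
exact: sv_threshold_le.
Qed.

Lemma generic_negligible (disp : measure_display) (Omega : measurableType disp)
    (Pr : probability Omega R) (xt : 'I_d -> Omega -> 'cV[R]_d) :
  (forall m, uniform_on_sphere Pr (xt m)) -> mutually_independent Pr xt ->
  Pr.-negligible [set w | ~~ generic (xt^~ w)].
Proof.
move=> unif indep; pose Y i := xt (inord i).
have := @sample_matrix_generic R disp Omega Pr d r Y (fun j => f (b j)) wgt
  (fun i _ => unif (inord i)) _ resonant_free _ r (leqnn r).
have wgt0 i j : wgt i j != 0 by rewrite expf_neq0// resonant_neq0.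
move=> /(_ _ wgt0); rewrite (_ : [set w | ~~ generic (xt^~ w)] = [set w | \det (sample_matrix Y (fun j => f (b j)) wgt r w) = 0]); last first.
  by apply/seteqP; split => w /=; rewrite negbK => /eqP.
apply => k kr A B [B' vB' ->] vB.
have kd : (k < d)%N := leq_trans kr resonant_size.
(* A past cylinder together with an event for arm [k] is again a product event, so mutual
   independence applies to the index set with and without [k]. *)
pose Bk (i : 'I_d) := if i == inord k then B else B' i.
pose I1 : {set 'I_d} := finset (fun i : 'I_d => (i < k)%N).
have vBk i : vBorel (Bk i) by rewrite /Bk; case: ifP.
have kI1 : inord k \notin I1 by rewrite inE inordK// ltnn.
have P1 : Pr (\bigcap_(i in `I_k) Y i @^-1` B' i) = (\prod_(i in I1) Pr (xt i @^-1` Bk i))%E.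
  rewrite -indep//; congr (Pr _); apply/seteqP; split => w /= H i.
    move=> /=; rewrite inE => ik; rewrite /Bk ifN; last by apply: contraTneq ik => ->; rewrite inordK// ltnn.
    by have := H i ik; rewrite /Y inord_val.
  move=> ik; have id := ltn_trans ik kd.
  have := H (inord i); rewrite /= inE /Bk inordK// => /(_ ik).
  by rewrite ifN// -val_eqE /= !inordK// ltn_eqF.
have P2 : Pr ((\bigcap_(i in `I_k) Y i @^-1` B' i) `&` Y k @^-1` B) =
   (\prod_(i in (inord k |: I1)%SET) Pr (xt i @^-1` Bk i))%E.
  rewrite -indep//; congr (Pr _); apply/seteqP; split => w /=.
    move=> [H Hk] i /=; rewrite !inE => /orP[/eqP ->|ik]; first by rewrite /Bk eqxx.
    rewrite /Bk ifN; last by apply: contraTneq ik => ->; rewrite inordK// ltnn.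
    by have := H i ik; rewrite /Y inord_val.
  move=> H; split; last by have := H (inord k); rewrite /= !inE eqxx /Bk eqxx => /(_ isT).
  move=> i ik; have id := ltn_trans ik kd.
  have := H (inord i); rewrite /= !inE /Bk inordK// ik orbT => /(_ isT).
  by rewrite ifN// -val_eqE /= !inordK// ltn_eqF.
by rewrite P2 big_setU1//= P1 muleC /Bk eqxx.
Qed.

End Deterministic.

(** * Simultaneous control of all noise entries *)

Section NoiseEvent.
Context {R : realType} {disp : measure_display} {Omega : measurableType disp}.
Variable P : probability Omega R.
Variables (d' L : nat).
Local Notation d := d'.+1.
Variables (rho : R) (F : nat -> set (set Omega)).
Variables (x : nat -> Omega -> 'cV[R]_d) (eta : nat -> Omega -> R).
Hypothesis noise : cond_sub_gaussian_noise P rho F x eta.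

Let angle (j : nat) : R := 2 * pi * j%:R ^+ 2 / (4 * L%:R).

(** The tail bound is one-sided and real, so each complex entry gives four sums: cosine or sine,
    with either sign. *)
Let coeff (sgn trig : bool) (j : nat) : R :=
  (-1) ^+ sgn * (if trig then cos (angle j) else sin (angle j)).

Let time (N : nat) (e k l j : nat) : nat :=
  (2 * k * d + e * d + 2 * d ^ 2 * j + N + l.+1)%N.

Lemma noise_matrix_sqr_mod (noise' : nat -> R) (N e : nat) (k l : 'I_d) :
  cmod (noise_matrix d' L noise' N e k l) ^+ 2 =
  N%:R^-1 ^+ 2 * ((\sum_(j < N) coeff false true j * noise' (time N e k l j)) ^+ 2
   + (\sum_(j < N) coeff false false j * noise' (time N e k l j)) ^+ 2).
Proof.
rewrite mxE cmodM exprMn cmodV -(rmorph_nat (real_complex R)) cmod_real ger0_norm//.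
congr (_ * _); rewrite cmodE; congr (_ ^+ 2 + _ ^+ 2).
  rewrite (big_morph (@complex.Re R) (id1 := 0) (op1 := +%R)) => [|[? ?] [? ?]|]//.
  by apply: eq_bigr => j _; rewrite /= mul0r subr0 /coeff expr0 mul1r mulrC.
rewrite (big_morph (@complex.Im R) (id1 := 0) (op1 := +%R)) => [|[? ?] [? ?]|]//.
by apply: eq_bigr => j _; rewrite /= mul0r addr0 /coeff expr0 mul1r mulrC.
Qed.

(** Union bound over sign, trigonometric part, [e], row and column: [8 * d ^ 2] events of
    probability at most [delta / (8 * d ^ 2)] each. *)
Lemma noise_event (N : nat) (delta : R) : (0 < N)%N -> 0 < delta <= 1 ->
  exists B, [/\ measurable B, (P B <= delta%:E)%E & forall w, ~ B w ->
    forall e, (e < 2)%N -> \sum_k \sum_l cmod (noise_matrix d' L (eta^~ w) N e k l : R[i]) ^+ 2 <=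
     4 * d%:R ^+ 2 * rho ^+ 2 * ln (4 * d%:R ^+ 2 / delta) / N%:R].
Proof.
move=> N0 /andP[d0 d1].
have dR : 1 <= d%:R :> R by rewrite ler1n.
have d2 : 1 <= d%:R ^+ 2 :> R by rewrite exprn_ege1.
pose m : R := 8 * d%:R ^+ 2; have m1 : 1 <= m by rewrite /m; lra.
have m0 : 0 < m by exact: lt_le_trans m1.
pose l := ln (m / delta).
have l0 : 0 <= l by rewrite ln_ge0// ler_pdivlMr// mul1r (le_trans d1).
have expl : expR (- l) = delta / m by rewrite expRN lnK ?posrE ?divr_gt0// invf_div.
pose I : finType := (bool * bool * bool * 'I_d * 'I_d)%type.
pose tau (i : I) := time N i.1.1.2 i.1.2 i.2.
pose co (i : I) := coeff i.1.1.1.1 i.1.1.1.2.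
pose S (i : I) w := \sum_(j < N) co i j * eta (tau i j) w.
pose v (i : I) := rho ^+ 2 * \sum_(j < N) co i j ^+ 2.
pose A (i : I) := [set w | Num.sqrt (2 * v i * l) < S i w].
have tau0 i : (0 < tau i 0)%N by rewrite /tau /time addnS.
have tauS i j : (tau i j < tau i j.+1)%N.
  by rewrite /tau /time !ltn_add2r ltn_add2l ltn_pmul2l// muln_gt0 expn_gt0.
have mA i : measurable (A i).
  apply: measurable_gt; apply: measurable_sum => j; apply: measurable_funM => //.
  by apply: (measurable_noise noise); rewrite /tau /time addnS.
have PA i : (P (A i) <= (delta / m)%:E)%E by rewrite -expl; exact: (noise_sum_tail noise).
have [B [mB PB AB]] := union_bound (enum I) mA PA.
exists B; split => //.
  have cardI : (size (enum I))%:R = m.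
    by rewrite -cardE !card_prod !card_bool card_ord !natrM /m; ring.
  by apply: (le_trans PB); rewrite cardI mulrC divfK ?gt_eqF.
move=> w nBw e e2.
have notA i : S i w <= Num.sqrt (2 * v i * l).
  by rewrite leNgt; apply/negP => Si; apply: nBw; apply: (AB i) => //; rewrite mem_enum.
have eE : e = ((e == 1)%N : nat) by case: e e2 => [|[|]].
have sq (t : bool) (k l' : 'I_d) :
    (\sum_(j < N) coeff false t j * eta (time N e k l' j) w) ^+ 2 <=
    2 * (rho ^+ 2 * \sum_(j < N) coeff false t j ^+ 2) * l.
  set s := \sum_(j < N) _ * _; set V := rho ^+ 2 * _.
  have V0 : 0 <= V by rewrite mulr_ge0 ?sqr_ge0// sumr_ge0// => *; exact: sqr_ge0.
  have s1 : s <= Num.sqrt (2 * V * l).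
    by have := notA (false, t, (e == 1)%N, k, l'); rewrite /S /v /co /tau /= -eE.
  have s2 : - s <= Num.sqrt (2 * V * l).
    have := notA (true, t, (e == 1)%N, k, l'); rewrite /S /v /co /tau /= -eE.
    have -> : \sum_(j < N) coeff true t j * eta (time N e k l' j) w = - s.
      by rewrite /s -sumrN; apply: eq_bigr => j _; rewrite /coeff expr0 expr1; ring.
    by rewrite (eq_bigr (fun j : 'I_N => coeff false t j ^+ 2))// => j _; rewrite /coeff !exprMn sqrrN !expr1n.
  have Vl0 : 0 <= 2 * V * l by do 2!apply: mulr_ge0 => //.
  rewrite -(sqr_sqrtr Vl0) -[leLHS]real_normK ?num_real//.
  by rewrite ler_pXn2r ?nnegrE ?sqrtr_ge0// ler_norml lerNl s1 s2.
(* [8 * d ^ 2 / delta] is at most the square of [4 * d ^ 2 / delta]; this converts the logarithm of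
   the union bound into the one in the threshold. *)
have lle : l <= 2 * ln (4 * d%:R ^+ 2 / delta).
  have p0 : 0 < 4 * d%:R ^+ 2 / delta by rewrite divr_gt0//; lra.
  have i0 : 0 < delta^-1 by rewrite invr_gt0.
  rewrite mulr_natl mulr2n -lnM ?posrE// /l ler_ln ?posrE ?mulr_gt0 ?divr_gt0//.
  rewrite mulrA ler_pM2r// /m mulrAC.
  have : 1 <= delta^-1 by rewrite invf_ge1.
  set y := delta^-1 => y1; have : 1 <= d%:R ^+ 2 * y by rewrite mulr_ege1.
  set z := d%:R ^+ 2 in d2 *; nra.
have NR : 0 < N%:R :> R by rewrite ltr0n.
have r0 : 0 <= rho ^+ 2 by exact: sqr_ge0.
have entry (k l' : 'I_d) : cmod (noise_matrix d' L (eta^~ w) N e k l' : R[i]) ^+ 2 <=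
    4 * rho ^+ 2 * ln (4 * d%:R ^+ 2 / delta) / N%:R.
  rewrite noise_matrix_sqr_mod.
  (* The variances of the real and imaginary parts add up to [N] times [rho ^+ 2], so treating the
     parts separately costs no extra factor 2. *)
  have sumN : \sum_(j < N) coeff false true j ^+ 2 + \sum_(j < N) coeff false false j ^+ 2 = N%:R.
    rewrite -big_split (eq_bigr (fun=> 1)) ?sumr_const ?card_ord// => j _.
    by rewrite /coeff !expr0 !mul1r /= cos2Dsin2.
  rewrite (le_trans (ler_wpM2l _ (lerD (sq true k l') (sq false k l'))))//.
  rewrite -mulrDl -mulrDr -mulrDr sumN expr2 -(mulrA N%:R^-1).
  have -> : N%:R^-1 * (2 * (rho ^+ 2 * N%:R) * l) = 2 * rho ^+ 2 * l.
    by field; rewrite gt_eqF.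
  rewrite mulrC ler_wpM2r ?invr_ge0//.
  have := ler_wpM2l r0 lle; lra.
apply: (@le_trans _ _ (\sum_(k < d) \sum_(l' < d) (4 * rho ^+ 2 * ln (4 * d%:R ^+ 2 / delta) / N%:R))).
  by apply: ler_sum => k _; apply: ler_sum => l' _; exact: entry.
rewrite !sumr_const !card_ord -mulrnA -[X in X <= _]mulr_natl natrM.
by rewrite le_eqVlt; apply/orP; left; apply/eqP; ring.
Qed.

End NoiseEvent.

(** * Choice of the constant, of the limit matrix and of the event *)

Theorem theorem2 (R : realType) (d : nat) (M : 'M[R]_d) (theta : 'cV[R]_d)
    (L : nat) (d_gt0 : (0 < d)%N) (L_gt0 : (0 < L)%N) :
  exists2 C : ('I_d -> 'cV[R]_d) -> R, (forall X, 0 < C X) &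
  forall (D : set 'cV[R]_d)
    (disp : measure_display) (Omega : measurableType disp)
    (P : probability Omega R)
    (F : nat -> set (set Omega)) (x : nat -> Omega -> 'cV[R]_d)
    (eta : nat -> Omega -> R) (xt : 'I_d -> Omega -> 'cV[R]_d)
    (rho B mu Delta delta : R) (J : 'M[R[i]]_d) (t0 N : nat),
    (exists K : R, forall v, D v -> l2norm v <= K) ->
    [set v | l2norm v = 1] `<=` D ->
    (forall t w, (0 < t)%N -> D (x t w)) ->
    0 <= rho ->
    cond_sub_gaussian_noise P rho F x eta ->
    0 < B ->
    (forall t, (0 < t)%N -> l2norm (M ^+ t *m theta) <= B) ->
    (0 < t0)%N ->
    0 <= mu ->
    nearly_periodic mu L (fun s => M ^+ (t0 + s.-1) *m theta) ->
    is_jordan_form_of (cmx M) J ->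
    0 < Delta <= 1 ->
    (forall a : R[i], eigenvalue (cmx M) a -> cmod a < 1 ->
       cmod a <= 1 - Delta) ->
    0 < delta <= 1 ->
    (2 * d ^ 2 <= N)%N ->
    (16 * L ^ 2 <= N)%N ->
    - (d%:R - 1) * ln Delta / Delta
      + (ln (B * jordan_condition (cmx M) J ^+ 2) + d%:R + 6) / Delta
      + d%:R <= N%:R :> R ->
    (forall m, uniform_on_sphere P (xt m)) ->
    mutually_independent P xt ->
    (forall t (m : 'I_d) w, (N < t <= N + 2 * N * d ^ 2)%N ->
       arm_slot d N t = m.+1 -> x t w = xt m w) ->
    exists2 A : ('I_d -> 'cV[R]_d) -> 'M[R[i]]_d,
      (forall X a, eigenvalue (A X) a ->
         a = 0 \/ distinct_eigenvalue (cmx M) (cmx theta) d a) &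
      exists E : set Omega,
        [/\ measurable E, ((1 - delta)%:E <= P E)%E
          & forall w, E w ->
              spectral_norm
                (A (xt^~ w) -
                 algorithm_output M theta (eta^~ w) (xt^~ w) L N rho delta)
              <= C (xt^~ w) *
                 ((rho ^+ 2 * (ln (1 / delta) + 1) + 1) / Num.sqrt N%:R)].
Proof.
case: d => [//|d'] in M theta d_gt0 *.
(* The bound [B] is introduced only after the constant, so boundedness of the orbit is decided
   first; for an unbounded orbit any constant will do. *)
have [bnd|unbounded] := pselect (exists B, forall t, (0 < t)%N -> l2norm (M ^+ t *m theta) <= B);
  last first.
  exists (fun=> 1) => // D disp Omega P F x eta xt rho B mu Delta delta J t0 N _ _ _ _ _ _ HB.
  by case: unbounded; exists B.
have bo := bounded_orbit_cmx bnd; set Mc := cmx M in bo; set tc := cmx theta in bo.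
have [s [q comp]] := components_exist Mc tc.
have /choice[cK cKP] (a : R[i]) : exists cK : R[i] * R, a \in s ->
    let f := horner_mx Mc (q a) *m tc in
    (cK.1 != 0 -> [/\ cmod a = 1, f != 0 & Mc *m f = a *: f]) /\
    forall m t0 : nat, mxnorm1 (\sum_(j < m) chirp R L j *: (Mc ^+ (t0 + 2 * d'.+1 ^ 2 * j) *m f)
           - (m%:R * cK.1 * a ^+ t0) *: f) <= cK.2.
  have [sa|] := boolP (a \in s); last by exists (0, 0).
  have [_ _ /(_ a sa) Nf _] := comp.
  have [//|c [K cKP]] := @component_asymptotic _ _ _ _ _ _ L (2 * d'.+1 ^ 2) L_gt0 _ Nf (bounded_orbit_horner _ bo).
  by exists (c, K).
pose c a := (cK a).1; pose K a := (cK a).2.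
have c_spec a (sa : a \in s) := (cKP a sa).1.
have c_asym a (sa : a \in s) := (cKP a sa).2.
pose gen := generic M theta s q c.
pose lim := limit_matrix M theta s q c.
(* Arms in degenerate position receive the constant 1 here and the limit matrix 0 below; they occur
   with probability zero. *)
have /choice[C0 C0P] (X : 'I_d'.+1 -> 'cV[R]_d'.+1) : exists Cx : R, 0 < Cx /\ (gen X ->
    forall (N : nat) (rho delta : R) (noise : nat -> R), (0 < N)%N -> 0 < delta <= 1 ->
    (forall e, (e < 2)%N -> \sum_k \sum_l cmod (noise_matrix d' L noise N e k l) ^+ 2 <=
     4 * d'.+1%:R ^+ 2 * rho ^+ 2 * ln (4 * d'.+1%:R ^+ 2 / delta) / N%:R) ->
    spectral_norm (lim X - algorithm_output M theta noise X L N rho delta) <=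
    Cx * ((rho ^+ 2 * (ln (1 / delta) + 1) + 1) / Num.sqrt N%:R)).
  have [gX|] := boolP (gen X); last by exists 1.
  by have [Cx Cx0 HC] := algorithm_output_bound L_gt0 comp c_spec c_asym gX; exists Cx.
exists C0 => [X|]; first by have [] := C0P X.
move=> D disp Omega P F x eta xt rho B mu Delta delta J t0 N _ _ _ _ noise _ _ _ _ _ _ _ _.
move=> d01 dN _ _ unif indep _.
exists (fun X => if gen X then lim X else 0) => [X a|].
  case: ifPn => [gX|_ /eigenvalueP[v]].
    exact: (limit_matrix_eigenvalue comp c_spec).
  by rewrite mulmx0 => /esym/eqP; rewrite scaler_eq0 => /orP[/eqP|/eqP ->]; [left|rewrite eqxx].
have N0 : (0 < N)%N by apply: leq_trans dN; rewrite muln_gt0 expn_gt0.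
have [Z [mZ PZ HZ]] := noise_event L noise N0 d01.
have [Nul [mNul PNul HNul]] := generic_negligible comp c_spec unif indep.
(* [Nul] is a measurable null set containing the degenerate outcomes, so the event is measurable and
   only [Z] costs probability. *)
exists (~` (Z `|` Nul)); split.
- by apply: measurableC; exact: measurableU.
- rewrite probability_setC; last exact: measurableU.
  rewrite EFinB leeB// (le_trans (measureU2 _ mZ mNul))//.
  by rewrite -[leRHS]adde0; apply: leeD => //; move/eqP: PNul; rewrite eq_le => /andP[].
- move=> w /not_orP[nZ nNul].
  have gX : gen (xt^~ w) by have [//|/HNul] := boolP (gen (xt^~ w)).
  by rewrite gX; apply: (C0P _).2 => //; exact: HZ.
Qed.
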